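(* Let $\psi:\mathbb{R}\to[0,\infty)$ be a function such that $\int_{\mathbb{R}}\psi(x)\,dx<\infty$. For $u\ge0$ let $$H_n^{\mathrm{AD}}(u):=P_\Phi\Big\{\int_{-\infty}^\infty[F_n(\bar X_n+s_nt)-\Phi(t)]^2\psi(\Phi(t))\,d\Phi(t)\ge u\Big\},$$ and for $u\in\mathbb{R}$ let $$G^{\mathrm{AD}}(u):=\inf\Big\{J_\Phi(l): l\in(\mathcal{L}_\Phi^{\Upsilon_0})^*,\ \int_{-\infty}^\infty[x(a+(b-a^2)^{1/2}t)-\Phi(t)]^2\psi(\Phi(t))\,d\Phi(t)\ge u,\ l(f_t)=x(t)\ (t\in\mathbb{R}),\ l(g)=a,\ l(g^2)=b\Big\},$$ where $f_t(s)=I(s\le t)$ and $g(s)=s$ for $s\in\mathbb{R}$. Let $\{X_j\}_{j=1}^\infty$ be a sequence of i.i.d. real random variables with a continuous c.d.f. $F$ and finite second moment, and let $\mu_F=E_F[X_1]$ and $\sigma_F^2=\mathrm{Var}_F(X_1)$, $\sigma_F\geq 0$. Then, almost surely, $$-\lim_{\delta\to0+}G^{\mathrm{AD}}\Big(\int_{-\infty}^\infty[F(\mu_F+\sigma_Ft)-\Phi(t)]^2\psi(\Phi(t))\,d\Phi(t)+\delta\Big)$$ $$\le\liminf_{n\to\infty}n^{-1}\ln H_n^{\mathrm{AD}}\Big(\int_{-\infty}^\infty[F_n(\bar X_n+s_nt)-\Phi(t)]^2\psi(\Phi(t))\,d\Phi(t)\Big)$$ $$\le\limsup_{n\to\infty}n^{-1}\ln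 H_n^{\mathrm{AD}}\Big(\int_{-\infty}^\infty[F_n(\bar X_n+s_nt)-\Phi(t)]^2\psi(\Phi(t))\,d\Phi(t)\Big)$$ $$\le-\lim_{\delta\to0+}G^{\mathrm{AD}}\Big(\int_{-\infty}^\infty[F(\mu_F+\sigma_Ft)-\Phi(t)]^2\psi(\Phi(t))\,d\Phi(t)-\delta\Big).$$
   Context: $\Phi$ is the standard normal c.d.f. For real random variables $X_1,\dots,X_n$ ($n\ge2$): $F_n(t)=n^{-1}\sum_{j=1}^nI(X_j\le t)$, $\bar X_n=n^{-1}\sum_{j=1}^nX_j$, $s_n^2=(n-1)^{-1}\sum_{j=1}^n(X_j-\bar X_n)^2$, $s_n\ge0$. $P_\Phi$ and $E_\Phi$ denote probability and expectation when $X, X_1,X_2,\dots$ are i.i.d. standard normal. Thus $H_n^{\mathrm{AD}}$ is a deterministic function, computed under i.i.d. standard normal data; in the conclusion it is evaluated at the random value of the statistic computed from the sample $X_1,\dots,X_n$ with c.d.f. $F$. Let $\Upsilon_0(x)=e^{|x|}-|x|-1$. $\mathcal{L}_\Phi^{\Upsilon_0}$ is the space of measurable functions $f:\mathbb{R}\to\mathbb{R}$ with $E_\Phi[\Upsilon_0(\lambda f(X))]<\infty$ for some $\lambda>0$, a Banach space (modulo a.s. equality) with norm $N_{\Upsilon_0}(f)=\inf\{\lambda>0:E_\Phi[\Upsilon_0(f(X)/\lambda)]\le1\}$. $(\mathcal{L}_\Phi^{\Upsilon_0})^*$ is its dual space of continuous linear functionals. For $l\in(\mathcal{L}_\Phi^{\Upsilon_0})^*$,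 $$J_\Phi(l):=\sup_{f\in\mathcal{L}_\Phi^{\Upsilon_0}}\big(l(f)-\ln E_\Phi[e^{f(X)}]\big)\in[0,\infty].$$ In the infimum, $x$, $a$, $b$ are determined by $l$. If $J_\Phi(l)<\infty$ then $l(\mathbf 1)=1$ and $l(f)\ge0$ whenever $f(X)\ge0$ a.s., so $b\ge a^2$; functionals $l$ with $J_\Phi(l)=\infty$ play no role. Conventions: $\inf\emptyset=+\infty$, $\ln0=-\infty$. *)

(* Defs.v *)
From HB Require Import structures.
From mathcomp Require Import all_boot all_order all_algebra.
From mathcomp Require Import all_classical all_reals all_analysis.

Set Implicit Arguments.
Unset Strict Implicit.
Unset Printing Implicit Defensive.

Import Order.TTheory GRing.Theory Num.Theory.
Import numFieldNormedType.Exports.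

Local Open Scope classical_set_scope.
Local Open Scope ring_scope.

Section independence.
Context {d} {T : measurableType d} {R : realType} (P : probability T R).
Implicit Type X : nat -> {RV P >-> R}.

Definition mutually_independent X : Prop :=
  forall (J : seq nat) (B : nat -> set R), uniq J ->
    (forall j, measurable (B j)) ->
    fine (P (\bigcap_(j in [set` J]) (X j @^-1` B j))) =
    \prod_(j <- J) fine (P (X j @^-1` B j)).

Definition iid X : Prop :=
  mutually_independent X /\
  forall j (A : set R), measurable A ->
    distribution P (X j) A = distribution P (X 0%N) A.

Definition iid_std_normal X : Prop :=
  mutually_independent X /\
  forall j (A : set R), measurable A ->
    distribution P (X j) A = normal_prob 0 1 A.

End independence.

(* A sample X_1, ..., X_n is given by the first n terms x 0, ..., x (n - 1) of
   a sequence x. *)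
Section sample_statistics.
Context {R : realType}.
Implicit Types (n : nat) (x : nat -> R) (t : R).

Definition ecdf n x t : R := n%:R^-1 * \sum_(j < n) \1_(`]-oo, t]) (x j).

Definition smean n x : R := n%:R^-1 * \sum_(j < n) x j.

Definition ssd n x : R :=
  Num.sqrt ((n%:R - 1)^-1 * \sum_(j < n) (x j - smean n x) ^+ 2).

End sample_statistics.

Section orlicz.
Context {R : realType}.
Local Open Scope ereal_scope.

Definition Upsilon0 (x : R) : R := (expR `|x| - `|x| - 1)%R.

(* Elements are functions, not classes of a.s. equal functions; luxemburg is
   a seminorm on them. *)
Definition orlicz : set (R -> R) := [set f | measurable_fun setT f /\
  exists2 lam : R, (0 < lam)%R &
    'E_(normal_prob 0 1)[fun x => Upsilon0 (lam * f x)] < +oo].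

Definition luxemburg (f : R -> R) : R := inf [set lam : R | (0 < lam)%R /\
  'E_(normal_prob 0 1)[fun x => Upsilon0 (f x / lam)] <= 1].

(* Only the restriction of l to orlicz matters. Continuity for the seminorm
   forces l to agree on a.s. equal functions, so these are the continuous
   linear functionals on the quotient. *)
Definition orlicz_dual (l : (R -> R) -> R) : Prop :=
  (forall (c : R) (f g : R -> R), orlicz f -> orlicz g ->
     l (fun x => c * f x + g x)%R = (c * l f + l g)%R) /\
  (forall f : R -> R, orlicz f -> forall e : R, (0 < e)%R ->
     exists2 del : R, (0 < del)%R & forall h : R -> R, orlicz h ->
       (luxemburg (fun x => h x - f x) < del)%R -> (`|l h - l f| < e)%R).

Definition J_Phi (l : (R -> R) -> R) : \bar R :=
  ereal_sup [set (l f)%:E - lne 'E_(normal_prob 0 1)[fun x => expR (f x)]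
            | f in orlicz].

End orlicz.

Section anderson_darling.
Context {R : realType}.
Local Open Scope ereal_scope.

Definition Phi (t : R) : R := fine (normal_prob 0 1 `]-oo, t]).

(* The integral of [F (m + s t) - Phi t]^2 psi (Phi t) dPhi(t). It is finite
   when F is a c.d.f., since the integral of psi \o Phi against dPhi is the
   integral of psi over ]0, 1[. *)
Definition AD_functional (psi F : R -> R) (m s : R) : \bar R :=
  \int[normal_prob 0 1]_t
    ((F (m + s * t) - Phi t) ^+ 2 * psi (Phi t))%:E.

Definition AD_statistic (psi : R -> R) (n : nat) (x : nat -> R) : \bar R :=
  AD_functional psi (ecdf n x) (smean n x) (ssd n x).

(* P_Phi is realized on a probability space (T, P) carrying a sequence Z that
   is meant to satisfy iid_std_normal; the value depends only on the joint law
   of Z. *)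
Definition H_AD d (T : measurableType d) (P : probability T R)
    (Z : nat -> {RV P >-> R}) (psi : R -> R) (n : nat) (u : R) : \bar R :=
  P [set w | u%:E <= AD_statistic psi n (fun j => Z j w)].

Definition G_AD (psi : R -> R) (u : R) : \bar R :=
  ereal_inf [set J_Phi l | l in [set l | orlicz_dual l /\
    let x := fun t : R => l \1_(`]-oo, t]) in
    let a := l (fun s => s) in
    let b := l (fun s => s ^+ 2)%R in
    u%:E <= AD_functional psi x a (Num.sqrt (b - a ^+ 2))]].

End anderson_darling.

(* Main.v *)
Require Import Defs.
From HB Require Import structures.
From mathcomp Require Import all_boot all_order all_algebra.
From mathcomp Require Import all_classical all_reals all_analysis.
From mathcomp Require Import measurable_realfun lra ring.

(* Idea. A bound J_Phi l <= J0 < oo says that l f <= J0 + ln c whenever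
   E e^f <= c. It forces l to be a positive functional with l 1 = 1 whose
   "c.d.f." t |-> l(1_(-oo, t]) has a modulus of continuity depending only on J0
   and whose second moment is bounded; but l(x^2; |x| > M) need not tend to 0,
   as l may be singular at infinity. Up to an arbitrarily small error the
   statistic is therefore a function of finitely many numbers: the masses of the
   cells of a partition of ]-M, M] and the outer second moment.

   Upper bound. The method of types for the cells, combined with the tilt
   e^(lam x^2), lam < 1/2 (the critical exponent of x^2 under the normal law),
   outside ]-M, M], bounds H_n by the exponent "relative entropy of the cell
   masses plus half the outer second moment". Any such profile is realized by a
   functional with a bounded density, whose tail mass q sits next to a point N
   with N^2 q equal to the outer second moment, at a cost close to that exponent.

   Lower bound. For l with J_Phi l < oo the same finite profile has at most that
   exponent (apply the bound on l to the optimal test function), and sampling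
   from the corresponding density, multinomially over the cells and the short
   tail interval, realizes it.

   Finally the statistic of the sample converges almost surely to its value at
   F, by Etemadi's strong law for X, X^2 and the indicators, and the continuity
   of F. *)

Set Implicit Arguments.
Unset Strict Implicit.
Unset Printing Implicit Defensive.

Import Order.TTheory GRing.Theory Num.Theory.
Import numFieldNormedType.Exports.

Local Open Scope classical_set_scope.
Local Open Scope ring_scope.

(** * Integrals and independence *)

(** The obstacle is that x^2 lies in the Orlicz space but is not a limit there of bounded functions,
    since e^(c x^2) is integrable only for c < 1/2. A mass q -> 0 near N with N^2 q = b shifts the
    second moment by b and leaves the limiting c.d.f. unchanged. The Gaussian mass near N is about
    e^(-N^2/2), so this costs about q N^2 / 2 = b / 2; conversely the test function lam x^2 outside
    ]-M, M], whose exponential has small integral there for large M, shows a cost of at least lam b.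
    As lam tends to 1/2 the two agree, so singular functionals never have to be described.

    Empirical means and functionals of finite [J_Phi] are both positive normalized functionals on
    functions of quadratic growth ([posfun]), so one comparison lemma serves both bounds. Empirical
    measures have atoms and satisfy no entropy bound; continuity is always borrowed from the other
    functional. [G_AD] is only known to be monotone: the margin in the one-sided limits absorbs
    every approximation error. *)

Section ge0_integral_EFin.
Context d (T : measurableType d) (R : realType) (P : probability T R).
Implicit Types f g : T -> R.

Lemma le_integral_EFin f g : measurable_fun setT f -> measurable_fun setT g ->
  (forall x, 0 <= f x) -> (forall x, f x <= g x) ->
  (\int[P]_x (f x)%:E <= \int[P]_x (g x)%:E)%E.
Proof.
move=> mf mg f0 fg; apply: ge0_le_integral => //=.
- by move=> x _; rewrite lee_fin.
- exact/measurable_EFinP.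
- exact/measurable_EFinP.
- by move=> x _; rewrite lee_fin.
Qed.

Lemma integralD_EFin_ge0 f g : measurable_fun setT f -> measurable_fun setT g ->
  (forall x, 0 <= f x) -> (forall x, 0 <= g x) ->
  (\int[P]_x (f x + g x)%:E = \int[P]_x (f x)%:E + \int[P]_x (g x)%:E)%E.
Proof.
move=> mf mg f0 g0; under eq_integral do rewrite EFinD.
by rewrite ge0_integralD//=;
  [move=> x _; rewrite lee_fin|exact/measurable_EFinP|
   move=> x _; rewrite lee_fin|exact/measurable_EFinP].
Qed.

Lemma integralZl_EFin_ge0 (c : R) f : measurable_fun setT f ->
  (forall x, 0 <= f x) -> 0 <= c ->
  (\int[P]_x (c * f x)%:E = c%:E * \int[P]_x (f x)%:E)%E.
Proof.
move=> mf f0 c0; under eq_integral do rewrite EFinM.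
by rewrite ge0_integralZl//=;
  [exact/measurable_EFinP|move=> x _; rewrite lee_fin].
Qed.

Lemma integral_sum_EFin_ge0 (I : Type) (s : seq I) (F : I -> T -> R) :
  (forall i, measurable_fun setT (F i)) -> (forall i x, 0 <= F i x) ->
  (\int[P]_x (\sum_(i <- s) F i x)%:E = \sum_(i <- s) \int[P]_x (F i x)%:E)%E.
Proof.
move=> mF F0; under eq_integral do rewrite -sumEFin.
rewrite ge0_integral_sum//.
- by move=> i; apply/measurable_EFinP.
- by move=> i x _; rewrite lee_fin.
Qed.

Lemma integral_indicT (A : set T) : measurable A ->
  (\int[P]_x (\1_A x)%:E = P A)%E.
Proof. by move=> mA; rewrite integral_indic// setIT. Qed.

Lemma integral_cstP (c : R) : (\int[P]_x c%:E = c%:E)%E.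
Proof. by rewrite integral_cst//= probability_setT mule1. Qed.

End ge0_integral_EFin.

Section weighted_integral.
Context d1 (T1 : measurableType d1) d2 (T2 : measurableType d2) (R : realType).
Variables (mu1 : {measure set T1 -> \bar R}) (mu2 : {measure set T2 -> \bar R}).
Context d (S : measurableType d).
Import HBNNSimple.

Lemma weighted_integral_nnsfun (W : T1 -> R) (X : T1 -> S)
    (mW : measurable_fun setT W) (mX : measurable_fun setT X)
    (W0 : forall x, 0 <= W x) (g : {nnsfun S >-> R}) :
  (\int[mu1]_x (W x * g (X x))%:E =
   \sum_(k \in range g) k%:E *
     \int[mu1]_x (W x * \1_(g @^-1` [set k]) (X x))%:E)%E.
Proof.
have mI k : measurable_fun setT (fun x => W x * \1_(g @^-1` [set k]) (X x)).
  by apply: measurable_funM => //; exact: measurableT_comp.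
have gk x k : 0 <= k * (W x * \1_(g @^-1` [set k]) (X x)).
  have [k0|k0] := leP 0 k; first by rewrite !mulr_ge0.
  by rewrite preimage_nnfun0// indicE in_set0 mulr0 mulr0.
transitivity (\int[mu1]_x (\sum_(k \in range g)
    (k * (W x * \1_(g @^-1` [set k]) (X x)))%:E))%E.
  apply: eq_integral => x _; rewrite fimfunE fsumEFin//; congr EFin.
  rewrite mulr_fsumr.
  by apply: eq_fsbigr => k _; rewrite mulrCA.
rewrite ge0_integral_fsum //; last 2 first.
- by move=> k; apply/measurable_EFinP; exact: measurable_funM.
- by move=> k x _; rewrite lee_fin.
apply: eq_fsbigr => k; rewrite inE => -[/= t _ <-].
under eq_integral do rewrite EFinM.
rewrite ge0_integralZl//; first exact/measurable_EFinP.
- by move=> x _; rewrite lee_fin mulr_ge0.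
- by rewrite lee_fin.
Qed.

Lemma weighted_integral_cvg (W : T1 -> R) (X : T1 -> S)
    (mW : measurable_fun setT W) (mX : measurable_fun setT X)
    (W0 : forall x, 0 <= W x) (h : S -> R) (h0 : forall y, 0 <= h y)
    (mh : measurable_fun setT (EFin \o h)) :
  (\int[mu1]_x (W x * nnsfun_approx measurableT mh n (X x))%:E @[n --> \oo]
   --> \int[mu1]_x (W x * h (X x))%:E)%E.
Proof.
have cvh y := @cvg_nnsfun_approx _ _ _ _ measurableT _ mh
   (fun x _ => h0 x) y I.
have -> : (fun x => (W x * h (X x))%:E) = (fun x => limn (fun n =>
    (W x * nnsfun_approx measurableT mh n (X x))%:E)).
  apply/funext => x; apply/esym/cvg_lim => //.
  apply: cvg_EFin; first by near=> n.
  apply: cvgMl_tmp; exact: (fine_cvg (cvh (X x))).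
apply: (cvg_monotone_convergence measurableT).
- move=> n; apply/measurable_EFinP; apply: measurable_funM => //.
  exact: measurableT_comp.
- by move=> n x _; rewrite lee_fin mulr_ge0.
- move=> x _ m n mn; rewrite lee_fin ler_wpM2l//.
  by have /lefP := nd_nnsfun_approx measurableT mh mn; exact.
Unshelve. all: by end_near. Qed.

End weighted_integral.

Section weighted_integral_eq.
Import HBNNSimple.

(** Agreement on indicators passes to simple functions by linearity and to [h] by monotone
    convergence. The weights let it serve three times: as a density (Gaussian integrals), as the
    constant 1 (equality in law) and as a product of independent factors. *)
Lemma weighted_integral_eq d1 (T1 : measurableType d1) d2
    (T2 : measurableType d2) d (S : measurableType d) (R : realType)
    (mu1 : {measure set T1 -> \bar R}) (mu2 : {measure set T2 -> \bar R})
    (W1 : T1 -> R) (X1 : T1 -> S) (W2 : T2 -> R) (X2 : T2 -> S)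
    (mW1 : measurable_fun setT W1) (mX1 : measurable_fun setT X1)
    (mW2 : measurable_fun setT W2) (mX2 : measurable_fun setT X2)
    (W10 : forall x, 0 <= W1 x) (W20 : forall x, 0 <= W2 x)
    (W12 : forall B, measurable B ->
      (\int[mu1]_x (W1 x * \1_B (X1 x))%:E =
       \int[mu2]_x (W2 x * \1_B (X2 x))%:E)%E)
    (h : S -> R) (h0 : forall y, 0 <= h y) (mh : measurable_fun setT h) :
  (\int[mu1]_x (W1 x * h (X1 x))%:E = \int[mu2]_x (W2 x * h (X2 x))%:E)%E.
Proof.
have mh' : measurable_fun setT (EFin \o h) by exact/measurable_EFinP.
have c1 := weighted_integral_cvg (mu1 := mu1) mW1 mX1 W10 h0 mh'.
have c2 := weighted_integral_cvg (mu1 := mu2) mW2 mX2 W20 h0 mh'.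
apply: cvg_unique c1 _ => //; apply: cvg_trans c2; apply: near_eq_cvg.
near=> n; rewrite !weighted_integral_nnsfun//.
apply: eq_fsbigr => k _; rewrite W12//.
Unshelve. all: by end_near. Qed.

End weighted_integral_eq.

Section independence_expectation.
Context d (T : measurableType d) (R : realType) (P : probability T R).

(** [mutually_independent] speaks of events only. The indices in [J'] still carry indicators, those
    in [J] already carry functions; the induction moves one index at a time from the first list to
    the second. *)
Lemma mutually_independent_expectation_prod (X : nat -> {RV P >-> R})
    (h : nat -> R -> R) (c : nat -> R) (J J' : seq nat) (B : nat -> set R) :
  mutually_independent X ->
  (forall j y, 0 <= h j y) -> (forall j, measurable_fun setT (h j)) ->
  (forall j, \int[P]_w (h j (X j w))%:E = (c j)%:E)%E ->
  (forall j, measurable (B j)) -> uniq (J ++ J') ->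
  (\int[P]_w ((\prod_(j <- J) h j (X j w)) *
              (\prod_(j <- J') \1_(B j) (X j w)))%:E =
   ((\prod_(j <- J) c j) * \prod_(j <- J') fine (P (X j @^-1` B j)))%:E)%E.
Proof.
move=> Xind h0 mh hc; elim: J J' B => [|a J IH] J' B mB.
  rewrite cat0s => uJ'; rewrite big_nil mul1r -(Xind _ _ uJ' mB).
  have mI : measurable (\bigcap_(j in [set` J']) (X j @^-1` B j)).
    by apply: fin_bigcap_measurable => // j _; exact: measurable_funPTI.
  rewrite fineK ?fin_num_measure// -[X in P X]setIT -integral_indic//.
  apply: eq_integral => w _; rewrite big_nil mul1r; congr EFin.
  rewrite indicE; elim: J' {uJ' mI} => [|j J' IHJ].
    by rewrite big_nil mem_set.
  rewrite big_cons IHJ indicE -natrM mulnb; congr (_%:R); congr nat_of_bool.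
  apply/idP/idP.
    move/andP => [/set_mem Bj /set_mem BJ]; apply/mem_set => i /=.
    by rewrite inE => /orP[/eqP->//|iJ]; exact: BJ.
  move=> /set_mem BJ; apply/andP; split; apply/mem_set.
    by apply: BJ; rewrite /= inE eqxx.
  by move=> i iJ; apply: BJ; rewrite /= inE iJ orbT.
move=> uJ; have /= := uJ; rewrite mem_cat negb_or => /andP[/andP[aJ aJ'] uJJ'].
pose W w := (\prod_(j <- J) h j (X j w)) * \prod_(j <- J') \1_(B j) (X j w).
have mW : measurable_fun setT W.
  apply: measurable_funM; apply: measurable_prod => j _.
    exact: measurableT_comp.
  exact: measurableT_comp.
have W0 w : 0 <= W w by apply: mulr_ge0; apply: prodr_ge0 => j _.
set C := (\prod_(j <- J) c j) * \prod_(j <- J') fine (P (X j @^-1` B j)).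
have c0 j : 0 <= c j.
  by rewrite -lee_fin -hc; apply: integral_ge0 => w _; rewrite lee_fin.
have C0 : 0 <= C by apply: mulr_ge0; apply: prodr_ge0 => // j _; rewrite fine_ge0.
have -> : (\int[P]_w ((\prod_(j <- a :: J) h j (X j w)) *
     (\prod_(j <- J') \1_(B j) (X j w)))%:E = \int[P]_w (W w * h a (X a w))%:E)%E.
  apply: eq_integral => w _; congr EFin.
  by rewrite big_cons /W -mulrA mulrC.
(* The other factors [W] weigh every event of [X a] exactly as their constant expectation [C] does;
   this is the induction hypothesis with [a] added to [J']. *)
rewrite (@weighted_integral_eq _ _ _ _ _ _ _ P P W (X a) (cst C) (X a))//=.
- under eq_integral do rewrite EFinM.
  rewrite ge0_integralZl//; last 2 first.
  + by apply/measurable_EFinP; exact: measurableT_comp.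
  + by move=> w _; rewrite lee_fin.
  by rewrite hc -EFinM big_cons /C mulrC mulrA.
- move=> A mA; pose B' j := if j == a then A else B j.
  have mB' j : measurable (B' j) by rewrite /B'; case: ifP.
  have B'J j : j \in J' -> B' j = B j.
    by move=> jJ'; rewrite /B'; case: eqP => // ja; move: aJ'; rewrite -ja jJ'.
  have := IH (a :: J') B' mB'; rewrite uniq_catC/= mem_cat negb_or aJ aJ'/=.
  rewrite uniq_catC => /(_ uJJ').
  rewrite big_cons (_ : B' a = A); last by rewrite /B' eqxx.
  have -> : \prod_(j <- J') fine (P (X j @^-1` B' j)) =
            \prod_(j <- J') fine (P (X j @^-1` B j)).
    by apply: eq_big_seq => j jJ'; rewrite B'J.
  move=> IHB; transitivity (C * fine (P (X a @^-1` A)))%:E; last first.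
    under eq_integral do rewrite EFinM.
    have mXA : measurable (X a @^-1` A) by exact: measurable_funPTI.
    rewrite ge0_integralZl//; last first.
      by apply/measurable_EFinP; exact: measurableT_comp.
    rewrite [X in (_ * X)%E](_ : _ = P (X a @^-1` A)).
      by rewrite EFinM fineK// fin_num_measure.
    by rewrite -[in RHS](setIT (X a @^-1` A)) -integral_indic.
  rewrite [C * _]mulrC /C mulrCA -IHB; apply: eq_integral => w _; congr EFin.
  rewrite big_cons (_ : B' a = A); last by rewrite /B' eqxx.
  rewrite /W -mulrA; congr (_ * _); rewrite mulrC; congr (_ * _).
  by apply: eq_big_seq => j jJ'; rewrite B'J.
Qed.

Lemma expectation_prod (X : nat -> {RV P >-> R})
    (h : nat -> R -> R) (c : nat -> R) (J : seq nat) :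
  mutually_independent X ->
  (forall j y, 0 <= h j y) -> (forall j, measurable_fun setT (h j)) ->
  (forall j, \int[P]_w (h j (X j w))%:E = (c j)%:E)%E -> uniq J ->
  (\int[P]_w (\prod_(j <- J) h j (X j w))%:E = (\prod_(j <- J) c j)%:E)%E.
Proof.
move=> Xind h0 mh hc uJ.
have := @mutually_independent_expectation_prod X h c J [::] (fun=> setT) Xind h0 mh
   hc (fun=> measurableT).
rewrite cats0 big_nil mulr1 => <-//; apply: eq_integral => w _.
by rewrite big_nil mulr1.
Qed.

End independence_expectation.

(** * The standard normal law *)

Section probability_cdf.
Context {R : realType}.
Local Open Scope measure_display_scope.

Lemma probability_eq_cdf (P Q : probability (measurableTypeR R) R) :
  (forall x : R, P `]-oo, x]%classic = Q `]-oo, x]%classic) ->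
  forall A, measurable A -> P A = Q A.
Proof.
move=> PQ A mA.
apply: (@measure_unique _ R (measurableTypeR R) (@RGenOInfty.G R)
  (fun n => `]- n%:R, +oo[%classic)) => //.
- exact: RGenOInfty.measurableE.
- move=> _ _ [x ->] [y ->]; exists (Num.max x y).
  by apply/seteqP; split => z /=; rewrite !in_itv/= !andbT gt_max => /andP.
- by move=> n; exists (- n%:R).
- rewrite -subTset => x _; exists (Num.bound `|x : R|) => //=.
  by rewrite in_itv/= andbT ltrNl (le_lt_trans (ler_norm _))// normrN;
    exact: (@archi_boundP R `|x| (normr_ge0 x)).
- move=> _ [x ->].
  have E : `]x, +oo[%classic = ~` (`]-oo, x]%classic : set (measurableTypeR R)).
    by rewrite setCitvl.
  rewrite E; apply: etrans (probability_setC P _) _ => //.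
  by rewrite PQ; apply/esym; exact: (probability_setC Q).
- by move=> n; rewrite (le_lt_trans (probability_le1 _ _))// ?ltry.
Qed.

End probability_cdf.

Section gaussian.
Context {R : realType}.
Local Notation N01 := (@normal_prob R 0 1).
Local Notation leb := (@lebesgue_measure R).
Local Notation pdf := (@normal_pdf R 0 1).

Lemma normal_pdf01E (x : R) : pdf x = normal_peak 1 * expR (- x ^+ 2 / 2).
Proof.
by rewrite normal_pdfE ?oner_eq0// /normal_fun subr0 expr1n.
Qed.

Lemma normal_peak1_le1 : normal_peak 1 <= 1 :> R.
Proof.
rewrite /normal_peak invf_le1 ?sqrtr_gt0//.
  by rewrite -[leLHS]sqrtr1 ler_wsqrtr// expr1n mul1r; have := pi_ge2 R; lra.
by rewrite expr1n mul1r mulrn_wgt0// pi_gt0.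
Qed.

Lemma normal_pdf01_le1 (x : R) : pdf x <= 1.
Proof.
by rewrite (le_trans (normal_pdf_ub _ _ _)) ?oner_eq0// normal_peak1_le1.
Qed.

Lemma normal_prob_le_lebesgue (A : set R) : measurable A -> (N01 A <= leb A)%E.
Proof.
move=> mA; rewrite /normal_prob -[leRHS]mul1e -integral_cst//.
apply: ge0_le_integral => //=.
- by move=> x _; rewrite lee_fin normal_pdf_ge0.
- by apply/measurable_EFinP/measurable_funTS; exact: measurable_normal_pdf.
- by move=> x _; rewrite lee_fin normal_pdf01_le1.
Qed.

Lemma normal_prob_itv_le (s t : R) : s <= t -> fine (N01 `]s, t]) <= t - s.
Proof.
move=> st; rewrite -lee_fin fineK ?fin_num_measure//.
rewrite (le_trans (normal_prob_le_lebesgue _))// lebesgue_measure_itv/= lte_fin.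
by case: ifPn => // _; rewrite lee_fin subr_ge0.
Qed.

Lemma normal_prob_itv_ge (s t K : R) : s <= t ->
  (forall x, s < x <= t -> x ^+ 2 <= K) ->
  normal_peak 1 * expR (- K / 2) * (t - s) <= fine (N01 `]s, t]).
Proof.
move=> st xK; rewrite -lee_fin fineK ?fin_num_measure//.
set c := normal_peak 1 * _.
have c0 : 0 <= c by rewrite mulr_ge0 ?normal_peak_ge0 ?expR_ge0.
rewrite (@le_trans _ _ (\int[leb]_(x in `]s, t]) c%:E)%E)//.
  rewrite (_ : (\int[leb]_(x in `]s, t]) c%:E = c%:E * leb `]s, t])%E); last first.
    exact: integral_cst.
  rewrite lebesgue_measure_itv/= lte_fin EFinM lee_wpmul2l ?lee_fin//.
  by case: ifPn => //; rewrite -leNgt lee_fin subr_le0.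
apply: ge0_le_integral => //=.
- by apply/measurable_EFinP/measurable_funTS; exact: measurable_normal_pdf.
- move=> x; rewrite in_itv/= => xst; rewrite lee_fin normal_pdf01E.
  rewrite ler_wpM2l ?normal_peak_ge0// ler_expR !mulNr lerN2.
  by rewrite ler_wpM2r ?invr_ge0// xK.
Qed.

Lemma normal_prob_itv_gt0 (s t : R) : s < t -> 0 < fine (N01 `]s, t]).
Proof.
move=> st; apply: (lt_le_trans _ (@normal_prob_itv_ge s t (s ^+ 2 + t ^+ 2) (ltW st) _)).
  by rewrite !mulr_gt0 ?subr_gt0// ?expR_gt0 ?normal_peak_gt0 ?oner_eq0.
by move=> x /andP[sx xt]; have [] := leP 0 x; nra.
Qed.

Lemma ge0_integral_normal_prob (h : R -> R) :
  (forall x, 0 <= h x) -> measurable_fun setT h ->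
  (\int[N01]_x (h x)%:E = \int[leb]_x (h x * pdf x)%:E)%E.
Proof.
move=> h0 mh.
have mpdf : measurable_fun setT pdf by exact: measurable_normal_pdf.
have := @weighted_integral_eq _ _ _ _ _ R R N01 leb (cst 1) id pdf id _ _ _ _ _ _ _ h h0 mh.
rewrite /=; under eq_integral do rewrite mul1r.
move=> ->//.
- by apply: eq_integral => x _; rewrite mulrC.
- by move=> x; exact: normal_pdf_ge0.
- move=> B mB; under eq_integral do rewrite mul1r.
  rewrite integral_indic//= setIT /normal_prob integral_mkcond/=.
  apply: eq_integral => x _; rewrite patchE indicE.
  by case: ifPn => _; rewrite ?mulr1 ?mulr0.
Qed.

(** Multiplying the standard normal density by e^(a x^2) gives a multiple of the normal density of
    variance 1 / (1 - 2 a), which is where a < 1/2 enters. *)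
Lemma gaussian_exp_square (a : R) : a < 1 / 2 -> exists2 c : R, 0 <= c &
  (\int[N01]_x (expR (a * x ^+ 2))%:E = c%:E)%E.
Proof.
move=> a2; pose s := Num.sqrt (1 - 2 * a)^-1.
have a0 : 0 < 1 - 2 * a by lra.
have s0 : 0 < s by rewrite sqrtr_gt0 invr_gt0.
have s2 : s ^+ 2 = (1 - 2 * a)^-1 by rewrite sqr_sqrtr// invr_ge0 ltW.
exists (normal_peak 1 / normal_peak s).
  by rewrite divr_ge0 ?normal_peak_ge0.
rewrite ge0_integral_normal_prob//; last first.
  by apply: measurableT_comp => //; apply: measurable_funM => //; exact: exprn_measurable.
transitivity (\int[leb]_x ((normal_peak 1 / normal_peak s)%:E * (normal_pdf 0 s x)%:E))%E.
  apply: eq_integral => x _; rewrite normal_pdf01E normal_pdfE ?gt_eqF//.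
  rewrite -EFinM; congr EFin.
  rewrite [RHS]mulrA divfK ?gt_eqF ?normal_peak_gt0 ?gt_eqF//.
  rewrite mulrCA -expRD; congr (_ * expR _).
  rewrite subr0 s2 -mulr_natr; field.
  by rewrite gt_eqF//=; lra.
rewrite ge0_integralZl//=.
- by rewrite integral_normal_pdf mule1.
- by apply/measurable_EFinP; exact: measurable_normal_pdf.
- by move=> x _; rewrite lee_fin normal_pdf_ge0.
- by rewrite lee_fin divr_ge0 ?normal_peak_ge0.
Qed.

(** For [b] strictly between [a] and 1/2 the larger exponential is still integrable, and outside
    ]-M, M] a factor e^(-(b - a) M) is gained, because x^2 >= M there once M >= 1. *)
Lemma gaussian_exp_square_tail (a e : R) : 0 <= a -> a < 1 / 2 -> 0 < e ->
  exists2 M0 : R, 1 <= M0 & forall M, M0 <= M ->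
  (\int[N01]_x (expR (a * x ^+ 2) * \1_(~` `]- M, M]) x)%:E <= e%:E)%E.
Proof.
move=> a0 a2 e0; pose b := (a + 1 / 2) / 2.
have [ab b2] : a < b /\ b < 1 / 2 by rewrite /b; lra.
have [c c0 bc] := gaussian_exp_square b2.
pose M0 := Num.max 1 (c / ((b - a) * e)); exists M0; first by rewrite le_max lexx.
move=> M; rewrite ge_max => /andP[M1 cM].
have me k : measurable_fun setT (fun x : R => expR (k * x ^+ 2)).
  by apply: measurableT_comp => //; apply: measurable_funM => //; exact: exprn_measurable.
apply: (@le_trans _ _ (\int[N01]_x ((expR (- ((b - a) * M)))%:E * (expR (b * x ^+ 2))%:E))%E).
  apply: ge0_le_integral => //=.
  - apply/measurable_EFinP; apply: measurable_funM; first exact: me.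
    by apply: measurable_indic; exact: measurableC.
  - by apply/measurable_EFinP; apply: measurable_funM => //; exact: me.
  - move=> x _; rewrite -EFinM lee_fin indicE.
    case: (boolP (x \in _)) => [|_]; last by rewrite mulr0 mulr_ge0// expR_ge0.
    rewrite inE/= in_itv/= mulr1 -expRD ler_expR => /negP; rewrite negb_and -leNgt -ltNge => xM.
    have : M <= x ^+ 2 by case/orP: xM => xM; nra.
    by move=> Mx; nra.
rewrite ge0_integralZl//=.
- rewrite bc -EFinM lee_fin.
  have := expR_ge1Dx ((b - a) * M).
  have E0 := expR_gt0 ((b - a) * M).
  rewrite expRN => E1; rewrite mulrC ler_pdivrMr//.
  have : c <= M * ((b - a) * e) by rewrite -ler_pdivrMr// mulr_gt0// subr_gt0.
  nra.
- by apply/measurable_EFinP; exact: me.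
Qed.

End gaussian.

Section gaussian_cdf.
Context {R : realType}.
Local Notation N01 := (@normal_prob R 0 1).
Local Notation leb := (@lebesgue_measure R).

Lemma PhiE (t : R) : (Phi t)%:E = N01 `]-oo, t].
Proof. by rewrite /Phi fineK// fin_num_measure. Qed.

Lemma Phi_ge0 (t : R) : 0 <= Phi t.
Proof. by rewrite fine_ge0. Qed.

Lemma Phi_le1 (t : R) : Phi t <= 1.
Proof. by rewrite -lee_fin PhiE probability_le1. Qed.

Lemma PhiB (s t : R) : s <= t -> Phi t - Phi s = fine (N01 `]s, t]).
Proof.
move=> st; apply/EFin_inj; rewrite EFinB (PhiE t) (PhiE s).
rewrite (@fineK _ (N01 `]s, t])); last exact: fin_num_measure.
have -> : `]-oo, t]%classic = `]-oo, s]%classic `|` `]s, t]%classic.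
  apply/seteqP; split => x /=; rewrite !in_itv/=.
    by move=> xt; have [xs|sx] := leP x s; [left|right].
  by case=> [xs|/andP[_ //]]; exact: le_trans st.
rewrite measureU//; first by rewrite addeAC subee ?add0e// fin_num_measure.
apply/seteqP; split => x //=; rewrite !in_itv/= => -[xs /andP[sx _]].
by move: sx; rewrite ltNge xs.
Qed.

Lemma Phi_nondecreasing : {homo Phi : s t / s <= t :> R}.
Proof. by move=> s t st; rewrite -subr_ge0 PhiB// fine_ge0. Qed.

Lemma Phi_increasing : {homo Phi : s t / s < t :> R}.
Proof.
by move=> s t st; rewrite -subr_gt0 PhiB ?ltW// normal_prob_itv_gt0.
Qed.

Lemma Phi_lipschitz (s t : R) : s <= t -> Phi t - Phi s <= t - s.
Proof. by move=> st; rewrite PhiB// normal_prob_itv_le. Qed.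

Lemma Phi_continuous : continuous (@Phi R).
Proof.
move=> x; apply/cvgrPdist_le => /= e e0; near=> y.
have xy : `|x - y| <= e by near: y; exact: (@cvgr_dist_le _ _ _ (nbhs x) _ id).
rewrite (le_trans _ xy)//; have [le_yx|/ltW le_xy] := leP y x.
  by rewrite !ger0_norm ?subr_ge0 ?Phi_nondecreasing// Phi_lipschitz.
rewrite distrC [leRHS]distrC.
by rewrite !ger0_norm ?subr_ge0 ?Phi_nondecreasing// Phi_lipschitz.
Unshelve. all: by end_near. Qed.

Lemma Phi_measurable : measurable_fun setT (@Phi R).
Proof. exact: continuous_measurable_fun Phi_continuous. Qed.

(** The identity as a random variable under [N01] has c.d.f. [Phi], so the general limits of c.d.f.s
    at infinity apply. *)
Let idTR : measurableTypeR R -> R := idfun.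

#[local] HB.instance Definition _ :=
  @isMeasurableFun.Build _ _ _ _ idTR (@measurable_id _ _ setT).

Lemma Phi_cvgy : Phi t @[t --> +oo] --> (1 : R).
Proof. exact: (fine_cvg (cvg_cdfy1 (idTR : {RV N01 >-> R}))). Qed.

Lemma Phi_cvgNy : Phi t @[t --> -oo] --> (0 : R).
Proof. exact: (fine_cvg (cvg_cdfNy0 (idTR : {RV N01 >-> R}))). Qed.

Lemma Phi_surjective (y : R) : 0 < y < 1 -> exists t, Phi t = y.
Proof.
move=> /andP[y0 y1].
have [a ay] : exists a, Phi a < y.
  have /cvgrPdist_lt/(_ _ y0) [a [_ Ha]] := Phi_cvgNy.
  exists (a - 1); have := Ha (a - 1); rewrite ltrBlDr ltrDl ltr01 => /(_ isT).
  by rewrite sub0r normrN ger0_norm// Phi_ge0.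
have [b yb] : exists b, y < Phi b.
  have y1' : 0 < 1 - y by rewrite subr_gt0.
  have /cvgrPdist_lt/(_ _ y1') [b [_ Hb]] := Phi_cvgy.
  exists (b + 1); have := Hb (b + 1); rewrite ltrDl ltr01 => /(_ isT).
  by rewrite ger0_norm ?subr_ge0 ?Phi_le1//; lra.
have ab : a <= b.
  by rewrite leNgt; apply/negP => /Phi_increasing ba; lra.
have [|t _ ty] := @IVT R Phi a b y ab (continuous_subspaceT Phi_continuous).
  by rewrite (min_idPl _) ?(max_idPr _) ?Phi_nondecreasing// !ltW.
by exists t.
Qed.

Let PhiTR : measurableTypeR R -> measurableTypeR R := @Phi R.

#[local] HB.instance Definition _ :=
  @isMeasurableFun.Build _ _ _ _ PhiTR Phi_measurable.

Lemma Phi_gt0 (t : R) : 0 < Phi t.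
Proof. by apply: le_lt_trans (Phi_ge0 (t - 1)) _; apply: Phi_increasing; rewrite ltrBlDr ltrDl. Qed.

Lemma uniform_prob01 (A : set R) : measurable A ->
  uniform_prob (@ltr01 R) A = leb (A `&` `[0, 1]).
Proof.
move=> mA; rewrite -[X in uniform_prob _ X]setIT -integral_indic//.
rewrite integral_uniform//; first by rewrite subr0 invr1 mul1e integral_indic.
exact/measurable_EFinP/measurable_indic.
Qed.

(** The probability integral transform: a continuous increasing c.d.f. maps its own law to the
    uniform one. It carries the integrability of [psi] over to that of [psi \o Phi] under the normal
    law. *)
Lemma pushforward_Phi (A : set R) : measurable A ->
  N01 (Phi @^-1` A) = uniform_prob (@ltr01 R) A.
Proof.
apply: (@probability_eq_cdf R (distribution N01 PhiTR)
  (uniform_prob (@ltr01 R))) => y.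
apply: etrans (esym (uniform_prob01 _)) => //.
change (N01 (Phi @^-1` `]-oo, y]) = leb (`]-oo, y] `&` `[0, 1])).
have [y0|y0] := leP y 0.
  rewrite [X in N01 X](_ : _ = set0) ?measure0; last first.
    by rewrite -subset0 => x /=; rewrite in_itv/= leNgt (le_lt_trans y0 (Phi_gt0 x)).
  apply/esym; apply: (@subset_measure0 _ _ _ leb _ [set 0]) => //; last exact: lebesgue_measure_set1.
  - exact: measurableI.
  - move=> x /=; rewrite !in_itv/= => -[xy /andP[x0 _]].
    by apply/eqP; rewrite eq_le x0 (le_trans xy y0).
have [y1|y1] := leP 1 y.
  rewrite [X in N01 X](_ : _ = setT) ?probability_setT; last first.
    by rewrite -subTset => x _ /=; rewrite in_itv/= (le_trans (Phi_le1 x) y1).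
  rewrite setIidr; first by rewrite lebesgue_measure_itv/= lte_fin ltr01 oppr0 adde0.
  by move=> x /=; rewrite !in_itv/= => /andP[_ x1]; exact: le_trans y1.
have [t ty] : exists t, Phi t = y by apply: Phi_surjective; rewrite y0.
transitivity (N01 `]-oo, t]).
  congr (N01 _); apply/seteqP; split => x /=; rewrite !in_itv/= -ty.
    by rewrite !leNgt; apply: contra; exact: Phi_increasing.
  exact: Phi_nondecreasing.
rewrite -PhiE ty [X in leb X](_ : _ = `[0, y]%classic).
  by rewrite lebesgue_measure_itv/= lte_fin y0 oppr0 adde0.
apply/seteqP; split => x /=; rewrite !in_itv/=; first by case=> -> /andP[->].
by move=> /andP[-> xy]; split=> //; rewrite (le_trans xy)// ltW.
Qed.

Lemma integrable_comp_Phi (psi : R -> R) : (forall x, 0 <= psi x) ->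
  leb.-integrable setT (EFin \o psi) ->
  N01.-integrable setT (EFin \o (psi \o Phi)).
Proof.
move=> psi0 psii; have mpsi := measurable_int _ psii.
apply/integrableP; split.
  by apply/measurable_EFinP/measurableT_comp; [exact/measurable_EFinP|exact: Phi_measurable].
have -> : (\int[N01]_x `|(EFin \o (psi \o Phi)) x| =
    \int[distribution N01 PhiTR]_y (psi y)%:E)%E.
  rewrite ge0_integral_distribution//.
  by apply: eq_integral => x _; rewrite /= ger0_norm.
rewrite (eq_measure_integral (uniform_prob (@ltr01 R))); last first.
  by move=> A mA _; exact: pushforward_Phi.
rewrite integral_uniform//.
rewrite subr0 invr1 mul1e; apply: le_lt_trans (integrable_lty _ psii) => //.
by apply: ge0_subset_integral => // y _; rewrite lee_fin.
Qed.

End gaussian_cdf.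

(** * Positive functionals and the entropy bound *)

Section quadratically_bounded.
Context {R : realType}.
Local Notation N01 := (@normal_prob R 0 1).
Implicit Types (f g : R -> R) (l : (R -> R) -> R).

(** A domain shared by all functionals compared below: it contains the indicators, the identity and
    the square, is stable under linear combinations and lies inside [orlicz] ([quadb_orlicz]). *)
Definition quadb f : Prop := measurable_fun setT f /\
  exists A, forall x, `|f x| <= A * (1 + x ^+ 2).

Lemma quadb_lin (c : R) f g : quadb f -> quadb g -> quadb (fun x => c * f x + g x).
Proof.
move=> [mf [A Af]] [mg [B Bg]]; split.
  by apply: measurable_funD => //; exact: measurable_funM.
exists (`|c| * A + B) => x; rewrite (le_trans (ler_normD _ _))// mulrDl lerD//.
by rewrite normrM -mulrA ler_wpM2l.
Qed.

Lemma quadb_bounded f A : measurable_fun setT f -> (forall x, `|f x| <= A) -> quadb f.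
Proof.
move=> mf fA; split=> //; exists A => x; rewrite (le_trans (fA x))//.
have A0 : 0 <= A by rewrite (le_trans _ (fA 0)).
by rewrite ler_peMr// lerDl sqr_ge0.
Qed.

Lemma quadb_cst (c : R) : quadb (fun=> c).
Proof. exact: (@quadb_bounded _ `|c|). Qed.

Lemma quadb_indic (A : set R) : measurable A -> quadb \1_A.
Proof.
move=> mA; apply: (@quadb_bounded _ 1) => [|x]; first exact: measurable_indic.
by rewrite indicE; case: (_ \in _); rewrite /= ?normr1 ?normr0.
Qed.

Lemma quadb_id : quadb (fun x => x).
Proof.
split; first exact: measurable_id.
by exists 1 => x; rewrite mul1r ler_norml; apply/andP; split; nra.
Qed.

Lemma quadb_sqr : quadb (fun x => x ^+ 2).
Proof.
split; first exact: exprn_measurable.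
by exists 1 => x; rewrite mul1r ger0_norm ?sqr_ge0// lerDr.
Qed.

Lemma quadb_mul_indic f (A : set R) : measurable A -> quadb f ->
  quadb (fun x => f x * \1_A x).
Proof.
move=> mA [mf [B Bf]]; split.
  by apply: measurable_funM => //; exact: measurable_indic.
exists B => x; rewrite (le_trans _ (Bf x))// normrM ler_piMr//.
by rewrite indicE; case: (_ \in _); rewrite /= ?normr1 ?normr0.
Qed.

Lemma quadbZ (c : R) f : quadb f -> quadb (fun x => c * f x).
Proof.
move=> qf; have := quadb_lin c qf (quadb_cst 0).
by under eq_fun do rewrite addr0.
Qed.

Lemma quadbD f g : quadb f -> quadb g -> quadb (fun x => f x + g x).
Proof.
move=> qf qg; have := quadb_lin 1 qf qg.
by under eq_fun do rewrite mul1r.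
Qed.

Lemma quadbB f g : quadb f -> quadb g -> quadb (fun x => f x - g x).
Proof.
move=> qf qg; have := quadb_lin (-1) qg qf.
by under eq_fun do rewrite mulN1r addrC.
Qed.

Lemma quadb_sum (I : Type) (s : seq I) (F : I -> R -> R) :
  (forall i, quadb (F i)) -> quadb (fun x => \sum_(i <- s) F i x).
Proof.
move=> qF; elim: s => [|i s IH].
  by under eq_fun do rewrite big_nil; exact: quadb_cst.
by under eq_fun do rewrite big_cons; exact: quadbD.
Qed.

(** Both empirical means and dual functionals of finite [J_Phi] have these properties. Additivity is
    finite only, as a dual functional may have a part singular at infinity. *)
Definition posfun l : Prop :=
  [/\ forall c f g, quadb f -> quadb g -> l (fun x => c * f x + g x) = c * l f + l g,
      forall f, quadb f -> (forall x, 0 <= f x) -> 0 <= l f &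
      l (fun=> 1) = 1].

Section posfun_theory.
Variable l : (R -> R) -> R.
Hypothesis pl : posfun l.

Lemma posfun0 : l (fun=> 0) = 0.
Proof.
have [lin _ _] := pl; have := lin 1 _ _ (quadb_cst 0) (quadb_cst 0).
under eq_fun do rewrite mulr0 addr0.
lra.
Qed.

Lemma posfunZ c f : quadb f -> l (fun x => c * f x) = c * l f.
Proof.
have [lin _ _] := pl => qf; have := lin c _ _ qf (quadb_cst 0).
by under eq_fun do rewrite addr0; rewrite posfun0 addr0.
Qed.

Lemma posfunD f g : quadb f -> quadb g -> l (fun x => f x + g x) = l f + l g.
Proof.
have [lin _ _] := pl => qf qg; have := lin 1 _ _ qf qg.
by under eq_fun do rewrite mul1r; rewrite mul1r.
Qed.

Lemma posfunB f g : quadb f -> quadb g -> l (fun x => f x - g x) = l f - l g.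
Proof.
have [lin _ _] := pl => qf qg; have := lin (-1) _ _ qg qf.
by under eq_fun do rewrite mulN1r addrC; rewrite mulN1r addrC.
Qed.

Lemma posfun_cst (c : R) : l (fun=> c) = c.
Proof.
have [_ _ l1] := pl; have := posfunZ c (quadb_cst 1).
by under eq_fun do rewrite mulr1; rewrite l1 mulr1.
Qed.

Lemma posfun_sum (I : Type) (s : seq I) (F : I -> R -> R) :
  (forall i, quadb (F i)) -> l (fun x => \sum_(i <- s) F i x) = \sum_(i <- s) l (F i).
Proof.
move=> qF; elim: s => [|i s IH].
  by under eq_fun do rewrite big_nil; rewrite posfun0 big_nil.
under eq_fun do rewrite big_cons; rewrite big_cons -IH posfunD//.
exact: quadb_sum.
Qed.

Lemma posfun_le f g : quadb f -> quadb g -> (forall x, f x <= g x) -> l f <= l g.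
Proof.
have [_ pos _] := pl => qf qg fg; rewrite -subr_ge0 -posfunB//.
by apply: pos => [|x]; [exact: quadbB|rewrite subr_ge0].
Qed.

Lemma posfun_ge0 f : quadb f -> (forall x, 0 <= f x) -> 0 <= l f.
Proof. by have [_ pos _] := pl; exact: pos. Qed.

Lemma posfun_norm_le f g : quadb f -> quadb g -> (forall x, `|f x| <= g x) ->
  `|l f| <= l g.
Proof.
move=> qf qg fg; rewrite ler_norml; apply/andP; split.
  rewrite lerNl -mulN1r -posfunZ//; apply: posfun_le => //; first exact: quadbZ.
  by move=> x; rewrite mulN1r; have := fg x; rewrite ler_norml lerNl => /andP[].
apply: posfun_le => // x; exact: le_trans (ler_norm _) (fg x).
Qed.

Lemma posfun_indic_ge0 (A : set R) : measurable A -> 0 <= l \1_A.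
Proof. by move=> mA; apply: posfun_ge0 => //; exact: quadb_indic. Qed.

Lemma posfun_indic_le1 (A : set R) : measurable A -> l \1_A <= 1.
Proof.
move=> mA; have [_ _ <-] := pl.
apply: posfun_le; [exact: quadb_indic|exact: quadb_cst|move=> x].
by rewrite indicE; case: (_ \in _).
Qed.

Lemma posfun_variance_ge0 :
  (l (fun x => x)) ^+ 2 <= l (fun x => x ^+ 2).
Proof.
set a := l (fun x => x).
have : 0 <= l (fun x => x ^+ 2 - (2 * a * x - a ^+ 2)).
  apply: posfun_ge0.
    apply: quadbB; first exact: quadb_sqr.
    by apply: quadbB; [apply: quadbZ; exact: quadb_id|exact: quadb_cst].
  by move=> x; have := sqr_ge0 (x - a); rewrite sqrrB -mulr_natr; lra.
rewrite posfunB; [|exact: quadb_sqr|by apply: quadbB; [apply: quadbZ; exact: quadb_id|exact: quadb_cst]].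
rewrite posfunB; [|by apply: quadbZ; exact: quadb_id|exact: quadb_cst].
by rewrite posfunZ ?posfun_cst; [rewrite -/a; nra|exact: quadb_id].
Qed.

End posfun_theory.

Lemma expR_measurable f : measurable_fun setT f -> measurable_fun setT (fun x => expR (f x)).
Proof. by move=> mf; exact: measurableT_comp. Qed.

(* The only consequence of J_Phi l <= J0 that is used; it makes sense for
   functionals defined on functions of at most quadratic growth. *)
Definition entropy_bound l (J0 : R) : Prop := forall f, quadb f -> forall c : R, 0 < c ->
  (\int[N01]_x (expR (f x))%:E <= c%:E)%E -> l f <= J0 + ln c.

(** The test function [K * \1_A] has exponential mean at most 1 + e^K e^(-K) = 2, and ln 2 <= 1.
    Small Gaussian mass thus forces small mass under [l], uniformly over the level set of the
    entropy. *)
Lemma entropy_bound_indic l J0 (A : set R) (K : R) : posfun l -> entropy_bound l J0 ->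
  0 < K -> measurable A -> (N01 A <= (expR (- K))%:E)%E -> l \1_A <= (J0 + 1) / K.
Proof.
move=> pl el K0 mA AK.
have qA := quadb_indic mA.
rewrite ler_pdivlMr// mulrC -(posfunZ pl)//.
have mI : measurable_fun setT (\1_A : R -> R) by exact: measurable_indic.
have le2 : (\int[N01]_x (expR (K * \1_A x))%:E <= 2%:E)%E.
  apply: (@le_trans _ _ (\int[N01]_x (1 + expR K * \1_A x)%:E)%E).
    apply: le_integral_EFin.
    - by apply: expR_measurable; exact: measurable_funM.
    - by apply: measurable_funD => //; exact: measurable_funM.
    - by move=> x; exact: expR_ge0.
    - move=> x; rewrite indicE; case: (_ \in _) => /=.
        by rewrite !mulr1 lerDr.
      by rewrite !mulr0 expR0 addr0.
  rewrite integralD_EFin_ge0//; last exact: measurable_funM.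
  rewrite integral_cstP integralZl_EFin_ge0 ?expR_ge0// integral_indicT//.
  rewrite (@le_trans _ _ (1 + (expR K)%:E * (expR (- K))%:E)%E)//.
    by rewrite leeD2l// lee_wpmul2l ?lee_fin ?expR_ge0.
  by rewrite -EFinM -expRD subrr expR0 -EFinD lee_fin.
rewrite (le_trans (el _ (quadbZ K qA) 2 _ le2))// lerD2l.
by rewrite (le_trans (le_ln1Dx _))//; rewrite ?(_ : 1 + 1 = 2)//.
Qed.

(** The test function is x^2 / 4: its coefficient is below the critical 1/2, and its inverse is the
    factor 4. *)
Lemma entropy_bound_sqr_bounded : exists C : R, forall l J0, posfun l -> entropy_bound l J0 -> 0 <= J0 ->
  l (fun x => x ^+ 2) <= 4 * J0 + C.
Proof.
have [c c0 ec] : exists2 c : R, 0 <= c & (\int[N01]_x (expR (1 / 4 * x ^+ 2))%:E = c%:E)%E.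
  by apply: gaussian_exp_square; lra.
exists (4 * ln (c + 1)) => l J0 pl el J00.
have c1 : 0 < c + 1 by lra.
have := el _ (quadbZ (1 / 4) quadb_sqr) _ c1; rewrite ec lee_fin lerDl ler01 => /(_ isT).
rewrite (posfunZ pl _ quadb_sqr); lra.
Qed.

End quadratically_bounded.

(** * Continuity of the Anderson-Darling functional *)

Section AD_functional_continuity.
Context {R : realType}.
Local Notation N01 := (@normal_prob R 0 1).
Variable psi : R -> R.
Hypothesis psi_ge0 : forall x, 0 <= psi x.
Hypothesis psi_int : (@lebesgue_measure R).-integrable setT (EFin \o psi).

(** Limits 0 and 1 at infinity and right continuity are left out, since t |-> l(1_(-oo, t]) may lack
    them when [l] is singular. *)
Definition subcdf (x : R -> R) : Prop :=
  {homo x : s t / s <= t} /\ forall t, 0 <= x t <= 1.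

Let mpsi : measurable_fun setT psi.
Proof. by have /measurable_EFinP := measurable_int _ psi_int. Qed.

Let mpsiPhi : measurable_fun setT (psi \o Phi).
Proof. by apply: measurableT_comp => //; exact: Phi_measurable. Qed.

Lemma subcdf_measurable_affine x (a s : R) : subcdf x ->
  measurable_fun setT (fun t => x (a + s * t)).
Proof.
move=> [ndx _]; apply: (@measurableT_comp _ _ _ _ _ _ x).
  exact: nondecreasing_measurable.
by apply: measurable_funD => //; exact: measurable_funM.
Qed.

Let ADint (x : R -> R) (a s t : R) := (x (a + s * t) - Phi t) ^+ 2 * psi (Phi t).

Lemma AD_integrand_measurable x a s : subcdf x -> measurable_fun setT (ADint x a s).
Proof.
move=> dx; apply: measurable_funM => //; apply: measurable_funX.
apply: measurable_funB; first exact: subcdf_measurable_affine.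
exact: Phi_measurable.
Qed.

Lemma AD_functional_fin x a s : subcdf x -> AD_functional psi x a s \is a fin_num.
Proof.
move=> dx; rewrite ge0_fin_numE; last first.
  by apply: integral_ge0 => t _; rewrite lee_fin mulr_ge0// sqr_ge0.
apply: le_lt_trans (integrable_lty _ (integrable_comp_Phi psi_ge0 psi_int)) => //.
apply: le_integral_EFin.
- exact: AD_integrand_measurable.
- exact: mpsiPhi.
- by move=> t; rewrite mulr_ge0// sqr_ge0.
- move=> t; rewrite ler_piMl//; have [_ /(_ (a + s * t))] := dx.
  by have := Phi_ge0 t; have := Phi_le1 t; nra.
Qed.

Let tail_cvg0 :
  (\int[N01]_t (psi (Phi t) * \1_(~` `[- n%:R, n%:R]) t)%:E @[n --> \oo] --> 0)%E.
Proof.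
have mI (n : nat) : measurable_fun setT
    (fun t : R => psi (Phi t) * \1_(~` `[- n%:R, n%:R]) t).
  by apply: measurable_funM => //; apply: measurable_indic; exact: measurableC.
rewrite -(@integral0 _ _ _ N01 setT).
apply: (@dominated_cvg _ _ _ N01 setT _ _ _ (EFin \o (psi \o Phi))) => //.
- by move=> n; apply/measurable_EFinP; exact: mI.
- move=> t _; apply: cvg_near_cst; near=> n.
  rewrite indicE memNset ?mulr0//= in_itv/=; apply; rewrite -ler_norml.
  by near: n; exact: nbhs_infty_ger.
- exact: integrable_comp_Phi.
- move=> n t _; rewrite lee_fin normrM ger0_norm// ler_piMr//.
  by rewrite indicE; case: (_ \in _); rewrite /= ?normr1 ?normr0.
Unshelve. all: by end_near. Qed.

(** Closeness is asked for on [|t| <= tau] only, as the finite measure psi(Phi) dPhi has small mass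
    elsewhere. Exchanging the two functions gives the reverse estimate. *)
Lemma AD_functional_close (e : R) : 0 < e ->
  exists eta tau : R, [/\ 0 < eta, 0 < tau &
    forall (x1 x2 : R -> R) (a1 a2 s1 s2 : R), subcdf x1 -> subcdf x2 ->
    (forall t : R, `|t| <= tau -> `|x1 (a1 + s1 * t) - x2 (a2 + s2 * t)| <= eta) ->
    fine (AD_functional psi x1 a1 s1) <= fine (AD_functional psi x2 a2 s2) + e].
Proof.
move=> e0; have psiPhi := integrable_comp_Phi psi_ge0 psi_int.
pose C := fine (\int[N01]_t (psi (Phi t))%:E)%E.
have CE : (\int[N01]_t (psi (Phi t))%:E = C%:E)%E.
  by rewrite /C fineK//; exact: (integrable_fin_num _ psiPhi).
have C0 : 0 <= C by rewrite /C fine_ge0// integral_ge0// => t _; rewrite lee_fin.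
have [n [n0 tailn]] : exists n : nat, (0 < n)%N /\
   (\int[N01]_t (psi (Phi t) * \1_(~` `[- n%:R, n%:R]) t)%:E <= (e / 4)%:E)%E.
  have e4 : 0 < e / 4 by rewrite divr_gt0.
  have /fine_cvgP[[N1 _ fin1] /cvgr_lt/(_ _ e4)[N2 _ HN]] := tail_cvg0.
  exists (maxn N1 N2).+1; split => //.
  rewrite -[leLHS]fineK ?lee_fin; first by apply/ltW/HN => /=; rewrite leqW// leq_maxr.
  by apply: fin1 => /=; rewrite leqW// leq_maxl.
(* The window contributes at most 2 eta C <= e / 2 and the tail at most 2 (e / 4); [C + 1] avoids a
   division by zero. *)
pose eta := e / (4 * (C + 1)); have eta0 : 0 < eta by rewrite divr_gt0// mulr_gt0//; lra.
exists eta, n%:R; split; rewrite ?ltr0n// => x1 x2 a1 a2 s1 s2 dx1 dx2 close.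
have F1 := AD_functional_fin a1 s1 dx1; have F2 := AD_functional_fin a2 s2 dx2.
rewrite -lee_fin EFinD !fineK//.
pose I (t : R) := \1_(~` `[- n%:R, n%:R]) t : R.
have mI : measurable_fun setT I by apply: measurable_indic; exact: measurableC.
have I0 t : 0 <= I t by rewrite /I indicE.
have eta0' := ltW eta0.
apply: (@le_trans _ _ (\int[N01]_t (ADint x2 a2 s2 t +
   (2 * eta * psi (Phi t) + 2 * (psi (Phi t) * I t)))%:E)%E).
  apply: le_integral_EFin.
  - exact: AD_integrand_measurable.
  - apply: measurable_funD; first exact: AD_integrand_measurable.
    apply: measurable_funD; first exact: measurable_funM.
    by apply: measurable_funM => //; exact: measurable_funM.
  - by move=> t; rewrite mulr_ge0// sqr_ge0.
  - move=> t; rewrite [leRHS](_ : _ = ((x2 (a2 + s2 * t) - Phi t) ^+ 2 +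
      2 * (eta + I t)) * psi (Phi t)); last by rewrite /ADint; ring.
    rewrite ler_wpM2r//.
    have [_ /(_ (a1 + s1 * t))/andP[p1 q1]] := dx1.
    have [_ /(_ (a2 + s2 * t))/andP[p2 q2]] := dx2.
    have := Phi_ge0 t; have := Phi_le1 t.
    have := close t; rewrite /I indicE.
    set u := x1 _ in p1 q1 *; set v := x2 _ in p2 q2 *; set p := Phi t => c r r0.
    have uv : `|u - v| <= eta + (t \in ~` `[- n%:R, n%:R])%:R.
      case: (boolP (t \in _)) => tI.
        have : `|u - v| <= 1 by rewrite ler_norml; apply/andP; split; lra.
        by move/le_trans; apply; rewrite lerDr ltW.
      rewrite addr0; apply: c; move: tI; rewrite notin_setE/= in_itv/= ler_norml.
      by move/contrapT.
    have := uv; rewrite ler_norml => /andP[uv1 uv2].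
    have w0 : 0 <= eta + (t \in ~` `[- n%:R, n%:R])%:R by apply: le_trans uv.
    set w := eta + _ in uv1 uv2 w0 *.
    (* All of [u], [v], [p] lie in [0, 1], so the factor [u + v - 2 * p] has modulus at most 2. *)
    have -> : (u - p) ^+ 2 = (v - p) ^+ 2 + (u - v) * (u + v - 2 * p) by ring.
    by rewrite lerD2l; have [?|?] := leP 0 (u + v - 2 * p); nra.
rewrite integralD_EFin_ge0; last 4 first.
- exact: AD_integrand_measurable.
- apply: measurable_funD; first exact: measurable_funM.
  by apply: measurable_funM => //; exact: measurable_funM.
- by move=> t; rewrite mulr_ge0// sqr_ge0.
- by move=> t; apply: addr_ge0; apply: mulr_ge0 => //; apply: mulr_ge0.
rewrite leeD2l//.
rewrite integralD_EFin_ge0; last 4 first.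
- exact: measurable_funM.
- by apply: measurable_funM => //; exact: measurable_funM.
- by move=> t; apply: mulr_ge0 => //; apply: mulr_ge0.
- by move=> t; apply: mulr_ge0 => //; apply: mulr_ge0.
rewrite !integralZl_EFin_ge0//; last 3 first.
- exact: measurable_funM.
- by move=> t; rewrite mulr_ge0.
- by rewrite mulr_ge0.
rewrite CE (@le_trans _ _ ((2 * eta)%:E * C%:E + 2%:E * (e / 4)%:E)%E)//.
  by rewrite leeD2l// lee_wpmul2l ?lee_fin.
rewrite -!EFinM -EFinD lee_fin.
have : 2 * eta * C <= e / 2.
  rewrite /eta (_ : 2 * (e / (4 * (C + 1))) * C = (e / 2) * (C / (C + 1))); last by field; lra.
  have h1 : C / (C + 1) <= 1 by rewrite ler_pdivrMr; lra.
  by rewrite ler_piMr// divr_ge0// ltW.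
lra.
Qed.

(** The error is routed through [x2 (a1 + s1 * t)]: uniform closeness handles the change of
    function, the modulus of [x2] the change of argument, so [x1] may have jumps. For [|t| <= tau]
    the arguments differ by at most [rho]. *)
Lemma AD_functional_continuous (e : R) : 0 < e ->
  exists eta tau : R, [/\ 0 < eta, 0 < tau &
    forall (x1 x2 : R -> R) (a1 a2 s1 s2 rho : R), subcdf x1 -> subcdf x2 ->
    (forall u v : R, `|u - v| <= rho -> `|x2 u - x2 v| <= eta) ->
    (forall t : R, `|x1 t - x2 t| <= eta) ->
    `|a1 - a2| <= rho / 2 -> `|s1 - s2| * tau <= rho / 2 ->
    `|fine (AD_functional psi x1 a1 s1) - fine (AD_functional psi x2 a2 s2)| <= e].
Proof.
move=> e0; have [eta [tau [eta0 tau0 H]]] := AD_functional_close e0.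
exists (eta / 2), tau; split; rewrite ?divr_gt0// => x1 x2 a1 a2 s1 s2 rho dx1 dx2 mod cl aa ss.
have cl' (t : R) : `|t| <= tau -> `|x1 (a1 + s1 * t) - x2 (a2 + s2 * t)| <= eta.
  move=> tt; rewrite -[x1 _](subrK (x2 (a1 + s1 * t))) -addrA.
  rewrite (le_trans (ler_normD _ _))// [leRHS](splitr eta) lerD//; apply: mod.
  rewrite (_ : _ - _ = (a1 - a2) + (s1 - s2) * t); last by ring.
  rewrite (le_trans (ler_normD _ _))// [leRHS](splitr rho) lerD//.
  by rewrite normrM (le_trans _ ss)// ler_wpM2l.
rewrite ler_distl; apply/andP; split; last exact: H.
rewrite lerBlDr; apply: H => // t /cl'; by rewrite distrC.
Qed.

End AD_functional_continuity.

(** * Reduction to finitely many parameters *)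

Section cells.
Context {R : realType}.
Implicit Types (M t x : R) (k i : nat).

Definition knot M k i : R := - M + i%:R * (2 * M / k%:R).
Definition cell M k i : set R := `]knot M k i, knot M k i.+1]%classic.
Definition outer M : set R := ~` `]- M, M]%classic.

Lemma measurable_cell M k i : measurable (cell M k i).
Proof. exact: measurable_itv. Qed.

Lemma measurable_outer M : measurable (outer M).
Proof. by apply: measurableC; exact: measurable_itv. Qed.

Lemma outer_sqr M x : 0 <= M -> outer M x -> M ^+ 2 <= x ^+ 2.
Proof.
move=> M0; rewrite /outer/= in_itv/= => /negP.
by rewrite negb_and -leNgt -ltNge => /orP[|] xM; nra.
Qed.

Variables (M : R) (k : nat).
Hypotheses (M0 : 0 < M) (k0 : (0 < k)%N).

Let h0 : 0 < 2 * M / k%:R.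
Proof. by rewrite divr_gt0 ?mulr_gt0 ?ltr0n. Qed.

Lemma knot0 : knot M k 0 = - M.
Proof. by rewrite /knot mul0r addr0. Qed.

Lemma knotk : knot M k k = M.
Proof.
rewrite /knot mulrCA divff ?pnatr_eq0 -?lt0n// mulr1; lra.
Qed.

Lemma knotS i : knot M k i.+1 = knot M k i + 2 * M / k%:R.
Proof. by rewrite /knot -natr1 mulrDl mul1r addrA. Qed.

Lemma knot_le i j : (i <= j)%N -> knot M k i <= knot M k j.
Proof. by move=> ij; rewrite lerD2l ler_wpM2r ?(ltW h0)// ler_nat. Qed.

Lemma knot_bounds i : (i <= k)%N -> - M <= knot M k i <= M.
Proof.
move=> ik; have := knot_le (leq0n i); have := knot_le ik.
by rewrite knot0 knotk => -> ->.
Qed.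

Lemma cell_inj i j x : cell M k i x -> cell M k j x -> i = j.
Proof.
rewrite /cell/= !in_itv/= => /andP[ix xi] /andP[jx xj]; apply/eqP.
rewrite eqn_leq (leqNgt i) (leqNgt j); apply/andP; split; apply/negP => /knot_le kk.
  by have := lt_le_trans ix (le_trans xj kk); rewrite ltxx.
by have := lt_le_trans jx (le_trans xi kk); rewrite ltxx.
Qed.

Lemma cell_inner i x : (i < k)%N -> cell M k i x -> - M < x <= M.
Proof.
rewrite /cell/= in_itv/= => ik /andP[ix xi].
have /andP[+ _] := knot_bounds (ltnW ik); have /andP[_ +] := knot_bounds ik.
by move=> a b; rewrite (le_lt_trans b ix) (le_trans xi a).
Qed.

Lemma cell_cover x : - M < x <= M -> exists i : 'I_k, cell M k i x.
Proof.
move=> /andP[Mx xM].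
have : exists i, x <= knot M k i by exists k; rewrite knotk.
case/ex_minnP => -[|i] xi imin.
  by move: xi; rewrite knot0 leNgt Mx.
have ik : (i < k)%N by apply: imin; rewrite knotk.
exists (Ordinal ik); rewrite /cell/= in_itv/= xi andbT ltNge.
by apply/negP => /imin; rewrite ltnn.
Qed.

(** The last component of each case evaluates a step function over the cells at [x], so that a
    pointwise estimate reduces to one value per case. *)
Variant cell_spec x : Prop :=
| CellSpec (i : 'I_k) of cell M k i x & ~ outer M x &
    (forall v : 'I_k -> R, \sum_j v j * \1_(cell M k j) x = v i)
| OuterSpec of outer M x & (forall j : 'I_k, ~ cell M k j x) &
    (forall v : 'I_k -> R, \sum_j v j * \1_(cell M k j) x = 0).

Lemma cellP x : cell_spec x.
Proof.
have [xM|xM] := boolP (- M < x <= M).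
  have [i xi] := cell_cover xM; apply: (CellSpec xi).
    by rewrite /outer/= in_itv/= xM.
  move=> v; rewrite (bigD1 i)//= indicE mem_set// mulr1 big1 ?addr0// => j ji.
  rewrite indicE memNset ?mulr0// => xj; move/eqP: ji; apply; apply: val_inj.
  exact: cell_inj xj xi.
have nj (j : 'I_k) : ~ cell M k j x.
  by move=> xj; move: xM; rewrite (cell_inner _ xj).
apply: OuterSpec => //; first by rewrite /outer/= in_itv/=; exact/negP.
by move=> v; rewrite big1// => j _; rewrite indicE memNset ?mulr0.
Qed.

Definition osqr x : R := x ^+ 2 * \1_(outer M) x.

Lemma quadb_osqr : quadb osqr.
Proof. by apply: quadb_mul_indic; [exact: measurable_outer|exact: quadb_sqr]. Qed.

Lemma osqr_ge0 x : 0 <= osqr x.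
Proof. by rewrite /osqr mulr_ge0 ?sqr_ge0// indicE. Qed.

Lemma indic_outer_le x : \1_(outer M) x <= (M ^+ 2)^-1 * osqr x.
Proof.
rewrite /osqr indicE; have [|_] := boolP (x \in _); last by rewrite !mulr0.
rewrite inE => /(outer_sqr (ltW M0)) Mx; rewrite mulr1.
by rewrite mulrC ler_pdivlMr ?exprn_gt0// mul1r.
Qed.

Definition csum (v : 'I_k -> R) x : R := \sum_j v j * \1_(cell M k j) x.

Lemma quadb_csum v : quadb (csum v).
Proof.
by apply: quadb_sum => j; apply: quadbZ; apply: quadb_indic; exact: measurable_cell.
Qed.

Lemma posfun_csum l v : posfun l -> l (csum v) = \sum_j v j * l \1_(cell M k j).
Proof.
move=> pl; rewrite (posfun_sum pl) => [|j]; last first.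
  by apply: quadbZ; apply: quadb_indic; exact: measurable_cell.
apply: eq_bigr => j _; rewrite (posfunZ pl)//.
by apply: quadb_indic; exact: measurable_cell.
Qed.

Section compare.
Variables (l1 l2 : (R -> R) -> R) (del K : R).
Hypotheses (pl1 : posfun l1) (pl2 : posfun l2).
Hypothesis cl : forall j : 'I_k, `|l1 \1_(cell M k j) - l2 \1_(cell M k j)| <= del.
Hypotheses (K1 : l1 osqr <= K) (K2 : l2 osqr <= K).

Let del0 : 0 <= del.
Proof. by apply: le_trans (cl (Ordinal k0)). Qed.

(** Up to [e + e' * osqr M], [f] is a step function on the cells plus an exceptional part [w]. Cell
    masses agree up to [del], which costs [k V del]; [w] collects what a step function cannot
    reproduce and is compared directly. *)
Lemma posfun_compare (f w : R -> R) (v : 'I_k -> R) (e e' V W : R) :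
  0 <= e' -> quadb f -> quadb w ->
  (forall x, `|f x - csum v x - w x| <= e + e' * osqr x) ->
  (forall j, `|v j| <= V) -> `|l1 w - l2 w| <= W ->
  `|l1 f - l2 f| <= 2 * e + 2 * e' * K + W + k%:R * V * del.
Proof.
move=> e'0 qf qw fvw vV wW.
have qv := quadb_csum v.
have qr : quadb (fun x => f x - csum v x - w x) by apply: quadbB => //; exact: quadbB.
have qe : quadb (fun x => e + e' * osqr x).
  by apply: quadbD; [exact: quadb_cst|apply: quadbZ; exact: quadb_osqr].
have R1 l : posfun l -> l osqr <= K -> `|l f - l (csum v) - l w| <= e + e' * K.
  move=> pl lK; rewrite -(posfunB pl)// -(posfunB pl)//; last exact: quadbB.
  apply: (le_trans (posfun_norm_le pl qr qe fvw)).
  rewrite (posfunD pl (quadb_cst _) (quadbZ _ quadb_osqr)).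
  rewrite (posfun_cst pl) (posfunZ pl _ quadb_osqr) lerD2l.
  by rewrite ler_wpM2l.
have R2 : `|l1 (csum v) - l2 (csum v)| <= k%:R * V * del.
  rewrite !posfun_csum// -sumrB; apply: (le_trans (ler_norm_sum _ _ _)).
  have <- : \sum_(j < k) V * del = k%:R * V * del.
    by rewrite sumr_const card_ord -(mulr_natl (V * del) k) mulrA.
  apply: ler_sum => j _; rewrite -mulrBr normrM.
  by apply: ler_pM.
have := R1 _ pl1 K1; have := R1 _ pl2 K2; move: R2 wW.
rewrite !ler_norml => /andP[? ?] /andP[? ?] /andP[? ?] /andP[? ?].
apply/andP; split; lra.
Qed.

(** Inside, the left knot approximates [x] within the mesh; outside, |x| <= x^2 / M lets the outer
    second moment control the mean. *)
Lemma posfun_compare_id :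
  `|l1 (fun x => x) - l2 (fun x => x)| <=
    4 * M / k%:R + 2 * K / M + k%:R * M * del.
Proof.
have := @posfun_compare (fun x => x) (fun=> 0) (fun j => knot M k j)
  (2 * M / k%:R) M^-1 M 0 _ quadb_id (quadb_cst 0).
rewrite addr0 (_ : 2 * (2 * M / k%:R) = 4 * M / k%:R); last by lra.
rewrite (_ : 2 * M^-1 * K = 2 * K / M); last by rewrite mulrAC.
apply.
- by rewrite invr_ge0 ltW.
- move=> x; rewrite subr0 /csum; case: (cellP x) => [i xi nx ->|xo nx ->].
    rewrite /osqr indicE memNset// !mulr0 addr0.
    move: xi; rewrite /cell/= in_itv/= knotS => /andP[].
    move: h0 (knot M k i); move: (2 * M / k%:R) => h hh q qx xq.
    by rewrite ler_norml; apply/andP; split; lra.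
  rewrite subr0 /osqr indicE mem_set// mulr1.
  have Mx : M <= `|x|.
    by rewrite -(@ler_pXn2r _ 2) ?nnegrE// ?(ltW M0)// real_normK ?num_real// (outer_sqr (ltW M0)).
  rewrite -(real_normK (num_real x)).
  have : `|x| <= M^-1 * `|x| ^+ 2 by rewrite mulrC ler_pdivlMr// expr2 ler_wpM2l.
  by move=> xx; rewrite (le_trans xx)// lerDr (ltW h0).
- by move=> j; rewrite ler_norml knot_bounds// ltnW.
- by rewrite (posfun_cst pl1) (posfun_cst pl2) subrr normr0.
Qed.

(** Here the exceptional part is [osqr M] itself: the cell masses say nothing about x^2 outside ]-M,
    M], so closeness of the outer second moments is a separate hypothesis. *)
Lemma posfun_compare_sqr (om : R) : `|l1 osqr - l2 osqr| <= om ->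
  `|l1 (fun x => x ^+ 2) - l2 (fun x => x ^+ 2)| <=
    8 * M ^+ 2 / k%:R + om + k%:R * M ^+ 2 * del.
Proof.
move=> oom.
have := @posfun_compare (fun x => x ^+ 2) osqr (fun j => knot M k j ^+ 2)
  (4 * M ^+ 2 / k%:R) 0 (M ^+ 2) om (lexx _) quadb_sqr quadb_osqr.
rewrite mulr0 mul0r addr0 (_ : 2 * (4 * M ^+ 2 / k%:R) = 8 * M ^+ 2 / k%:R); last by lra.
apply => //.
- move=> x; rewrite mul0r addr0 /csum; case: (cellP x) => [i xi nx ->|xo nx ->].
    rewrite /osqr indicE memNset// mulr0 subr0.
    have xM := cell_inner (ltn_ord i) xi.
    rewrite (_ : 4 * M ^+ 2 / k%:R = (2 * M / k%:R) * (2 * M)); last first.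
      by ring.
    have := knot_bounds (ltnW (ltn_ord i)).
    move: xi; rewrite /cell/= in_itv/= knotS.
    move: h0 (knot M k i); move: (2 * M / k%:R) => h hh q /andP[x1 x2] /andP[k1 k2].
    move/andP: xM => [? ?]; rewrite subr_sqr normrM.
    by apply: ler_pM => //; rewrite ler_norml; apply/andP; split; lra.
  rewrite subr0 /osqr indicE mem_set// mulr1 subrr normr0.
  by rewrite divr_ge0// mulr_ge0// sqr_ge0.
- move=> j; rewrite normrX lerXn2r ?nnegrE// ?(ltW M0)//.
  by rewrite ler_norml knot_bounds// ltnW.
Qed.

(** A ray is a union of whole cells and one fragment of a cell, up to an outer part of mass at most
    K / M^2. The fragment is small under [l2] by hypothesis, hence under [l1] through the mass of
    its cell. *)
Lemma posfun_compare_cdf (eta : R) :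
  (forall j : 'I_k, l2 \1_(cell M k j) <= eta) ->
  forall t, `|l1 \1_(`]-oo, t]) - l2 \1_(`]-oo, t])| <=
    2 * K / M ^+ 2 + (eta + del) + k%:R * del.
Proof.
move=> heta t.
have eta0 : 0 <= eta.
  by apply: le_trans (heta (Ordinal k0)); apply: posfun_indic_ge0 => //; exact: measurable_cell.
have i0 : 0 <= (M ^+ 2)^-1 by rewrite invr_ge0 sqr_ge0.
have H w v : quadb w -> (forall x, `|\1_(`]-oo, t]) x - csum v x - w x| <= \1_(outer M) x) ->
  (forall j, `|v j| <= 1) -> `|l1 w - l2 w| <= eta + del ->
  `|l1 \1_(`]-oo, t]) - l2 \1_(`]-oo, t])| <=
    2 * K / M ^+ 2 + (eta + del) + k%:R * del.
  move=> qw fv v1 lw.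
  have := @posfun_compare \1_(`]-oo, t]) w v 0 (M ^+ 2)^-1 1 _ i0 _ qw _ v1 lw.
  rewrite mulr0 add0r mulr1 (_ : 2 * (M ^+ 2)^-1 * K = 2 * K / M ^+ 2); last by rewrite mulrAC.
  apply; first by apply: quadb_indic; exact: measurable_itv.
  by move=> x; rewrite add0r (le_trans (fv x))// indic_outer_le.
have [tM|Mt] := leP t (- M).
  apply: (H (fun=> 0) (fun=> 0)).
  - exact: quadb_cst.
  - move=> x; rewrite subr0 /csum big1 ?subr0 => [|j _]; last by rewrite mul0r.
    rewrite !indicE; have [xt|] := boolP (x \in `]-oo, t]%classic); last by rewrite normr0.
    rewrite mem_set ?normr1//; move: xt; rewrite /outer inE/= !in_itv/= => xt.
    by move=> /andP[Mx _]; lra.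
  - by move=> j; rewrite normr0.
  - by rewrite (posfun_cst pl1) (posfun_cst pl2) subrr normr0 addr_ge0.
have [tM|{}tM] := ltP M t.
  apply: (H (fun=> 0) (fun=> 1)).
  - exact: quadb_cst.
  - move=> x; rewrite subr0 /csum; case: (cellP x) => [i xi nx ->|xo nx ->].
      rewrite !indicE mem_set ?subrr ?normr0//=.
      by rewrite in_itv/= (le_trans _ (ltW tM))//; have /andP[] := cell_inner (ltn_ord i) xi.
    by rewrite subr0 !indicE (mem_set xo) /=; case: (_ \in _); rewrite ?normr1 ?normr0.
  - by move=> j; rewrite normr1.
  - by rewrite (posfun_cst pl1) (posfun_cst pl2) subrr normr0 addr_ge0.
have [i ti] : exists i : 'I_k, cell M k i t by apply: cell_cover; rewrite Mt.
pose W : set R := `]knot M k i, t]%classic.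
have mW : measurable W by exact: measurable_itv.
have Wi x : W x -> cell M k i x.
  move: ti; rewrite /W /cell/= !in_itv/= => /andP[_ tk] /andP[-> xt].
  exact: le_trans tk.
(* Weight 1 on the cells entirely to the left of [t], and the fragment [W] of the cell containing
   [t] as exceptional part. *)
apply: (H \1_W (fun j => (j < i)%N%:R)).
- exact: quadb_indic.
- move=> x; rewrite /csum; case: (cellP x) => [j xj nx ->|xo nx ->].
    rewrite [\1_(outer M) x]indicE (memNset nx)/= normr_le0 subr_eq0; apply/eqP.
    rewrite !indicE; have [ji|ij|ij] := ltngtP j i.
    + rewrite mem_set/=; last first.
        move: ti xj; rewrite /cell/= !in_itv/= => /andP[it _] /andP[_ xj].
        by rewrite (le_trans xj)// (le_trans _ (ltW it))// knot_le.
      rewrite memNset ?subrr// => /Wi /(cell_inj xj) => ij.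
      by move: ji; rewrite ij ltnn.
    + rewrite memNset/=; last first.
        move: ti xj; rewrite /cell/= !in_itv/= => /andP[_ tk] /andP[jx _] xt.
        have kk := lt_le_trans jx (le_trans xt tk); move: (knot_le ij).
        by rewrite leNgt kk.
      rewrite memNset ?subrr// => /Wi /(cell_inj xj) => ji.
      by move: ij; rewrite ji ltnn.
    + rewrite subr0; congr (_%:R); congr nat_of_bool.
      apply/idP/idP; rewrite !inE /W/= !in_itv/=; last by case/andP.
      by move=> ->; move: xj; rewrite ij /cell/= in_itv/= => /andP[->].
  rewrite subr0 !indicE (mem_set xo)/= (@memNset _ W) ?subr0; last by move=> /Wi; exact: nx.
  by case: (_ \in _); rewrite ?normr1 ?normr0.
- by move=> j; case: (_ < _)%N; rewrite ?normr1 ?normr0.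
- have L l : posfun l -> 0 <= l \1_W <= l \1_(cell M k i).
    move=> pl; rewrite posfun_indic_ge0//=; apply: posfun_le => //.
    + exact: quadb_indic.
    + by apply: quadb_indic; exact: measurable_cell.
    + move=> x; rewrite !indicE; have [xW|_ //] := boolP (x \in W).
      by rewrite mem_set//; apply: Wi; exact: set_mem.
  have /andP[a1 b1] := L _ pl1; have /andP[a2 b2] := L _ pl2.
  have := cl i; have := heta i; rewrite !ler_norml => ? /andP[? ?].
  by apply/andP; split; lra.
Qed.

End compare.

End cells.

Section AD_compare.
Context {R : realType}.
Local Notation N01 := (@normal_prob R 0 1).
Variable psi : R -> R.
Hypothesis psi_ge0 : forall x, 0 <= psi x.
Hypothesis psi_int : (@lebesgue_measure R).-integrable setT (EFin \o psi).

Definition AD_value (l : (R -> R) -> R) : R :=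
  fine (AD_functional psi (fun t => l \1_(`]-oo, t])) (l (fun x => x))
   (Num.sqrt (l (fun x => x ^+ 2) - l (fun x => x) ^+ 2))).

Lemma posfun_subcdf (l : (R -> R) -> R) : posfun l -> subcdf (fun t => l \1_(`]-oo, t])).
Proof.
move=> pl; split => [s t st|t]; last first.
  by rewrite posfun_indic_ge0//= posfun_indic_le1.
apply: posfun_le => //; try exact: quadb_indic.
move=> x; rewrite !indicE; have [xs|//] := boolP (x \in `]-oo, s]%classic).
by rewrite mem_set//; move: xs; rewrite inE/= !in_itv/= => /le_trans; apply.
Qed.

(** [K] is chosen with (J0 + 1) / K = eta, and an interval of length e^(-K) has Gaussian mass at
    most e^(-K). *)
Lemma entropy_bound_modulus (J0 eta : R) : 0 <= J0 -> 0 < eta -> exists2 rho : R, 0 < rho &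
  forall l, posfun l -> entropy_bound l J0 -> forall s t : R, s <= t -> t - s <= rho ->
    l \1_(`]s, t]) <= eta.
Proof.
move=> J00 eta0; pose K := (J0 + 1) / eta.
have K0 : 0 < K by rewrite divr_gt0//; lra.
exists (expR (- K)); first exact: expR_gt0.
move=> l pl el s t st tr.
have := entropy_bound_indic pl el K0 (measurable_itv `]s, t]).
rewrite (_ : (J0 + 1) / K = eta); last by rewrite /K; field; rewrite ?gt_eqF//=; lra.
apply; rewrite -[leLHS]fineK ?fin_num_measure// lee_fin.
by rewrite (le_trans _ tr)// normal_prob_itv_le.
Qed.

Lemma posfun_cdf_dist (l : (R -> R) -> R) (rho eta : R) : posfun l ->
  (forall s t : R, s <= t -> t - s <= rho -> l \1_(`]s, t]) <= eta) ->
  forall u v : R, `|u - v| <= rho -> `|l \1_(`]-oo, u]) - l \1_(`]-oo, v])| <= eta.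
Proof.
move=> pl H.
suff S (u v : R) : u <= v -> v - u <= rho -> `|l \1_(`]-oo, v]) - l \1_(`]-oo, u])| <= eta.
  move=> u v uv; have [vu|/ltW vu] := leP v u.
    by apply: S => //; rewrite (le_trans _ uv)// ler_norm.
  by rewrite distrC; apply: S => //; rewrite (le_trans _ uv)// distrC ler_norm.
move=> uv vu; rewrite -posfunB//; try exact: quadb_indic.
rewrite (_ : (fun x => _) = \1_(`]u, v]%classic)).
  by rewrite ger0_norm ?H//; exact: posfun_indic_ge0.
apply/funext => x; rewrite !indicE.
have [xu|ux] := leP x u.
  rewrite (@mem_set _ `]-oo, u]%classic)/= ?in_itv//=.
  rewrite (@mem_set _ `]-oo, v]%classic)/= ?in_itv/= ?(le_trans xu)//.
  by rewrite memNset ?subrr//= in_itv/= ltNge xu.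
rewrite (@memNset _ `]-oo, u]%classic) ?subr0; last by rewrite /= in_itv/= leNgt ux.
by congr (_%:R); congr nat_of_bool; apply/idP/idP; rewrite !inE/= !in_itv/= ux.
Qed.

Lemma osqr_le_sqr (M x : R) : osqr M x <= x ^+ 2.
Proof. by rewrite /osqr ler_piMr ?sqr_ge0// indicE; case: (_ \in _). Qed.

(** The 1/2-Hoelder continuity of the square root, stated for the roots; it remains valid at
    vanishing variances. *)
Lemma sqrt_dist_le (x y e : R) : 0 <= x -> 0 <= y -> 0 <= e -> `|x ^+ 2 - y ^+ 2| <= e ^+ 2 ->
  `|x - y| <= e.
Proof.
move=> x0 y0 e0; rewrite !ler_norml => /andP[a b]; apply/andP; split.
- rewrite leNgt; apply/negP => ab; have : y > x + e by lra.
  by nra.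
- rewrite leNgt; apply/negP => ab; have : x > y + e by lra.
  by nra.
Qed.

(** From a2^2 <= b2 <= B comes |a2| <= 1 + B, so |a1^2 - a2^2| <= th (2 B + 3); the two remaining
    errors, each at most [th], make it th (2 B + 5). *)
Lemma variance_dist_le (a1 a2 b1 b2 v th del sg B : R) : 0 <= B -> 0 < th ->
  th <= 1 -> del <= th -> `|a1 - a2| <= th -> `|b1 - b2| <= th -> a2 ^+ 2 <= b2 ->
  b2 <= B -> `|v - (b1 - a1 ^+ 2)| <= del -> th * (2 * B + 5) <= sg ->
  `|v - (b2 - a2 ^+ 2)| <= sg.
Proof.
move=> B0 th0 th1 dth da db v2 b2B cs thsg.
have a2B : `|a2| <= 1 + B by rewrite ler_norml; apply/andP; split; nra.
have aa : `|a1 ^+ 2 - a2 ^+ 2| <= th * (2 * B + 3).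
  rewrite subr_sqr normrM ler_pM//.
  rewrite (_ : a1 + a2 = (a1 - a2) + 2 * a2); last by ring.
  by rewrite (le_trans (ler_normD _ _))// normrM (ger0_norm (_ : 0 <= 2))//; lra.
move: cs db aa; rewrite !ler_norml => /andP[? ?] /andP[? ?] /andP[? ?].
by apply/andP; split; lra.
Qed.

(* Only l2 carries an entropy bound: l1 is meant to be an empirical measure, and
   s1 its standard deviation normalized by n - 1. *)
Lemma AD_compare (J0 e : R) : 0 <= J0 -> 0 < e ->
  exists M0 om : R, [/\ 1 <= M0, 0 < om, om <= 1 &
  forall M, M0 <= M -> exists (k : nat) (del : R),
  [/\ (0 < k)%N, 0 < del, del <= 1 & forall l1 l2 (s1 : R),
    posfun l1 -> posfun l2 -> entropy_bound l2 J0 ->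
    (forall j : 'I_k, `|l1 \1_(cell M k j) - l2 \1_(cell M k j)| <= del) ->
    `|l1 (osqr M) - l2 (osqr M)| <= om -> 0 <= s1 ->
    `|s1 ^+ 2 - (l1 (fun x => x ^+ 2) - l1 (fun x => x) ^+ 2)| <= del ->
    `|fine (AD_functional psi (fun t => l1 \1_(`]-oo, t])) (l1 (fun x => x)) s1) -
      AD_value l2| <= e]].
Proof.
move=> J00 e0.
have [eta [tau [eta0 tau0 Hcont]]] := AD_functional_continuous psi_ge0 psi_int e0.
have [C HC] := @entropy_bound_sqr_bounded R.
have eta40 : 0 < eta / 4 by lra.
have [rho rho0 Hrho] := entropy_bound_modulus J00 eta40.
pose B := Num.max 0 (4 * J0 + C).
have B0 : 0 <= B by rewrite le_max lexx.
have HB l : posfun l -> entropy_bound l J0 -> l (fun x => x ^+ 2) <= B.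
  by move=> pl el; rewrite le_max HC ?orbT.
(* The extra 1 makes [K] a bound for [l1 (osqr M)] too, since the tolerance on outer second moments
   is at most 1. *)
pose K := B + 1; have K0 : 0 < K by rewrite /K; lra.
pose sg := rho / (2 * tau); have sg0 : 0 < sg by rewrite divr_gt0// mulr_gt0.
(* One tolerance for all parameters: [rho / 2] serves the mean, [eta / 8] the c.d.f., the last entry
   the variance, whose root must be within [sg]; the entry 1 keeps [om] and [del] at most 1. *)
pose th := Num.min (Num.min 1 (rho / 2)) (Num.min (eta / 8) (sg ^+ 2 / (2 * B + 5))).
have th0 : 0 < th.
  by rewrite !lt_min ltr01 !divr_gt0// ?exprn_gt0//; lra.
have [th1 thr the ths] : [/\ th <= 1, th <= rho / 2, th <= eta / 8 & th <= sg ^+ 2 / (2 * B + 5)].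
  by rewrite /th !ge_min !lexx !orbT.
(* [om] is fixed before [M], because later uses enlarge [M] in terms of [om]; [k] and [del] may
   depend on [M]. *)
exists (Num.max 1 (6 * K / th)), (th / 3); split.
- by rewrite le_max lexx.
- by lra.
- by lra.
move=> M; rewrite ge_max => /andP[M1 KM].
have M0 : 0 < M by lra.
have KM' : 2 * K / M <= th / 3.
  rewrite ler_pdivrMr//; move: KM; rewrite ler_pdivrMr//; lra.
pose k := (Num.truncn (24 * M ^+ 2 / th)).+1.
have k0 : (0 < k)%N by [].
have kR0 : 0 < k%:R :> R by rewrite ltr0n.
have Mk : 24 * M ^+ 2 / k%:R <= th.
  have : 24 * M ^+ 2 / th < k%:R by exact: truncnS_gt.
  by rewrite ltr_pdivrMr// => /ltW; rewrite ler_pdivrMr// [th * _]mulrC.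
have MM : M <= M ^+ 2 by rewrite expr2 ler_peMr// ltW.
have M2k : 24 * M / k%:R <= th.
  by rewrite (le_trans _ Mk)// ler_wpM2r ?invr_ge0 ?(ltW kR0)//; lra.
(* The largest of the cell errors, k M^2 del, and [del] itself then add up to th / 3. *)
pose del := th / (3 * (k%:R * M ^+ 2 + 1)).
have kM0 : 0 < k%:R * M ^+ 2 by rewrite mulr_gt0// exprn_gt0.
have del0 : 0 < del by rewrite divr_gt0//; lra.
have delE : k%:R * M ^+ 2 * del + del = th / 3.
  by rewrite /del; field; lra.
have kdel : k%:R * del <= k%:R * M * del.
  by rewrite ler_wpM2r ?(ltW del0)// ler_peMr// ltW.
have kMdel : k%:R * M * del <= k%:R * M ^+ 2 * del.
  by rewrite ler_wpM2r ?(ltW del0)// ler_wpM2l// ltW.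
have kd0 : 0 < k%:R * M ^+ 2 * del by rewrite mulr_gt0.
exists k, del; split => //; first lra.
move=> l1 l2 s1 pl1 pl2 el2 cl cosq s10 cs.
have mod := Hrho _ pl2 el2.
have b2B := HB _ pl2 el2.
have K2 : l2 (osqr M) <= K.
  rewrite (@le_trans _ _ B) ?lerDl//; apply: le_trans b2B.
  apply: posfun_le => //; [exact: quadb_osqr|exact: quadb_sqr|move=> x; exact: osqr_le_sqr].
have K1 : l1 (osqr M) <= K.
  have : l2 (osqr M) <= B.
    apply: le_trans b2B.
    apply: posfun_le => //; [exact: quadb_osqr|exact: quadb_sqr|move=> x; exact: osqr_le_sqr].
  by move: cosq; rewrite ler_norml /K => /andP[_ ?]; lra.
have cellle (j : 'I_k) : l2 \1_(cell M k j) <= eta / 4.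
  apply: mod; first by apply: knot_le.
  rewrite knotS addrAC subrr add0r (le_trans _ (_ : th <= rho))//; last by lra.
  by rewrite (le_trans _ M2k)// ler_wpM2r ?invr_ge0 ?(ltW kR0)//; lra.
have A1 := posfun_compare_id M0 k0 pl1 pl2 cl K1 K2.
have A2 := posfun_compare_sqr M0 k0 pl1 pl2 cl K1 K2 cosq.
have A3 := posfun_compare_cdf M0 k0 pl1 pl2 cl K1 K2 cellle.
set a1 := l1 (fun x => x) in A1 cs *; set a2 := l2 (fun x => x) in A1 *.
set b1 := l1 (fun x => x ^+ 2) in A2 cs *; set b2 := l2 (fun x => x ^+ 2) in A2 b2B *.
have da : `|a1 - a2| <= th.
  have e1 : 4 * M / k%:R = (24 * M / k%:R) / 6 by field; rewrite gt_eqF.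
  by apply: le_trans A1 _; rewrite e1; lra.
have db : `|b1 - b2| <= th.
  have e1 : 8 * M ^+ 2 / k%:R = (24 * M ^+ 2 / k%:R) / 3 by field; rewrite gt_eqF.
  by apply: le_trans A2 _; rewrite e1; lra.
have v2 := posfun_variance_ge0 pl2; rewrite -/a2 -/b2 in v2.
rewrite /AD_value; apply: (Hcont _ _ _ _ _ _ rho).
- exact: posfun_subcdf.
- exact: posfun_subcdf.
- move=> u v uv; apply: (@le_trans _ _ (eta / 4)); last by lra.
  exact: posfun_cdf_dist uv.
- move=> t; apply: (le_trans (A3 t)).
  have : 2 * K / M ^+ 2 <= 2 * K / M.
    by rewrite ler_wpM2l ?mulr_ge0 ?(ltW K0)// lef_pV2 ?posrE ?exprn_gt0.
  by lra.
- by rewrite -/a1 -/a2 (le_trans da).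
- rewrite -/a2 -/b2 -ler_pdivlMr// (_ : rho / 2 / tau = sg); last first.
    by rewrite /sg; field; rewrite ?gt_eqF.
  apply: sqrt_dist_le => //; rewrite ?sqrtr_ge0 ?(ltW sg0)//.
  rewrite sqr_sqrtr ?subr_ge0//.
  apply: (variance_dist_le B0 th0 th1 _ da db v2 b2B cs); last first.
    by move: ths; rewrite ler_pdivlMr//; lra.
  by apply: (@le_trans _ _ (th / 3)); [rewrite -delE lerDr ltW|rewrite ler_pdivrMr// ler_peMr ?ler1n// ltW].
Qed.

End AD_compare.

(** * The Orlicz space and its dual *)

Section orlicz_space.
Context {R : realType}.
Local Notation N01 := (@normal_prob R 0 1).
Implicit Types (f g : R -> R) (l : (R -> R) -> R).

Lemma expR_chord (t s : R) : 0 <= t <= 1 -> expR (t * s) <= t * expR s + (1 - t).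
Proof.
move=> /andP[t0 t1].
have e1 : expR (t * s) * (1 + (1 - t) * s) <= expR s.
  rewrite [X in _ <= expR X](_ : s = t * s + (1 - t) * s); last by ring.
  by rewrite expRD ler_wpM2l ?expR_ge0 ?expR_ge1Dx.
have e2 : expR (t * s) * (1 - t * s) <= 1.
  by rewrite -[leRHS](expRxMexpNx_1 (t * s)) ler_wpM2l ?expR_ge0 ?expR_ge1Dx.
have {}e1 := ler_wpM2l t0 e1.
have t1' : 0 <= 1 - t by lra.
have {}e2 := ler_wpM2l t1' e2.
move: (expR s) (expR (t * s)) e1 e2 => u v; nra.
Qed.

Lemma Upsilon0_ge0 (x : R) : 0 <= Upsilon0 x.
Proof. by rewrite /Upsilon0; have := expR_ge1Dx `|x|; lra. Qed.

Lemma Upsilon0_ge (x : R) : `|x| - 1 <= Upsilon0 x.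
Proof.
rewrite /Upsilon0; have := normr_ge0 x; move: (`|x| : R) => t t0.
have h := expR_ge1Dx (t / 2).
have -> : expR t = expR (t / 2) ^+ 2 by rewrite expr2 -expRD -splitr.
have : (1 + t / 2) ^+ 2 <= expR (t / 2) ^+ 2.
  by rewrite lerXn2r ?nnegrE ?expR_ge0//; lra.
by have := sqr_ge0 (1 - t / 2); rewrite !expr2; nra.
Qed.

Lemma Upsilon0_le (x y : R) : `|x| <= `|y| -> Upsilon0 x <= Upsilon0 y.
Proof.
rewrite /Upsilon0; set s := `|x|; set t := `|y| => st.
have s0 : 0 <= s by exact: normr_ge0.
have h := expR_ge1Dx (t - s).
have es : 1 <= expR s by have := expR_ge1Dx s; lra.
rewrite [X in _ <= expR X - _ - _](_ : t = s + (t - s)); last by ring.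
by rewrite expRD; move: (expR s) es (expR (t - s)) h => u u1 v; nra.
Qed.

Lemma Upsilon0_scale (t x : R) : 0 <= t <= 1 -> Upsilon0 (t * x) <= t * Upsilon0 x.
Proof.
move=> t01; have /andP[t0 t1] := t01; rewrite /Upsilon0 normrM (ger0_norm t0).
by have := expR_chord `|x| t01; lra.
Qed.

Lemma Upsilon0_measurable f : measurable_fun setT f ->
  measurable_fun setT (fun x => Upsilon0 (f x)).
Proof.
move=> mf; have mn : measurable_fun setT (fun x => `|f x|) by exact: measurableT_comp.
by apply: measurable_funB => //; apply: measurable_funB => //; exact: expR_measurable.
Qed.

(** After division by 4 (A + 1) the modulus is at most 1 + x^2 / 4, and e^(x^2 / 4) is
    integrable. *)
Lemma quadb_orlicz f : quadb f -> orlicz f.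
Proof.
move=> [mf [A fA]]; split => //.
have A0 : 0 <= A by have := fA 0; rewrite expr0n/= addr0 mulr1; exact: le_trans.
have A1 : 0 < 4 * (A + 1) by lra.
exists (4 * (A + 1))^-1; first by rewrite invr_gt0.
have [c c0 ec] : exists2 c : R, 0 <= c & (\int[N01]_x (expR (1 / 4 * x ^+ 2))%:E = c%:E)%E.
  by apply: gaussian_exp_square; lra.
have mq : measurable_fun setT (fun x : R => expR (1 / 4 * x ^+ 2)).
  by apply: expR_measurable; apply: measurable_funM => //; exact: exprn_measurable.
rewrite unlock; apply: (@le_lt_trans _ _ (\int[N01]_x (expR 1 * expR (1 / 4 * x ^+ 2))%:E)%E).
  apply: le_integral_EFin.
  - by apply: Upsilon0_measurable; exact: measurable_funM.
  - exact: measurable_funM.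
  - by move=> x; exact: Upsilon0_ge0.
  - move=> x; rewrite -expRD /Upsilon0.
    set y := `|_|; have y0 : 0 <= y by exact: normr_ge0.
    rewrite (@le_trans _ _ (expR y))//; first by lra.
    rewrite ler_expR /y normrM ger0_norm ?invr_ge0 ?(ltW A1)//.
    rewrite mulrC ler_pdivrMr// (le_trans (fA x))//.
    by have := sqr_ge0 x; move: (x ^+ 2) => q; nra.
rewrite integralZl_EFin_ge0 ?expR_ge0//.
by rewrite ec -EFinM ltry.
Qed.

Lemma orlicz_integrable f : orlicz f -> N01.-integrable setT (EFin \o f).
Proof.
move=> [mf [m m0 fin]]; apply/integrableP; split; first exact/measurable_EFinP.
move: fin; rewrite unlock => fin.
have mU := Upsilon0_measurable (measurable_funM (measurable_cst m) mf).
apply: (@le_lt_trans _ _ (\int[N01]_x (m^-1 * (Upsilon0 (m * f x) + 1))%:E)%E).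
  apply: le_integral_EFin.
  - exact: measurableT_comp.
  - by apply: measurable_funM => //; exact: measurable_funD.
  - by move=> x.
  - move=> x; rewrite mulrC ler_pdivlMr// -lerBlDr.
    by rewrite -[X in _ * X - _](gtr0_norm m0) -normrM mulrC Upsilon0_ge.
rewrite integralZl_EFin_ge0 ?invr_ge0 ?ltW//; last 2 first.
- exact: measurable_funD.
- by move=> x; rewrite addr_ge0// Upsilon0_ge0.
rewrite integralD_EFin_ge0//; last by move=> x; exact: Upsilon0_ge0.
by rewrite integral_cstP lte_mul_pinfty ?lee_fin ?invr_ge0 ?(ltW m0)// lte_add_pinfty// ltry.
Qed.

(** The real [inf] of an empty set is a default value, so a small [luxemburg] provides an admissible
    [lam] only once the set is known to be inhabited. *)
Lemma orlicz_luxemburg_ne f g : orlicz f -> orlicz g ->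
  [set lam : R | 0 < lam /\
    ('E_N01[fun x => Upsilon0 ((f x - g x) / lam)] <= 1)%E] !=set0.
Proof.
move=> [mf [a a0 fa]] [mg [b b0 gb]]; move: fa gb; rewrite unlock => fa gb.
(* Half of both scales, because |f - g| <= 2 max(|f|, |g|): at each point one of the two [Upsilon0]
   terms dominates. *)
pose m : R := Num.min a b / 2.
have m0 : 0 < m by rewrite divr_gt0// lt_min a0.
have [ma mb] : 2 * m <= a /\ 2 * m <= b.
  by split; rewrite /m mulrC divfK// ge_min lexx ?orbT.
clearbody m.
have mUa := Upsilon0_measurable (measurable_funM (measurable_cst a) mf).
have mUb := Upsilon0_measurable (measurable_funM (measurable_cst b) mg).
have mfg : measurable_fun setT (fun x => f x - g x) by exact: measurable_funB.
have Uab x : Upsilon0 (m * (f x - g x)) <= Upsilon0 (a * f x) + Upsilon0 (b * g x).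
  have [fg|gf] := leP `|f x| `|g x|.
    rewrite (@le_trans _ _ (Upsilon0 (b * g x))) ?lerDr ?Upsilon0_ge0//.
    apply: Upsilon0_le; rewrite !normrM (gtr0_norm m0) (gtr0_norm b0).
    have := ler_normB (f x) (g x); have := normr_ge0 (g x); nra.
  rewrite (@le_trans _ _ (Upsilon0 (a * f x))) ?lerDl ?Upsilon0_ge0//.
  apply: Upsilon0_le; rewrite !normrM (gtr0_norm m0) (gtr0_norm a0).
  have := ler_normB (f x) (g x); have := normr_ge0 (f x); nra.
set c := (\int[N01]_x (Upsilon0 (a * f x) + Upsilon0 (b * g x))%:E)%E.
have c0 : (0 <= c)%E.
  by apply: integral_ge0 => x _; rewrite lee_fin addr_ge0// Upsilon0_ge0.
have cfin : c \is a fin_num.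
  rewrite ge0_fin_numE// /c integralD_EFin_ge0//; last 2 first.
  - by move=> x; exact: Upsilon0_ge0.
  - by move=> x; exact: Upsilon0_ge0.
  by rewrite lte_add_pinfty.
pose k : R := Num.max 1 (fine c); have k1 : 1 <= k by rewrite le_max lexx.
have k0 : 0 < k by lra.
exists (k / m); split; first by rewrite divr_gt0.
apply: (@le_trans _ _ (\int[N01]_x (k^-1 * (Upsilon0 (a * f x) + Upsilon0 (b * g x)))%:E)%E).
  apply: le_integral_EFin.
  - by apply: Upsilon0_measurable; exact: measurable_funM.
  - by apply: measurable_funM => //; exact: measurable_funD.
  - by move=> x; exact: Upsilon0_ge0.
  - move=> x; rewrite invf_div mulrC -mulrA mulrCA.
    rewrite mulrA [X in Upsilon0 X](_ : _ = k^-1 * (m * (f x - g x))); last by ring.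
    apply: (le_trans (Upsilon0_scale _ _)).
      by rewrite invr_ge0 (ltW k0) invf_le1.
    by rewrite ler_wpM2l ?invr_ge0 ?(ltW k0).
rewrite integralZl_EFin_ge0 ?invr_ge0 ?(ltW k0)//; last 2 first.
- exact: measurable_funD.
- by move=> x; rewrite addr_ge0// Upsilon0_ge0.
rewrite -/c -(fineK cfin) -EFinM lee_fin mulrC ler_pdivrMr// mul1r.
by rewrite le_max lexx orbT.
Qed.

Lemma luxemburg_lt f g (del : R) : orlicz f -> orlicz g ->
  luxemburg (fun x => f x - g x) < del -> exists lam : R, [/\ 0 < lam, lam < del &
    ('E_N01[fun x => Upsilon0 ((f x - g x) / lam)] <= 1)%E].
Proof.
move=> of_ og; rewrite /luxemburg => /inf_lt.
by move=> /(_ (orlicz_luxemburg_ne of_ og))[lam [lam0 E1] ld]; exists lam.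
Qed.

(** Young's inequality for the conjugate pair d ln d - d and e^y, the case d = 0 included. *)
Lemma young_exp (d y : R) : 0 <= d -> d * y <= d * ln d - d + expR y.
Proof.
rewrite le_eqVlt => /predU1P[<-|d0]; first by rewrite !mul0r subrr add0r expR_ge0.
have := expR_ge1Dx (y - ln d); rewrite expRB (lnK d0) -(@ler_pM2l _ d)// mulrCA divff ?gt_eqF// mulr1.
lra.
Qed.

Section density_functional.
Variables (D : R -> R) (B H : R).
Hypotheses (mD : measurable_fun setT D) (D0 : forall x, 0 <= D x <= B).
Hypothesis D1 : (\int[N01]_x (D x)%:E = 1)%E.
Hypothesis mDlnD : N01.-integrable setT (fun x => (D x * ln (D x))%:E).
Hypothesis DlnD : (\int[N01]_x (D x * ln (D x))%:E = H%:E)%E.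

Definition densf f : R := fine (\int[N01]_x (D x * f x)%:E)%E.

Let B0 : 0 <= B.
Proof. by have /andP[] := D0 0; exact: le_trans. Qed.

Lemma densf_integrable f : N01.-integrable setT (EFin \o f) ->
  N01.-integrable setT (EFin \o (fun x => D x * f x)).
Proof.
move=> fi; have mf := measurable_int _ fi.
apply: (le_integrable measurableT _ _ (integrableZl measurableT B fi)) => //.
- by apply/measurable_EFinP; apply: measurable_funM => //; exact/measurable_EFinP.
- move=> x _; rewrite -EFinM lee_fin !normrM ler_wpM2r//.
  by have /andP[d0 dB] := D0 x; rewrite !ger0_norm.
Qed.

Lemma densf_lin c f g : N01.-integrable setT (EFin \o f) ->
  N01.-integrable setT (EFin \o g) ->
  densf (fun x => c * f x + g x) = c * densf f + densf g.
Proof.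
move=> fi gi; have dfi := densf_integrable fi; have dgi := densf_integrable gi.
have cdfi : N01.-integrable setT (EFin \o (fun x => c * (D x * f x))).
  by have := integrableZl measurableT c dfi.
rewrite /densf -/(Rintegral N01 setT _) -/(Rintegral N01 setT (fun x => D x * f x)).
rewrite -/(Rintegral N01 setT (fun x => D x * g x)).
rewrite -RintegralZl// -RintegralD//.
by apply: eq_Rintegral => x _; ring.
Qed.

(** The bound |h - f| <= lam (Upsilon0((h - f) / lam) + 1) integrates to at most 2 lam, so with
    [D <= B] the functional changes by at most 2 B lam. *)
Lemma densf_dual : orlicz_dual densf.
Proof.
split=> [c f g of_ og|f of_ e e0].
  by apply: densf_lin; exact: orlicz_integrable.
have B1 : 0 < B + 1 by rewrite ltr_wpDl.
exists (e / (2 * (B + 1))); first by rewrite divr_gt0// mulr_gt0.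
move=> h oh lhf.
have [lam [lam0 lamd]] := luxemburg_lt oh of_ lhf; rewrite unlock => E1.
have hi := orlicz_integrable oh; have fi := orlicz_integrable of_.
have hfi : N01.-integrable setT (EFin \o (fun x => h x - f x)).
  exact: (integrableB measurableT hi fi).
have -> : densf h - densf f = densf (fun x => h x - f x).
  have := densf_lin (-1) fi hi; rewrite mulN1r addrC => <-.
  by congr densf; apply/funext => x; ring.
have di := densf_integrable hfi.
have mhf : measurable_fun setT (fun x => h x - f x).
  by apply/measurable_EFinP; exact: measurable_int hfi.
apply: (@le_lt_trans _ _ (B * (2 * lam))); last first.
  move: lamd; rewrite ltr_pdivlMr; last by rewrite mulr_gt0.
  by nra.
apply: (le_trans (le_normr_Rintegral measurableT di)).
rewrite -lee_fin /Rintegral fineK; last first.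
  exact: (integrable_fin_num _ (integrable_norm di)).
apply: (@le_trans _ _ (\int[N01]_x (B * (lam * (Upsilon0 ((h x - f x) / lam) + 1)))%:E)%E).
  have mU : measurable_fun setT (fun x => Upsilon0 ((h x - f x) / lam)).
    by apply: Upsilon0_measurable; exact: measurable_funM.
  apply: le_integral_EFin.
  - by apply: measurableT_comp => //; exact: measurable_funM.
  - by apply: measurable_funM => //; apply: measurable_funM => //; exact: measurable_funD.
  - by move=> x; exact: normr_ge0.
  - move=> x; have /andP[d0 dB] := D0 x; rewrite normrM (ger0_norm d0).
    apply: ler_pM => //; rewrite mulrC -ler_pdivrMr// -lerBlDr.
    by rewrite -[X in _ / X - _](gtr0_norm lam0) -normf_div Upsilon0_ge.
have mU : measurable_fun setT (fun x => Upsilon0 ((h x - f x) / lam)).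
  by apply: Upsilon0_measurable; exact: measurable_funM.
have U0 x : 0 <= Upsilon0 ((h x - f x) / lam) + 1 by rewrite addr_ge0// Upsilon0_ge0.
rewrite integralZl_EFin_ge0//; last 2 first.
- by apply: measurable_funM => //; exact: measurable_funD.
- by move=> x; rewrite mulr_ge0 ?(ltW lam0).
rewrite integralZl_EFin_ge0 ?(ltW lam0)//; last exact: measurable_funD.
rewrite integralD_EFin_ge0//; last by move=> x; exact: Upsilon0_ge0.
rewrite integral_cstP EFinM lee_wpmul2l ?lee_fin// mulrC EFinM lee_wpmul2l ?lee_fin ?(ltW lam0)//.
by rewrite (_ : 2%:E = 1 + 1)%E ?leeD2r// -EFinD.
Qed.

(** One half of the Gibbs variational principle: Young's inequality with d = D x and y = f x - C is
    integrated, and C = ln E e^f is the best constant. An infinite E e^f makes the corresponding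
    term -oo. *)
Lemma densf_entropy : (J_Phi densf <= H%:E)%E.
Proof.
apply: ge_ereal_sup => _ [f of_ <-]; rewrite unlock.
have fi := orlicz_integrable of_.
have E0 : (0 <= \int[N01]_x (expR (f x))%:E)%E.
  by apply: integral_ge0 => x _; rewrite lee_fin expR_ge0.
have mf : measurable_fun setT f by have [] := of_.
have [Efin|] := boolP ((\int[N01]_x (expR (f x))%:E)%E \is a fin_num); last first.
  rewrite ge0_fin_numE// -leNgt leye_eq => /eqP ->.
  by rewrite /= addeNy leNye.
set c := fine (\int[N01]_x (expR (f x))%:E)%E.
have c0 : 0 <= c by rewrite fine_ge0.
have Ec : (\int[N01]_x (expR (f x))%:E = c%:E)%E by rewrite /c fineK.
have key C : densf f <= H - 1 + C + expR (- C) * c.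
  have ei : N01.-integrable setT (EFin \o (fun x => expR (- C) * expR (f x))).
    have efi : N01.-integrable setT (EFin \o (fun x => expR (f x))).
      apply/integrableP; split; first by apply/measurable_EFinP; exact: expR_measurable.
      under eq_integral do rewrite gee0_abs ?lee_fin ?expR_ge0//.
      by rewrite -ge0_fin_numE.
    exact: (integrableZl measurableT (expR (- C)) efi).
  have Di : N01.-integrable setT (EFin \o D).
    apply/integrableP; split; first exact/measurable_EFinP.
    under eq_integral => x _ do
      (rewrite gee0_abs; last by rewrite lee_fin; have /andP[] := D0 x).
    by rewrite D1 ltry.
  have CDi : N01.-integrable setT (EFin \o (fun x => (C - 1) * D x)).
    exact: (integrableZl measurableT (C - 1) Di).
  have E1 : Rintegral N01 setT (fun x => (C - 1) * D x) = C - 1.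
    by rewrite RintegralZl// /Rintegral D1 mulr1.
  have E2 : Rintegral N01 setT (fun x => expR (- C) * expR (f x)) = expR (- C) * c.
    rewrite /Rintegral; have -> : (\int[N01]_x (expR (- C) * expR (f x))%:E = (expR (- C) * c)%:E)%E.
      rewrite integralZl_EFin_ge0 ?expR_ge0//; last exact: expR_measurable.
      by rewrite Ec -EFinM.
    by [].
  have E3 : Rintegral N01 setT (fun x => D x * ln (D x)) = H by rewrite /Rintegral DlnD.
  have i1 : N01.-integrable setT (EFin \o (fun x => D x * ln (D x) + (C - 1) * D x)).
    exact: (integrableD measurableT mDlnD CDi).
  have -> : H - 1 + C + expR (- C) * c = Rintegral N01 setT (fun x => D x * ln (D x) + (C - 1) * D x + expR (- C) * expR (f x)).
    by rewrite RintegralD// RintegralD// E1 E2 E3; ring.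
  apply: le_Rintegral => //.
  - exact: densf_integrable.
  - exact: (integrableD measurableT i1 ei).
  - move=> x _; have /andP[d0 _] := D0 x.
    have := young_exp (f x - C) d0; rewrite expRD; lra.
rewrite Ec; case: (ltgtP c 0) c0 => // [c0 _|c0 _].
  rewrite lne_EFin// -EFinN -EFinD lee_fin.
  have := key (ln c); rewrite expRN (lnK c0) mulVf ?gt_eqF//; lra.
by exfalso; have := key (densf f - H); rewrite c0; lra.
Qed.

End density_functional.

Section dual_posfun.
Variables (l : (R -> R) -> R) (J0 : R).
Hypotheses (dl : orlicz_dual l) (Jl : (J_Phi l <= J0%:E)%E).

Lemma orlicz_dual_entropy_bound : entropy_bound l J0.
Proof.
move=> f qf c c0 Ec.
have Jf : ((l f)%:E - lne 'E_N01[fun x => expR (f x)] <= J_Phi l)%E.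
  by apply: ereal_sup_ubound; exists f => //; exact: quadb_orlicz.
have := le_trans Jf Jl; rewrite unlock.
have E0 : (0 <= \int[N01]_x (expR (f x))%:E)%E.
  by apply: integral_ge0 => x _; rewrite lee_fin expR_ge0.
move: Ec E0; case: (\int[N01]_x _)%E => [r| |]//; rewrite !lee_fin => rc r0.
rewrite le_eqVlt in r0; case/predU1P: r0 => [<-|r0]; first by rewrite le0_lneNy//= addey.
rewrite lne_EFin// -EFinN -EFinD lee_fin lerBlDr => /le_trans; apply.
by rewrite lerD2l ler_ln.
Qed.

(** If f >= 0 and l f < 0, the multiple of f at which [l] takes the value J0 + 1 is nonpositive, so
    its exponential mean is at most 1, against the bound J0. Constants give c (l 1 - 1) <= J0 for
    every real c, hence l 1 = 1. *)
Lemma orlicz_dual_posfun : posfun l.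
Proof.
have [lin _] := dl.
have lin' c f g : quadb f -> quadb g -> l (fun x => c * f x + g x) = c * l f + l g.
  by move=> /quadb_orlicz of_ /quadb_orlicz og; exact: lin.
have l0 : l (fun=> 0) = 0.
  have := lin' 1 _ _ (quadb_cst 0) (quadb_cst 0).
  by under eq_fun do rewrite mulr0 addr0; lra.
have lZ c f : quadb f -> l (fun x => c * f x) = c * l f.
  move=> qf; have := lin' c _ _ qf (quadb_cst 0).
  by under eq_fun do rewrite addr0; rewrite l0 addr0.
have small y : (forall c : R, c * y <= J0) -> y = 0.
  move=> cy; apply/eqP; apply: contraT => y0.
  have := cy ((J0 + 1) / y); rewrite divfK//; lra.
split => //.
  move=> f qf f0; rewrite leNgt; apply/negP => lf.
  have := @orlicz_dual_entropy_bound _ (quadbZ ((J0 + 1) / l f) qf).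
  have J0' : 0 <= J0.
    have := orlicz_dual_entropy_bound (quadb_cst 0) ltr01.
    rewrite l0 ln1 addr0; apply; rewrite expR0 integral_cstP//.
  move=> /(_ 1 ltr01); rewrite lZ// divfK ?lt_eqF// ln1 addr0.
  have le1 : (\int[N01]_x (expR ((J0 + 1) / l f * f x))%:E <= 1)%E.
    rewrite -(integral_cstP N01); apply: le_integral_EFin => //.
    - by apply: expR_measurable; apply: measurable_funM => //; have [] := qf.
    - move=> x; rewrite -[leRHS]expR0 ler_expR; apply: mulr_le0_ge0 => //.
      by apply: mulr_ge0_le0; [lra|rewrite invr_le0 ltW].
  by move=> /(_ le1); lra.
apply/eqP; rewrite -subr_eq0; apply/eqP; apply: small => c.
have := @orlicz_dual_entropy_bound _ (quadb_cst c) (expR c) (expR_gt0 _).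
rewrite integral_cstP lexx => /(_ isT); rewrite expRK.
have := lZ c _ (quadb_cst 1); under eq_fun do rewrite mulr1.
by move=> ->; lra.
Qed.

End dual_posfun.

End orlicz_space.

(** * Densities constant on finitely many sets *)

Section finite_density.
Context {R : realType}.
Local Notation N01 := (@normal_prob R 0 1).
Variables (I : finType) (A : I -> set R) (w : I -> R).
Let p i := fine (N01 (A i)).
Hypotheses (mA : forall i, measurable (A i)) (p0 : forall i, 0 < p i).
Hypothesis dA : forall i j x, A i x -> A j x -> i = j.
Hypotheses (w0 : forall i, 0 <= w i) (w1 : \sum_i w i = 1).

Let step (v : I -> R) (x : R) : R := \sum_i v i * \1_(A i) x.

Let step_in v i x : A i x -> step v x = v i.
Proof.
move=> Aix; rewrite /step (bigD1 i)//= indicE mem_set// mulr1 big1 ?addr0// => j ji.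
rewrite indicE memNset ?mulr0// => Ajx; move/eqP: ji; apply; exact: dA Ajx Aix.
Qed.

Let step_out v x : (forall i, ~ A i x) -> step v x = 0.
Proof. by move=> nA; rewrite /step big1// => i _; rewrite indicE memNset ?mulr0. Qed.

Let mI i : measurable_fun setT (\1_(A i) : R -> R).
Proof. exact: measurable_indic. Qed.

Let mstep v : measurable_fun setT (step v).
Proof. by apply: measurable_sum => i; exact: measurable_funM. Qed.

Let step_case (P : R -> Prop) v x : (forall i, A i x -> P (v i)) -> P 0 -> P (step v x).
Proof.
move=> Pv P0; have [[i Aix]|nA] := pselect (exists i, A i x).
  by rewrite (step_in v Aix); exact: Pv Aix.
by rewrite step_out// => i Aix; apply: nA; exists i.
Qed.

Let step_bnd v x : `|step v x| <= \sum_i `|v i|.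
Proof.
apply: (@step_case (fun y => `|y| <= \sum_i `|v i|)) => [i _|].
  by rewrite (bigD1 i)//= lerDl sumr_ge0.
by rewrite normr0 sumr_ge0.
Qed.

Let step_integrable v : N01.-integrable setT (EFin \o step v).
Proof. by apply: orlicz_integrable; apply: quadb_orlicz; apply: quadb_bounded (step_bnd v). Qed.

Let step_integral v : (\int[N01]_x (step v x)%:E = (\sum_i v i * p i)%:E)%E.
Proof.
have ii i : N01.-integrable setT (fun x => (\1_(A i) x)%:E)
  by apply: orlicz_integrable; apply: quadb_orlicz; exact: quadb_indic.
under eq_integral do rewrite /step -sumEFin.
rewrite integral_sum//; last first.
  by move=> i; exact: (integrableZl measurableT (v i) (ii i)).
rewrite -sumEFin; apply: eq_bigr => i _.
under eq_integral do rewrite EFinM.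
transitivity ((v i)%:E * N01 (A i))%E; first rewrite integralZl//.
  by congr (_ * _)%E; exact: (integral_indicT N01 (mA i)).
rewrite EFinM /p fineK//; exact: (fin_num_measure N01 _ (mA i)).
Qed.

(** The density is w_i / p_i on A_i and 0 elsewhere; it is bounded, hence in the dual, and its
    relative entropy is the displayed sum. By the last clause the functional ignores everything off
    the sets [A i]. *)
Lemma finite_density_functional :
  exists l : (R -> R) -> R, [/\ orlicz_dual l,
    (J_Phi l <= (\sum_i w i * ln (w i / p i))%:E)%E,
    forall i, l \1_(A i) = w i &
    forall f g, (forall x i, A i x -> f x = g x) -> l f = l g].
Proof.
pose v i := w i / p i; pose D := step v.
have D0 x : 0 <= D x <= \sum_i `|v i|.
  apply/andP; split; last exact: le_trans (ler_norm _) (step_bnd v x).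
  by apply: (@step_case (fun y => 0 <= y)) => // i _; rewrite divr_ge0// ltW.
have DlnE : (fun x => D x * ln (D x)) = step (fun i => v i * ln (v i)).
  apply/funext => x; have [[i Aix]|nA] := pselect (exists i, A i x).
    by rewrite /D !(step_in _ Aix).
  by rewrite /D !step_out ?mul0r// => i Aix; apply: nA; exists i.
have pw i : v i * p i = w i by rewrite /v divfK// gt_eqF.
have D1 : (\int[N01]_x (D x)%:E = 1)%E.
  by rewrite step_integral; congr EFin; rewrite -w1; apply: eq_bigr => i _; rewrite pw.
have DlnD : (\int[N01]_x (D x * ln (D x))%:E = (\sum_i w i * ln (w i / p i))%:E)%E.
  transitivity (\int[N01]_x (step (fun i => v i * ln (v i)) x)%:E)%E.
    by apply: eq_integral => x _; rewrite -DlnE.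
  rewrite step_integral; congr EFin; apply: eq_bigr => i _.
  by rewrite mulrAC pw.
have DlnI : N01.-integrable setT (fun x => (D x * ln (D x))%:E).
  have := step_integrable (fun i => v i * ln (v i)); apply: eq_integrable => // x _.
  by rewrite /= -DlnE.
exists (densf D); split.
- exact: (densf_dual (mstep v) D0).
- exact: (densf_entropy (mstep v) D0 D1 DlnI DlnD).
- move=> i; rewrite /densf.
  transitivity (fine (\int[N01]_x (step (fun j => if j == i then v i else 0) x)%:E)%E).
    congr fine; apply: eq_integral => x _; congr EFin.
    have [[j Ajx]|nA] := pselect (exists j, A j x).
      rewrite /D !(step_in _ Ajx); have [<-|ji] := eqVneq j i.
        by rewrite indicE mem_set// mulr1.
      rewrite indicE memNset ?mulr0// => Aix.
      by move/eqP: ji; apply; exact: dA Ajx Aix.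
    by rewrite /D !step_out ?mul0r// => j Ajx; apply: nA; exists j.
  rewrite step_integral/= (bigD1 i)//= eqxx pw big1 ?addr0// => j /negPf ->.
  by rewrite mul0r.
- move=> f g fg; rewrite /densf; congr fine; apply: eq_integral => x _; congr EFin.
  have [[i Aix]|nA] := pselect (exists i, A i x); first by rewrite (fg x i Aix).
  by rewrite /D step_out ?mul0r// => i Aix; apply: nA; exists i.
Qed.

End finite_density.

(** * Concentration of multinomial counts and change of measure *)

Section finite_sanov.
Context {R : realType}.
Variables (I : finType) (w : I -> R).
Hypotheses (w0 : forall i, 0 <= w i) (w1 : \sum_i w i = 1).

Definition occ n (s : {ffun 'I_n -> I}) (i : I) : nat := #|[pred j | s j == i]|.

Lemma prod_mgf n (u : I -> R) :
  \sum_(s : {ffun 'I_n -> I}) \prod_j (w (s j) * u (s j)) =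
  (\sum_i w i * u i) ^+ n.
Proof.
by rewrite -(bigA_distr_bigA (fun (j : 'I_n) i => w i * u i)) prodr_const card_ord.
Qed.

Lemma sum_prod_weights n : \sum_(s : {ffun 'I_n -> I}) \prod_j w (s j) = 1.
Proof.
have := prod_mgf n (fun=> 1); under eq_bigr do under eq_bigr do rewrite mulr1.
by move=> ->; under eq_bigr do rewrite mulr1; rewrite w1 expr1n.
Qed.

Lemma prod_occ n (s : {ffun 'I_n -> I}) (u : I -> R) :
  \prod_j u (s j) = \prod_i u i ^+ occ s i.
Proof.
rewrite (partition_big s xpredT)//=; apply: eq_bigr => i _.
rewrite (eq_bigr (fun=> u i)) => [|j /eqP->//].
by rewrite prodr_const.
Qed.

(** From e^(-x/2) >= 1 - x/2 one gets e^x <= (1 - x/2)^(-2), and (1 + x + x^2) (1 - x/2)^2 = 1 +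
    (x^2 / 4) (1 - 3 x + x^2), which is at least 1 for |x| <= 1/4. *)
Lemma expR_le_quad (x : R) : `|x| <= 1 / 4 -> expR x <= 1 + x + x ^+ 2.
Proof.
rewrite ler_norml => /andP[xl xr].
have h := expR_ge1Dx (- (x / 2)); have h2 := expRxMexpNx_1 (x / 2).
have E0 := expR_gt0 (x / 2).
have -> : expR x = expR (x / 2) ^+ 2 by rewrite expr2 -expRD -splitr.
move: (expR (x / 2)) (expR (- (x / 2))) E0 h h2 => e f e0 h h2.
have h3 : e * (1 - x / 2) <= 1 by rewrite -[leRHS]h2 ler_pM2l.
have h4 : e ^+ 2 * (1 - x / 2) ^+ 2 <= 1.
  by rewrite -exprMn -[leRHS](expr1n _ 2) lerXn2r ?nnegrE// mulr_ge0 ?ltW//; lra.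
have y0 : 0 < (1 - x / 2) ^+ 2 by rewrite exprn_gt0//; lra.
rewrite -(ler_pM2r y0) (le_trans h4)//.
rewrite (_ : (1 + x + x ^+ 2) * (1 - x / 2) ^+ 2 =
  1 + x ^+ 2 / 4 * (1 - 3 * x + x ^+ 2)); last by field.
by rewrite lerDl mulr_ge0 ?divr_ge0 ?sqr_ge0//; nra.
Qed.

(** The sum is the n-th power of a one-letter moment generating function; the centred letter has
    mean 0 and modulus at most 1, so this factor is at most 1 + th^2 <= e^(th^2). *)
Lemma occ_mgf n (i : I) (th : R) : `|th| <= 1 / 4 ->
  \sum_(s : {ffun 'I_n -> I}) (\prod_j w (s j)) * expR (th * ((occ s i)%:R - n%:R * w i))
   <= expR (n%:R * th ^+ 2).
Proof.
move=> th4; pose u (j : I) := expR (th * ((j == i)%:R - w i)).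
have wi1 : w i <= 1 by rewrite -w1 (bigD1 i)//= lerDl sumr_ge0.
rewrite (_ : \sum_s _ = \sum_(s : {ffun 'I_n -> I}) \prod_j (w (s j) * u (s j))); last first.
  apply: eq_bigr => s _; rewrite big_split/=; congr (_ * _).
  rewrite /u -expR_sum -mulr_sumr; congr (expR (_ * _)).
  rewrite sumrB sumr_const card_ord -(mulr_natl (w i) n); congr (_ - _).
  rewrite /occ -sum1_card natr_sum/=.
  by rewrite big_mkcond/=; apply: eq_bigr => j _; rewrite inE; case: eqP.
rewrite prod_mgf expRM_natl lerXn2r ?nnegrE ?expR_ge0//.
  by apply: sumr_ge0 => j _; rewrite mulr_ge0 ?expR_ge0.
apply: le_trans (expR_ge1Dx _).
apply: (@le_trans _ _ (\sum_j w j * (1 + th * ((j == i)%:R - w i) + th ^+ 2))).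
  apply: ler_sum => j _; rewrite ler_wpM2l// /u.
  have y1 : `|(j == i)%:R - w i| <= 1.
    by have := w0 i; case: (j == i) => /= wi; rewrite ?mulr1n ?mulr0n ler_norml; apply/andP; split; lra.
  apply: (le_trans (expR_le_quad _)).
    by rewrite normrM (le_trans _ th4)// ler_piMr.
  rewrite lerD2l exprMn ler_piMr ?sqr_ge0//.
  by rewrite -[leLHS]real_normK ?num_real// -[leRHS](expr1n _ 2) lerXn2r ?nnegrE.
rewrite (eq_bigr (fun j => w j * (1 + th ^+ 2 - th * w i) + th * (w j * (j == i)%:R))); last first.
  by move=> j _; ring.
rewrite big_split/= -mulr_suml w1 -mulr_sumr (bigD1 i)//= eqxx mulr1.
rewrite big1 ?addr0 => [|j /negPf ->]; last by rewrite mulr0.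
lra.
Qed.

Lemma occ_deviation n (i : I) (del : R) : 0 < del -> del <= 1 / 2 ->
  \sum_(s : {ffun 'I_n -> I} | n%:R * del < `|(occ s i)%:R - n%:R * w i|)
     (\prod_j w (s j)) <= 2 * expR (- (n%:R * (del ^+ 2 / 4))).
Proof.
(* The optimal Chernoff parameter: -del th + th^2 is minimal there, with value -del^2 / 4, and
   [del <= 1 / 2] gives th <= 1/4. *)
move=> d0 d1; pose th := del / 2.
pose G (t : R) (s : {ffun 'I_n -> I}) :=
  (\prod_j w (s j)) * expR (t * ((occ s i)%:R - n%:R * w i)).
have G0 t s : 0 <= G t s by rewrite mulr_ge0 ?expR_ge0// prodr_ge0.
have thn : `|th| <= 1 / 4 by rewrite ger0_norm /th; lra.
apply: (@le_trans _ _ (\sum_s expR (- (n%:R * del * th)) * (G th s + G (- th) s))).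
  rewrite [leRHS](bigID (fun s => n%:R * del < `|(occ s i)%:R - n%:R * w i|))/=.
  rewrite -[leLHS]addr0 lerD//; last first.
    by apply: sumr_ge0 => s _; rewrite mulr_ge0 ?expR_ge0// addr_ge0.
  apply: ler_sum => s; rewrite /G -mulrDr mulrCA => dev.
  rewrite -[leLHS]mulr1 ler_wpM2l ?prodr_ge0// mulrDr -!expRD.
  move: dev; set y := _ - _; rewrite lter_normr => /orP[] dev.
    rewrite -[leLHS]addr0 lerD ?expR_ge0// -[leLHS]expR0 ler_expR.
    by rewrite addrC subr_ge0 mulrC ler_wpM2l ?(ltW dev)//; rewrite /th; lra.
  rewrite -[leLHS]add0r lerD ?expR_ge0// -[leLHS]expR0 ler_expR mulNr -mulrN.
  by rewrite addrC subr_ge0 mulrC ler_wpM2l ?(ltW dev)//; rewrite /th; lra.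
rewrite -mulr_sumr big_split/=.
have := occ_mgf n i thn; have := @occ_mgf n i (- th); rewrite normrN => /(_ thn).
rewrite sqrrN -/(G _ _) => g1 g2.
apply: (@le_trans _ _ (expR (- (n%:R * del * th)) * (expR (n%:R * th ^+ 2) + expR (n%:R * th ^+ 2)))).
  by rewrite ler_wpM2l ?expR_ge0// lerD.
rewrite mulrDr -!expRD (_ : - _ + _ = - (n%:R * (del ^+ 2 / 4))); first by lra.
by rewrite /th; field.
Qed.

Lemma occ_concentration (del : R) : 0 < del -> exists n0, forall n, (n0 <= n)%N ->
  1 / 2 <= \sum_(s : {ffun 'I_n -> I} |
     [forall i, `|(occ s i)%:R - n%:R * w i| <= n%:R * del]) \prod_j w (s j).
Proof.
move=> d0.
wlog d1 : del d0 / del <= 1 / 2.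
  move=> H; have [|/ltW d1] := leP del (1 / 2); first exact: H.
  have [|n0 Hn0] := H (1 / 2) _ (lexx _); first by lra.
  exists n0 => n nn0; apply: le_trans (Hn0 n nn0) _.
  rewrite [leRHS](bigID (fun s : {ffun 'I_n -> I} => [forall i, `|(occ s i)%:R - n%:R * w i| <= n%:R * (1 / 2)]))/=.
  rewrite -[leLHS]addr0 lerD//; last by apply: sumr_ge0 => s _; exact: prodr_ge0.
  rewrite le_eqVlt; apply/orP; left; apply/eqP; apply: eq_bigl => s.
  rewrite andb_idl// => /forallP hs; apply/forallP => i.
  by apply: le_trans (hs i) _; rewrite ler_wpM2l.
pose c := del ^+ 2 / 4; have c0 : 0 < c by rewrite divr_gt0// exprn_gt0.
(* The union bound 2 #|I| e^(-n c) is at most 1/2 once n c >= 4 #|I|, by e^y >= 1 + y. *)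
exists (Num.truncn (4 * #|I|%:R / c)).+1 => n nn0.
have nc : 4 * #|I|%:R <= n%:R * c.
  rewrite -ler_pdivrMr//; apply/ltW; apply: lt_le_trans (truncnS_gt _) _.
  by rewrite ler_nat.
have tot := sum_prod_weights n.
rewrite (bigID (fun s : {ffun 'I_n -> I} => [forall i, `|(occ s i)%:R - n%:R * w i| <= n%:R * del]))/= in tot.
have bad : \sum_(s : {ffun 'I_n -> I} | ~~ [forall i, `|(occ s i)%:R - n%:R * w i| <= n%:R * del])
   \prod_j w (s j) <= \sum_(i : I) 2 * expR (- (n%:R * c)).
  apply: (@le_trans _ _ (\sum_(i : I) \sum_(s : {ffun 'I_n -> I} |
      n%:R * del < `|(occ s i)%:R - n%:R * w i|) \prod_j w (s j))).
    rewrite (exchange_big_dep xpredT)//= [leRHS](bigID (fun s : {ffun 'I_n -> I} => ~~ [forall i, `|(occ s i)%:R - n%:R * w i| <= n%:R * del]))/=.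
    rewrite -[leLHS]addr0 lerD//; last first.
      by apply: sumr_ge0 => s _; apply: sumr_ge0 => i _; exact: prodr_ge0.
    apply: ler_sum => s; rewrite negb_forall => /existsP[i]; rewrite -ltNge => si.
    by rewrite (bigD1 i)//= lerDl sumr_ge0// => j _; exact: prodr_ge0.
  by apply: ler_sum => i _; exact: occ_deviation.
have : \sum_(i : I) 2 * expR (- (n%:R * c)) <= 1 / 2.
  rewrite sumr_const -(mulr_natl _ #|I|) expRN.
  have E := expR_ge1Dx (n%:R * c); have E0 := expR_gt0 (n%:R * c).
  by rewrite mulrA ler_pdivrMr//; lra.
by move: tot bad; lra.
Qed.

End finite_sanov.

Section sanov_lower_bound.
Context d (T : measurableType d) (R : realType) (P : probability T R).
Local Notation N01 := (@normal_prob R 0 1).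
Variable Z : nat -> {RV P >-> R}.
Hypothesis Zn : iid_std_normal Z.
Variables (I : finType) (A : I -> set R) (w : I -> R).
Let p i := fine (N01 (A i)).
Hypotheses (mA : forall i, measurable (A i)) (p0 : forall i, 0 < p i).
Hypothesis dA : forall i j x, A i x -> A j x -> i = j.
Hypotheses (w0 : forall i, 0 < w i) (w1 : \sum_i w i = 1).

Let F n (s : {ffun 'I_n -> I}) : set T := \bigcap_(j in [set: 'I_n]) (Z j @^-1` A (s j)).

Let mF n (s : {ffun 'I_n -> I}) : measurable (F s).
Proof. by apply: fin_bigcap_measurable => // j _; exact: measurable_funPTI. Qed.

Lemma prob_cells n (s : {ffun 'I_n -> I}) :
  P (F s) = (\prod_j p (s j))%:E.
Proof.
have [ind dist] := Zn.
pose B (j : nat) : set R := if insub j is Some i then A (s i) else setT.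
have mB j : measurable (B j) by rewrite /B; case: insub.
have BE (j : 'I_n) : B j = A (s j) by rewrite /B valK.
have := ind (iota 0 n) B (iota_uniq _ _) mB.
have -> : \bigcap_(j in [set` iota 0 n]) Z j @^-1` B j = F s.
  apply/seteqP; split => t Ht j; rewrite /= ?mem_iota ?add0n.
    by move=> _; have := Ht j; rewrite /= mem_iota /= add0n ltn_ord BE; exact.
  by move=> jn; have := Ht (Ordinal jn) Logic.I; rewrite -BE.
rewrite -[X in iota 0 X]subn0 -/(index_iota 0 n) big_mkord => PE.
rewrite -[LHS]fineK ?fin_num_measure// PE; congr EFin; apply: eq_bigr => j _.
by rewrite BE /p -(dist j).
Qed.

(** Change of measure: for a word whose counts are within n del of n w, the probability under [p] is
    that under [w] times an exponential with exponent at least -n (H + del L). Such words have total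
    [w]-weight at least 1/2 for large n, and their events are disjoint because the sets [A i]
    are. *)
Lemma sanov_lower_bound (e : R) : 0 < e -> exists2 del0 : R, 0 < del0 &
  forall del, 0 < del -> del <= del0 -> exists n0, forall n, (n0 <= n)%N ->
  forall E : set T, measurable E ->
  (forall s : {ffun 'I_n -> I}, (forall i, `|(occ s i)%:R - n%:R * w i| <= n%:R * del) ->
     F s `<=` E) ->
  ((expR (- (n%:R * (\sum_i w i * ln (w i / p i) + e))))%:E <= P E)%E.
Proof.
move=> e0; pose r i := ln (w i / p i).
pose L := \sum_i `|r i|; have L0 : 0 <= L by exact: sumr_ge0.
pose H := \sum_i w i * r i.
(* Makes [del * L <= e / 2]; the other half of [e] pays for the factor 1/2. *)
exists (e / (2 * (L + 1))) => [|del d0 dle]; first by rewrite divr_gt0// mulr_gt0// ltr_wpDl.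
have dL : del * L <= e / 2.
  move: dle; rewrite ler_pdivlMr; last by rewrite mulr_gt0// ltr_wpDl.
  by lra.
have [n1 Hn1] := occ_concentration (fun i => ltW (w0 i)) w1 d0.
exists (maxn n1 (Num.truncn (2 / e)).+1) => n; rewrite geq_max => /andP[nn1 nn2] E mE HE.
have ne : 1 <= n%:R * (e / 2).
  have : 2 / e <= n%:R.
    by apply/ltW; apply: lt_le_trans (truncnS_gt _) _; rewrite ler_nat.
  by rewrite ler_pdivrMr//; lra.
pose good (s : {ffun 'I_n -> I}) := [forall i, `|(occ s i)%:R - n%:R * w i| <= n%:R * del].
pose S := \sum_(s | good s) \prod_j w (s j).
have half : 1 / 2 <= S by exact: Hn1.
apply: (@le_trans _ _ (expR (- (n%:R * (H + e / 2))) * S)%:E).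
  rewrite lee_fin; apply: (@le_trans _ _ (expR (- (n%:R * (H + e / 2))) * (1 / 2))); last first.
    by rewrite ler_wpM2l ?expR_ge0.
  rewrite (_ : - (n%:R * (H + e)) = - (n%:R * (H + e / 2)) + - (n%:R * (e / 2))); last by field.
  rewrite expRD ler_wpM2l ?expR_ge0// expRN.
  have := expR_ge1Dx (n%:R * (e / 2)) => E1.
  by rewrite mul1r lef_pV2 ?posrE ?expR_gt0//; lra.
apply: (@le_trans _ _ (\sum_(s | good s) \prod_j p (s j))%:E).
  rewrite lee_fin mulr_sumr; apply: ler_sum => s /forallP gs.
  have rE i : p i = w i * expR (- r i).
    rewrite /r expRN lnK ?posrE ?divr_gt0// invf_div mulrCA divff ?mulr1// gt_eqF//.
  rewrite [leRHS](eq_bigr (fun j => w (s j) * expR (- r (s j)))) => [|j _]; last exact: rE.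
  rewrite big_split/= mulrC ler_wpM2l ?prodr_ge0// => [j _|]; first exact: ltW.
  rewrite (prod_occ s (fun i => expR (- r i))).
  under eq_bigr do rewrite -expRM_natl.
  rewrite -expR_sum ler_expR -[leRHS]opprK lerN2.
  rewrite -sumrN (@le_trans _ _ (\sum_i (n%:R * w i * r i + n%:R * del * `|r i|)))//.
    apply: ler_sum => i _; rewrite mulrN opprK -lerBlDl -mulrBl.
    by rewrite (le_trans (ler_norm _))// normrM ler_wpM2r.
  rewrite big_split/= -mulr_sumr -/L (_ : \sum_i _ = n%:R * H); last first.
    by rewrite mulr_sumr; apply: eq_bigr => i _; rewrite mulrA.
  by rewrite mulrDr lerD2l -mulrA ler_wpM2l.
rewrite -sumEFin -(integral_indicT P mE).
rewrite (eq_bigr (fun s => \int[P]_x (\1_(F s) x)%:E)%E) => [|s _]; last first.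
  by rewrite integral_indicT// prob_cells.
rewrite big_mkcond/= (eq_bigr (fun s => \int[P]_x (if good s then \1_(F s) x else 0)%:E)%E); last first.
  by move=> s _; case: ifP => // _; rewrite integral0_eq.
rewrite -integral_sum_EFin_ge0; last 2 first.
- by move=> s; case: (good s) => //; exact: measurable_indic.
- by move=> s x; case: (good s).
apply: le_integral_EFin.
- by apply: measurable_sum => s; case: (good s) => //; exact: measurable_indic.
- exact: measurable_indic.
- by move=> x; apply: sumr_ge0 => s _; case: (good s).
move=> x; have [[s [gs Fs]]|none] := pselect (exists s, good s /\ F s x).
  rewrite (bigD1 s)//= gs indicE (mem_set Fs) big1 ?addr0 => [|s' s's].
    rewrite indicE mem_set//; apply: HE Fs => i; exact: (forallP gs).
  case: ifP => // _; rewrite indicE memNset// => Fs'; move/eqP: s's; apply.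
  by apply/ffunP => j; apply: dA (Fs' j Logic.I) (Fs j Logic.I).
rewrite big1 ?indicE// => s _; case: ifP => // gs; rewrite indicE memNset// => Fs.
by apply: none; exists s.
Qed.

End sanov_lower_bound.

(** * Profiles *)

Section tail_family.
Context {R : realType}.
Local Notation N01 := (@normal_prob R 0 1).
Implicit Types (M N : R) (k : nat) (l : (R -> R) -> R).

Lemma big_option k (F : option 'I_k -> R) :
  \sum_o F o = F None + \sum_j F (Some j).
Proof.
rewrite (bigD1 None)//=; congr (_ + _).
rewrite (reindex_omap Some id)/=; last by case.
by apply: eq_bigl => j; rewrite eqxx.
Qed.

(* The point where the mass q outside ]-M, M] is moved, so that N^2 q is the
   outer second moment; for q = 0 any point beyond M would do. *)
Definition tailN M l : R :=
  if l \1_(outer M) == 0 then M else Num.sqrt (l (osqr M) / l \1_(outer M)).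

(** [None] indexes the tail interval. Its length 1/N keeps x^2 within 3 of N^2, while the logarithm
    of its Gaussian mass is -N^2 / 2 up to a term of order N. *)
Definition fam M k N (o : option 'I_k) : set R :=
  if o is Some j then cell M k j else `]N, N + N^-1]%classic.

Definition wt M k l (o : option 'I_k) : R :=
  if o is Some j then l \1_(cell M k j) else l \1_(outer M).

Definition cell_entropy M k l : R :=
  \sum_(j < k) l \1_(cell M k j) * ln (l \1_(cell M k j) / fine (N01 (cell M k j))).

Section family.
Variables (M : R) (k : nat) (N : R).
Hypotheses (M1 : 1 <= M) (k0 : (0 < k)%N) (MN : M <= N).

Let M0 : 0 < M. Proof. by apply: lt_le_trans M1. Qed.
Let N0 : 0 < N. Proof. exact: lt_le_trans MN. Qed.

Lemma measurable_fam o : measurable (@fam M k N o).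
Proof. by case: o => [j|]; [exact: measurable_cell|exact: measurable_itv]. Qed.

Lemma fam_tail_outer x : fam M N (None : option 'I_k) x -> outer M x.
Proof.
rewrite /fam/= in_itv/= => /andP[Nx _]; rewrite /outer/= in_itv/= => /andP[_ xM].
by have := lt_le_trans (le_lt_trans MN Nx) xM; rewrite ltxx.
Qed.

Lemma cell_not_outer (j : 'I_k) x : cell M k j x -> ~ outer M x.
Proof. by move=> xj; rewrite /outer/= in_itv/= (cell_inner M0 k0 (ltn_ord j) xj). Qed.

Lemma fam_inj (o o' : option 'I_k) x : fam M N o x -> fam M N o' x -> o = o'.
Proof.
case: o o' => [j|] [j'|] //.
- by move=> xj xj'; congr Some; apply: val_inj; exact: cell_inj xj xj'.
- by move=> /cell_not_outer n /fam_tail_outer.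
- by move=> /fam_tail_outer o /cell_not_outer.
Qed.

Lemma fam_gt0 (o : option 'I_k) : 0 < fine (N01 (fam M N o)).
Proof.
case: o => [j|]; apply: normal_prob_itv_gt0; last by rewrite ltrDl invr_gt0.
by rewrite knotS ltrDl divr_gt0 ?mulr_gt0 ?ltr0n.
Qed.

Lemma tail_sqr x : fam M N (None : option 'I_k) x -> N ^+ 2 <= x ^+ 2 <= N ^+ 2 + 3.
Proof.
rewrite /fam/= in_itv/= => /andP[Nx xN].
have N1 : 1 <= N by exact: le_trans MN.
have i0 : 0 < N^-1 by rewrite invr_gt0.
have i1 : N^-1 <= 1 by rewrite invf_le1.
have Ni : N * N^-1 = 1 by rewrite divff// gt_eqF.
apply/andP; split; first nra.
apply: (@le_trans _ _ ((N + N^-1) ^+ 2)); first by rewrite lerXn2r ?nnegrE; lra.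
by rewrite sqrrD Ni; nra.
Qed.

End family.

Section weights.
Variables (M : R) (k : nat) (l : (R -> R) -> R).
Hypotheses (M1 : 1 <= M) (k0 : (0 < k)%N) (pl : posfun l).
Hypothesis tail0 : l \1_(outer M) = 0 -> l (osqr M) = 0.

Let M0 : 0 < M. Proof. by apply: lt_le_trans M1. Qed.
Let q := l \1_(outer M).
Let b := l (osqr M).
Let q0 : 0 <= q. Proof. by apply: posfun_indic_ge0 => //; exact: measurable_outer. Qed.
Let b0 : 0 <= b. Proof. by apply: posfun_ge0 => //; [exact: quadb_osqr|exact: osqr_ge0]. Qed.

Lemma wt_ge0 (o : option 'I_k) : 0 <= wt M l o.
Proof.
by case: o => [j|]; apply: posfun_indic_ge0 => //; [exact: measurable_cell|exact: measurable_outer].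
Qed.

Lemma wt_sum1 : \sum_(o : option 'I_k) wt M l o = 1.
Proof.
have [_ _ <-] := pl; rewrite big_option/=.
rewrite (eq_bigr (fun j : 'I_k => 1 * l \1_(cell M k j))); last by move=> j _; rewrite mul1r.
rewrite -(@posfun_csum R M k l (fun=> 1) pl) addrC -posfunD//; last 2 first.
- exact: quadb_csum.
- by apply: quadb_indic; exact: measurable_outer.
congr l; apply/funext => x; rewrite /csum; case: (cellP M0 k0 x) => [j xj nx ->|xo nx ->].
  by rewrite indicE memNset// addr0.
by rewrite indicE mem_set// add0r.
Qed.

Lemma outer_sqr_mass : M ^+ 2 * q <= b.
Proof.
rewrite -(posfunZ pl); last by apply: quadb_indic; exact: measurable_outer.
apply: posfun_le => //; [|exact: quadb_osqr|move=> x].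
  by apply: quadbZ; apply: quadb_indic; exact: measurable_outer.
rewrite /osqr indicE; have [|_] := boolP (x \in _); last by rewrite !mulr0.
by rewrite inE !mulr1 => /(outer_sqr (ltW M0)).
Qed.

Lemma tailN_ge : M <= tailN M l.
Proof.
rewrite /tailN; case: eqP => // /eqP qn0; have q1 : 0 < q by rewrite lt_neqAle eq_sym qn0.
rewrite -[leLHS](ger0_norm (ltW M0)) -sqrtr_sqr ler_wsqrtr//.
by rewrite ler_pdivlMr// outer_sqr_mass.
Qed.

(** [tail0] excludes an outer second moment carried by no mass, as a singular functional may have.
    Empirical means satisfy it ([emp_outer0]), and so does any functional that charges the
    outside. *)
Lemma tailN_mass : tailN M l ^+ 2 * q = b.
Proof.
rewrite /tailN; case: eqP => [q00|/eqP qn0]; first by rewrite /q q00 mulr0 /b tail0.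
by rewrite sqr_sqrtr ?divr_ge0// -/q -/b divfK.
Qed.

(** Since ln q <= 0 and -ln p <= N^2 / 2 + (3 - ln peak) N, the cost is at most q N^2 / 2 + (3 - ln
    peak) q N. The first term is b / 2, and q N <= q N^2 / M = b / M. *)
Lemma tail_entropy : wt M l (None : option 'I_k) * ln (wt M l (None : option 'I_k) / fine (N01 (fam M (tailN M l) (None : option 'I_k)))) <=
   b / 2 + (3 - ln (normal_peak 1)) * b / M.
Proof.
set N := tailN M l; have MN : M <= N by exact: tailN_ge.
have N0 : 0 < N by exact: lt_le_trans MN.
have N1 : 1 <= N by exact: le_trans MN.
have peak0 : 0 < normal_peak 1 :> R by rewrite normal_peak_gt0 ?oner_eq0.
have lnp : ln (normal_peak 1) <= 0 :> R by rewrite ln_le0// normal_peak1_le1.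
rewrite /= -/q; move: (q0); rewrite le_eqVlt => /predU1P[<-|q1].
  rewrite mul0r; apply: addr_ge0; apply: divr_ge0 => //; last exact: ltW.
  by apply: mulr_ge0 => //; lra.
set p := fine _; have p0 : 0 < p by exact: (fam_gt0 M1 k0 MN None).
have qle1 : q <= 1 by apply: posfun_indic_le1 => //; exact: measurable_outer.
have pge : normal_peak 1 * expR (- (N ^+ 2 + 3) / 2) * N^-1 <= p.
  rewrite [X in _ * X <= _](_ : N^-1 = (N + N^-1) - N); last by ring.
  apply: normal_prob_itv_ge; first by rewrite lerDl invr_ge0 ltW.
  move=> x xN; have : N ^+ 2 <= x ^+ 2 <= N ^+ 2 + 3.
    by apply: (@tail_sqr M k N M1 MN x); rewrite /fam/= in_itv.
  by case/andP.
have lnpge : ln (normal_peak 1) - (N ^+ 2 + 3) / 2 - ln N <= ln p.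
  apply: le_trans (_ : _ <= ln (normal_peak 1 * expR (- (N ^+ 2 + 3) / 2) * N^-1)) _.
    have E0 := expR_gt0 (- (N ^+ 2 + 3) / 2).
    have i0 : 0 < N^-1 by rewrite invr_gt0.
    have pE0 : 0 < normal_peak 1 * expR (- (N ^+ 2 + 3) / 2) by rewrite mulr_gt0.
    by rewrite (lnM pE0 i0) (lnM peak0 E0) expRK lnV ?posrE// mulNr.
  rewrite ler_ln ?posrE//; apply: mulr_gt0; rewrite ?invr_gt0//.
  by apply: mulr_gt0 => //; exact: expR_gt0.
have lnN : ln N <= N by apply/ltW/ln_sublinear.
have lnq : ln q <= 0 by rewrite ln_le0.
rewrite ln_div ?posrE//.
apply: (@le_trans _ _ (q * (N ^+ 2 / 2 + (3 - ln (normal_peak 1)) * N))).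
  rewrite ler_wpM2l//; move: (ln (normal_peak 1)) lnp lnpge => cc c0 c1.
  by move: (ln p) (ln q) (ln N) c1 lnq lnN => a1 a2 a3; nra.
have qN := tailN_mass; rewrite -/N in qN.
rewrite mulrDr [q * (_ / 2)]mulrA [q * _]mulrC qN lerD2l mulrCA -mulrA.
rewrite ler_wpM2l//; first by lra.
rewrite ler_pdivlMr// -qN mulrC mulrA [N ^+ 2 * q]mulrC expr2 mulrA mulrC.
by rewrite [leRHS]mulrC ler_wpM2l ?(ltW N0)// mulrC ler_wpM2l.
Qed.

(** The density keeps the cell masses exactly and moves the outer mass q into the tail interval at
    N. There x^2 exceeds N^2 by at most 3, an error of 3 q <= 3 b / M in the outer second moment. *)
Lemma cell_dual : exists l2 : (R -> R) -> R, [/\ orlicz_dual l2,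
  (J_Phi l2 <= (cell_entropy M k l + b / 2 + (3 - ln (normal_peak 1)) * b / M)%:E)%E,
  forall j : 'I_k, l2 \1_(cell M k j) = l \1_(cell M k j) &
  `|l2 (osqr M) - b| <= 3 * b / M].
Proof.
set N := tailN M l; have MN : M <= N by exact: tailN_ge.
have [l2 [d2 J2 c2 e2]] := finite_density_functional (@measurable_fam M k N)
  (fam_gt0 M1 k0 MN) (@fam_inj M k N M1 k0 MN) wt_ge0 wt_sum1.
have pl2 : posfun l2 by exact: orlicz_dual_posfun d2 J2.
exists l2; split => //.
- apply: (le_trans J2); rewrite lee_fin big_option addrC -addrA.
  by rewrite lerD2l; exact: tail_entropy.
- by move=> j; have := c2 (Some j).
have mt : measurable (fam M N (None : option 'I_k)) by exact: measurable_fam.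
have qt : quadb \1_(fam M N (None : option 'I_k)) by exact: quadb_indic.
have -> : l2 (osqr M) = l2 (fun x => x ^+ 2 * \1_(fam M N (None : option 'I_k)) x).
  apply: e2 => x [j|] xo; rewrite /osqr !indicE.
    rewrite memNset ?memNset//; last exact: cell_not_outer xo.
    by move=> xt; have := fam_inj M1 k0 MN (xo : fam M N (Some j) x) xt.
  by rewrite !mem_set//; exact: (fam_tail_outer MN xo).
have qs : quadb (fun x => x ^+ 2 * \1_(fam M N (None : option 'I_k)) x).
  by apply: quadb_mul_indic => //; exact: quadb_sqr.
have lo : N ^+ 2 * q <= l2 (fun x => x ^+ 2 * \1_(fam M N (None : option 'I_k)) x).
  rewrite -[q](c2 None) -(posfunZ pl2)//; apply: posfun_le => //; first exact: quadbZ.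
  move=> x; rewrite indicE; have [|_] := boolP (x \in _); last by rewrite !mulr0.
  by rewrite inE !mulr1 => /(tail_sqr M1 MN)/andP[].
have hi : l2 (fun x => x ^+ 2 * \1_(fam M N (None : option 'I_k)) x) <= (N ^+ 2 + 3) * q.
  rewrite -[q](c2 None) -(posfunZ pl2)//; apply: posfun_le => //; first exact: quadbZ.
  move=> x; rewrite indicE; have [|_] := boolP (x \in _); last by rewrite !mulr0.
  by rewrite inE !mulr1 => /(tail_sqr M1 MN)/andP[].
have qN := tailN_mass; rewrite -/N in qN; rewrite mulrDl in hi; rewrite qN in lo hi.
rewrite ger0_norm ?subr_ge0// lerBlDl (le_trans hi)// lerD2l -mulrA ler_wpM2l//.
rewrite ler_pdivlMr// (le_trans _ outer_sqr_mass)// mulrC ler_wpM2r//.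
by rewrite expr2 ler_peMr// ltW.
Qed.

End weights.

End tail_family.

Section gaussian_expectation.
Context {R : realType}.
Local Notation N01 := (@normal_prob R 0 1).

Definition gaussE (f : R -> R) : R := fine (\int[N01]_x (f x)%:E)%E.

Lemma gaussE_dual : orlicz_dual gaussE /\ (J_Phi gaussE <= 0%:E)%E.
Proof.
have E : gaussE = densf (fun=> 1).
  by apply/funext => f; congr fine; apply: eq_integral => x _; rewrite mul1r.
have m1 : measurable_fun setT (fun _ : R => (1 : R)) by exact: measurable_cst.
have D0 (x : R) : 0 <= (1 : R) <= 1 by rewrite ler01 lexx.
have D1 : (\int[N01]_x 1%:E = 1)%E by rewrite integral_cstP.
have L0 : (\int[N01]_x (1 * ln 1)%:E = 0%:E)%E by rewrite integral_cstP mul1r ln1.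
have Li : N01.-integrable setT (fun x => (1 * ln 1 : R)%:E).
  by rewrite mul1r ln1; exact: (orlicz_integrable (quadb_orlicz (quadb_cst 0))).
by rewrite E; split; [exact: (densf_dual m1 D0)|exact: (densf_entropy m1 D0 D1 Li L0)].
Qed.

Lemma gaussE_posfun : posfun gaussE.
Proof. by have [d J] := gaussE_dual; exact: orlicz_dual_posfun d J. Qed.

Lemma gaussE_entropy_bound : entropy_bound gaussE 0.
Proof. by have [d J] := gaussE_dual; exact: orlicz_dual_entropy_bound J. Qed.

Lemma gaussE_indic (A : set R) : measurable A -> gaussE \1_A = fine (N01 A).
Proof. by move=> mA; rewrite /gaussE (integral_indicT N01 mA). Qed.

(** From q ln (q / p) >= q - p >= -p, summed over the cells. The cell masses need not add up to 1,
    so the sum can be negative; the bound later turns a bounded exponent into a bounded outer second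
    moment. *)
Lemma cell_entropy_ge (M : R) (k : nat) (l : (R -> R) -> R) : 1 <= M -> (0 < k)%N ->
  posfun l -> - 1 <= cell_entropy M k l.
Proof.
move=> M1 k0 pl; have M0 : 0 < M by apply: lt_le_trans M1.
have := @wt_sum1 R M k gaussE M1 k0 gaussE_posfun; rewrite big_option /= => s1.
have po : 0 <= gaussE \1_(outer M).
  by apply: (posfun_indic_ge0 gaussE_posfun); exact: measurable_outer.
apply: (@le_trans _ _ (\sum_(j < k) - gaussE \1_(cell M k j))).
  by rewrite sumrN lerN2; lra.
apply: ler_sum => j _; have mc := measurable_cell M k j.
rewrite (gaussE_indic mc); set p := fine _; set q := l _.
have p0 : 0 < p by exact: (fam_gt0 M1 k0 (lexx M) (Some j)).
have q0 : 0 <= q by exact: posfun_indic_ge0.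
move: q0; rewrite le_eqVlt => /predU1P[<-|q0]; first by rewrite mul0r oppr_le0 ltW.
have := @le_ln1Dx R (p / q - 1); rewrite (_ : 1 + (p / q - 1) = p / q); last by ring.
rewrite ltrBrDr addNr divr_gt0// => /(_ isT).
rewrite !ln_div ?posrE//; move/(ler_wpM2l (ltW q0)).
by rewrite !mulrBr mulr1 mulrCA divff ?gt_eqF// mulr1; lra.
Qed.

End gaussian_expectation.

(** * Empirical measures as positive functionals *)

Section empirical.
Context {R : realType}.
Implicit Types (n : nat) (x : nat -> R).

Definition emp n x (f : R -> R) : R := n%:R^-1 * \sum_(j < n) f (x j).

Lemma emp_posfun n x : (0 < n)%N -> posfun (emp n x).
Proof.
move=> n0; have n0' : n%:R != 0 :> R by rewrite pnatr_eq0 -lt0n.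
split=> [c f g _ _|f _ f0|].
- by rewrite /emp big_split/= mulrDr -mulr_sumr mulrCA.
- by rewrite mulr_ge0 ?invr_ge0// sumr_ge0.
- by rewrite /emp sumr_const card_ord -(mulr_natl 1 n) mulr1 mulVf.
Qed.

Lemma emp_sum n x f : (0 < n)%N -> \sum_(j < n) f (x j) = n%:R * emp n x f.
Proof. by move=> n0; rewrite /emp mulrA divff ?mul1r// pnatr_eq0 -lt0n. Qed.

(** With divisor n - 1 the squared deviation is n / (n - 1) times b - a^2, so the excess is (b -
    a^2) / (n - 1). *)
Lemma ssd_sqr n x : (1 < n)%N ->
  `|ssd n x ^+ 2 - (emp n x (fun y => y ^+ 2) - emp n x (fun y => y) ^+ 2)| <=
  emp n x (fun y => y ^+ 2) / (n%:R - 1).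
Proof.
move=> n1; have n0 : (0 < n)%N by exact: ltnW.
have nR : 0 < n%:R - 1 :> R by rewrite subr_gt0 ltr1n.
have nR0 : n%:R != 0 :> R by rewrite pnatr_eq0 -lt0n.
have pe := emp_posfun x n0; have := posfun_variance_ge0 pe.
set b := emp n x (fun y => y ^+ 2); set a := emp n x _ => ab.
have ssdE : \sum_(j < n) (x j - smean n x) ^+ 2 = n%:R * (b - a ^+ 2).
  rewrite -[smean n x]/a.
  rewrite (eq_bigr (fun j : 'I_n => (x j) ^+ 2 + (- 2 * a * x j + a ^+ 2))); last first.
    by move=> j _; ring.
  rewrite !big_split/= -mulr_sumr sumr_const card_ord -(mulr_natl (a ^+ 2) n).
  rewrite (emp_sum x (fun y => y ^+ 2) n0) (emp_sum x (fun y => y) n0) -/a -/b.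
  by ring.
rewrite /ssd sqr_sqrtr; last first.
  by rewrite ssdE mulr_ge0 ?invr_ge0 ?(ltW nR)// mulr_ge0// subr_ge0.
rewrite ssdE (_ : _ - _ = (b - a ^+ 2) / (n%:R - 1)); last first.
  by field; rewrite gt_eqF.
rewrite ger0_norm; last by rewrite divr_ge0 ?(ltW nR)// subr_ge0.
by rewrite ler_wpM2r ?invr_ge0 ?(ltW nR)// gerBl sqr_ge0.
Qed.

Lemma posfun_sqr_le (M : R) l : posfun l -> 0 <= M ->
  l (fun y => y ^+ 2) <= M ^+ 2 + l (osqr M).
Proof.
move=> pl M0; have qo := @quadb_osqr R M.
rewrite -[X in X + _](posfun_cst pl) -posfunD//; last exact: quadb_cst.
apply: posfun_le => //; [exact: quadb_sqr|by apply: quadbD => //; exact: quadb_cst|].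
move=> y; rewrite /osqr indicE; have [_|] := boolP (y \in _).
  by rewrite mulr1 lerDr sqr_ge0.
rewrite mulr0 addr0 notin_setE /outer/= => /contrapT; rewrite in_itv/= => /andP[a b].
by rewrite -[leLHS]real_normK ?num_real// lerXn2r ?nnegrE// ler_norml b ltW.
Qed.

Lemma emp_outer0 n x (M : R) : (0 < n)%N -> 0 < M ->
  emp n x \1_(outer M) = 0 -> emp n x (osqr M) = 0.
Proof.
move=> n0 M0; rewrite /emp => /eqP; rewrite mulf_eq0 invr_eq0 pnatr_eq0 -[n == 0%N]negbK -lt0n n0/=.
rewrite psumr_eq0 => [/allP h|j _]; last by rewrite indicE.
rewrite big1 ?mulr0// => j _; have := h j; rewrite mem_index_enum => /(_ isT)/= /eqP h'.
by rewrite /osqr h' mulr0.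
Qed.

End empirical.

(** * Exponent of the samples with a large statistic *)

Section upper_bound_deterministic.
Context {R : realType}.
Local Notation N01 := (@normal_prob R 0 1).
Variable psi : R -> R.
Hypothesis psi_ge0 : forall x, 0 <= psi x.
Hypothesis psi_int : (@lebesgue_measure R).-integrable setT (EFin \o psi).

Lemma AD_statisticE n x : AD_statistic psi n x =
  AD_functional psi (fun t => emp n x \1_(`]-oo, t])) (emp n x (fun y => y)) (ssd n x).
Proof. by []. Qed.

Lemma AD_statistic_fin n x : (0 < n)%N -> AD_statistic psi n x \is a fin_num.
Proof.
move=> n0; rewrite AD_statisticE; apply: AD_functional_fin => //.
by apply: posfun_subcdf; exact: emp_posfun.
Qed.

(** By contraposition: a sample of smaller exponent is replaced by the density functional of
    [cell_dual], whose [J_Phi] is below [alpha] and whose value is within [e] of the statistic,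
    against the hypothesis on [alpha]. *)
Lemma upper_bound_exponent (alpha e u del : R) : 0 < alpha -> 0 < e -> 0 < del ->
  (forall l, orlicz_dual l -> u - e <= AD_value psi l -> (alpha%:E <= J_Phi l)%E) ->
  exists (M : R) (k : nat) (lam : R),
  [/\ [/\ 1 <= M, (0 < k)%N, 0 <= lam & lam < 1 / 2],
    (\int[N01]_x (expR (lam * x ^+ 2) * \1_(outer M) x)%:E <= del%:E)%E &
    exists n0, forall n x, (n0 <= n)%N -> u <= fine (AD_statistic psi n x) ->
      alpha - del <= cell_entropy M k (emp n x) + lam * emp n x (osqr M)].
Proof.
move=> a0 e0 d0 HJ.
have [M0 [om [M01 om0 om1 Hcmp]]] := AD_compare psi_ge0 psi_int (ltW a0) e0.
(* Bounds the outer second moment when the exponent is below [alpha]: the cell part is at least -1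
   and lam >= 1/4. *)
pose K := 4 * (alpha + 1); have K0 : 0 < K by rewrite /K; lra.
(* Close enough to 1/2 that (1/2 - lam) K <= del / 4, the price of replacing lam by the true cost
   1/2. *)
pose lam := Num.max (1 / 4) (1 / 2 - del / (4 * K)).
have lam4 : 1 / 4 <= lam by rewrite le_max lexx.
have lam0 : 0 <= lam by lra.
have lamK : 1 / 2 - del / (4 * K) <= lam by rewrite le_max lexx orbT.
have dK : 0 < del / (4 * K) by rewrite divr_gt0// mulr_gt0.
have lam2 : lam < 1 / 2 by rewrite gt_max; apply/andP; split; lra.
have [M1 M11 Htail] := gaussian_exp_square_tail lam0 lam2 d0.
pose cp : R := 3 - ln (normal_peak 1).
have lnp : ln (normal_peak 1) <= 0 :> R by rewrite ln_le0// normal_peak1_le1.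
have cp0 : 0 < cp by rewrite /cp; lra.
(* The third entry makes the correction of [tail_entropy] at most del / 4; the fourth brings the
   outer second moment of the density within [om]. *)
pose M := Num.max (Num.max M0 M1) (Num.max (4 * cp * K / del) (3 * K / om)).
have [MM0 MM1 Mcp Mom] : [/\ M0 <= M, M1 <= M, 4 * cp * K / del <= M & 3 * K / om <= M].
  by rewrite /M !le_max !lexx ?orbT.
clearbody M.
have M1' : 1 <= M by exact: le_trans MM0.
have M0' : 0 < M by apply: lt_le_trans M1'.
have {}Mcp : cp * K / M <= del / 4.
  rewrite ler_pdivrMr//; move: Mcp; rewrite ler_pdivrMr// => h.
  by clear -h; lra.
have {}Mom : 3 * K / M <= om by move: Mom; rewrite !ler_pdivrMr// [M * _]mulrC.
have [k [dl [k0 dl0 dl1 H]]] := Hcmp M MM0.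
exists M, k, lam; split => //; first exact: Htail.
pose B := M ^+ 2 + K; have B0 : 0 < B by rewrite addr_gt0// exprn_gt0.
(* [B] bounds the empirical second moment. The normalization error B / (n - 1) must be at most [dl];
   the divisor n - 1 accounts for the second successor. *)
exists (Num.truncn (B / dl)).+2 => n x nn0 uT.
have n1 : (1 < n)%N by exact: leq_trans nn0.
have n0 : (0 < n)%N by exact: ltnW.
have nB : B / (n%:R - 1) <= dl.
  have nR : 0 < n%:R - 1 :> R by rewrite subr_gt0 ltr1n.
  rewrite ler_pdivrMr// mulrC -ler_pdivrMr//.
  rewrite -(subnKC n0) natrD addrAC subrr add0r.
  apply/ltW/(lt_le_trans (truncnS_gt _)); rewrite ler_nat.
  by rewrite -(leq_add2l 1) subnKC.
have pe := emp_posfun x n0.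
rewrite leNgt; apply/negP => Lam.
have hent := cell_entropy_ge M1' k0 pe.
have b0 : 0 <= emp n x (osqr M).
  by apply: posfun_ge0 => //; [exact: quadb_osqr|exact: osqr_ge0].
have bK : emp n x (osqr M) <= K.
  move: b0 hent Lam; move: (cell_entropy _ _ _) (emp _ _ _) => h b b0 hent Lam.
  clear -b0 hent Lam lam4 d0; rewrite /K; nra.
have [l [dl2 Jl cl ol]] := @cell_dual R M k (emp n x) M1' k0 pe (emp_outer0 n0 M0').
have {ol} ol : `|emp n x (osqr M) - l (osqr M)| <= om.
  rewrite distrC (le_trans ol)// (le_trans _ Mom)// ler_wpM2r ?invr_ge0 ?(ltW M0')//.
  by rewrite ler_wpM2l.
have Jl' : (J_Phi l < alpha%:E)%E.
  apply: (le_lt_trans Jl); rewrite lte_fin -/cp.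
  have h1 : cp * emp n x (osqr M) / M <= cp * K / M.
    by rewrite ler_wpM2r ?invr_ge0 ?(ltW M0')// ler_wpM2l// ltW.
  have h2 : (1 / 2 - lam) * emp n x (osqr M) <= del / (4 * K) * K.
    by apply: ler_pM => //; lra.
  have h3 : del / (4 * K) * K = del / 4 by field; rewrite gt_eqF.
  rewrite h3 in h2; move: (cell_entropy _ _ _) (emp _ _ _) Lam h1 h2 => h b Lam h1 h2.
  move: (cp * b / M) (cp * K / M) h1 Mcp => y z yz zd.
  clear -Lam h2 yz zd d0; nra.
have pl := orlicz_dual_posfun dl2 (ltW Jl').
have el := orlicz_dual_entropy_bound (ltW Jl').
have := H (emp n x) l (ssd n x) pe pl el _ ol (sqrtr_ge0 _) _.
have : u - e <= AD_value psi l -> False.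
  by move=> uT'; have := HJ l dl2 uT'; rewrite leNgt Jl'.
rewrite -AD_statisticE => HF HH; apply: HF; move: HH.
have h1 (j : 'I_k) : `|emp n x \1_(cell M k j) - l \1_(cell M k j)| <= dl.
  by rewrite cl subrr normr0 ltW.
move=> /(_ h1).
have h2 : `|ssd n x ^+ 2 - (emp n x (fun y => y ^+ 2) - emp n x (fun y => y) ^+ 2)| <= dl.
  apply: (le_trans (ssd_sqr x n1)); apply: le_trans nB.
  rewrite ler_wpM2r ?invr_ge0 ?subr_ge0 ?ler1n//.
  by rewrite (le_trans (posfun_sqr_le pe (ltW M0')))// lerD2l.
move=> /(_ h2); rewrite ler_norml lerBlDr => /andP[_ h].
by rewrite lerBlDl (le_trans uT).
Qed.

End upper_bound_deterministic.

(** * Upper bound *)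

Section eq_law.

Lemma eq_law_integral d1 (T1 : measurableType d1) d2 (T2 : measurableType d2)
    (R : realType) (P1 : probability T1 R) (P2 : probability T2 R)
    (X1 : T1 -> R) (X2 : T2 -> R) (h : R -> R) :
  measurable_fun setT X1 -> measurable_fun setT X2 ->
  (forall A, measurable A -> P1 (X1 @^-1` A) = P2 (X2 @^-1` A)) ->
  (forall x, 0 <= h x) -> measurable_fun setT h ->
  (\int[P1]_t (h (X1 t))%:E = \int[P2]_t (h (X2 t))%:E)%E.
Proof.
move=> mX1 mX2 X12 h0 mh.
have := @weighted_integral_eq _ T1 _ T2 _ R R P1 P2 (cst 1) X1 (cst 1) X2
  (measurable_cst _) mX1 (measurable_cst _) mX2 (fun=> ler01) (fun=> ler01) _ h h0 mh.
under eq_integral do rewrite /= mul1r.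
move=> E; rewrite E; first by apply: eq_integral => t _; rewrite /= mul1r.
move=> B mB; under eq_integral do rewrite /= mul1r.
under [RHS]eq_integral do rewrite /= mul1r.
have m1 : measurable (X1 @^-1` B) by rewrite -[X in measurable X]setTI; exact: mX1.
have m2 : measurable (X2 @^-1` B) by rewrite -[X in measurable X]setTI; exact: mX2.
by have := X12 _ mB; rewrite -(integral_indicT P1 m1) -(integral_indicT P2 m2).
Qed.

End eq_law.

Section AD_statistic_measurable.
Context d (T : measurableType d) (R : realType) (P : probability T R).
Local Notation N01 := (@normal_prob R 0 1).
Variable Z : nat -> {RV P >-> R}.
Variable psi : R -> R.
Hypothesis psi_ge0 : forall x, 0 <= psi x.
Hypothesis psi_int : (@lebesgue_measure R).-integrable setT (EFin \o psi).

(** The integrand is jointly measurable in the sample and the integration variable, the indicator in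
    [ecdf] being a comparison of measurable functions; Tonelli's theorem gives the rest. *)
Lemma AD_statistic_measurable n :
  measurable_fun setT (fun t => AD_statistic psi n (fun j => Z j t)).
Proof.
have mpsi : measurable_fun setT psi by have /measurable_EFinP := measurable_int _ psi_int.
have mZ j : measurable_fun setT (fun t => Z j t) by exact: measurable_funPT.
have mm : measurable_fun setT (fun t => smean n (fun j => Z j t)).
  by apply: measurable_funM => //; exact: measurable_sum.
have ms : measurable_fun setT (fun t => ssd n (fun j => Z j t)).
  have msq : measurable_fun setT (@Num.sqrt R).
    exact: continuous_measurable_fun (@sqrt_continuous R).
  apply: (measurableT_comp msq).
  apply: measurable_funM => //; apply: measurable_sum => j.
  by apply: measurable_funX; exact: measurable_funB.
pose f (z : T * R) := ((ecdf n (fun j => Z j z.1) (smean n (fun j => Z j z.1) +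
   ssd n (fun j => Z j z.1) * z.2) - Phi z.2) ^+ 2 * psi (Phi z.2)).
have mPhi : measurable_fun setT (fun z : T * R => Phi z.2).
  exact: (measurableT_comp Phi_measurable measurable_snd).
have mf : measurable_fun setT f.
  apply: measurable_funM; last exact: (measurableT_comp mpsi mPhi).
  apply: measurable_funX; apply: measurable_funB => //.
  apply: measurable_funM => //; apply: measurable_sum => j.
  pose g (z : T * R) : bool := Z j z.1 <= smean n (fun j => Z j z.1) + ssd n (fun j => Z j z.1) * z.2.
  have mg : measurable_fun setT g.
    apply: measurable_fun_ler; first exact: (measurableT_comp (mZ j) measurable_fst).
    apply: measurable_funD; first exact: (measurableT_comp mm measurable_fst).
    by apply: measurable_funM => //; exact: (measurableT_comp ms measurable_fst).
  rewrite (_ : (fun z : T * R => _) = (fun z => if g z then 1 else 0)).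
    by apply: measurable_fun_ifT => //; exact: measurable_cst.
  apply/funext => z; rewrite indicE /g.
  case: ifPn => h; first by rewrite mem_set//= in_itv.
  by rewrite memNset//= in_itv/=; exact/negP.
apply: (@measurable_fun_fubini_tonelli_F _ _ T _ R N01 (EFin \o f)).
- exact/measurable_EFinP.
- by move=> z; rewrite lee_fin mulr_ge0// sqr_ge0.
Qed.

Lemma AD_event_measurable n (u : R) :
  measurable [set t | (u%:E <= AD_statistic psi n (fun j => Z j t))%E].
Proof.
rewrite -[X in measurable X]setTI; apply: emeasurable_fun_c_infty => //.
exact: AD_statistic_measurable.
Qed.

End AD_statistic_measurable.

Section upper_bound.
Context d (T : measurableType d) (R : realType) (P : probability T R).
Local Notation N01 := (@normal_prob R 0 1).
Variable Z : nat -> {RV P >-> R}.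
Hypothesis Zn : iid_std_normal Z.
Variable psi : R -> R.
Hypothesis psi_ge0 : forall x, 0 <= psi x.
Hypothesis psi_int : (@lebesgue_measure R).-integrable setT (EFin \o psi).

Lemma normal_expectation (j : nat) (h : R -> R) : (forall x, 0 <= h x) ->
  measurable_fun setT h ->
  (\int[P]_t (h (Z j t))%:E = \int[N01]_x (h x)%:E)%E.
Proof.
move=> h0 mh; have [_ dist] := Zn.
apply: (@eq_law_integral _ T _ (g_sigma_algebraType (R.-ocitv.-measurable)) R P N01 (Z j) id) => //.
by move=> A mA; exact: dist.
Qed.

Section types.
Variables (M : R) (k : nat) (lam : R).
Hypotheses (M1 : 1 <= M) (k0 : (0 < k)%N).
Variable del : R.
Hypothesis d0 : 0 <= del.
Hypothesis tail : (\int[N01]_x (expR (lam * x ^+ 2) * \1_(outer M) x)%:E <= del%:E)%E.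

Let p (j : 'I_k) := fine (N01 (cell M k j)).
Let p0 j : 0 < p j. Proof. exact: (fam_gt0 M1 k0 (lexx M) (Some j)). Qed.

(* The likelihood ratio of a law with cell masses q, except that outside ]-M, M]
   it is e^(lam x^2), hence its integral is only at most 1 + del. *)
Definition tilt (q : 'I_k -> R) (x : R) : R :=
  csum M (fun j => q j / p j) x + expR (lam * x ^+ 2) * \1_(outer M) x.

Let csum_ge0 (v : 'I_k -> R) x : (forall j, 0 <= v j) -> 0 <= csum M v x.
Proof. by move=> v0; apply: sumr_ge0 => j _; rewrite mulr_ge0. Qed.

Let e_ge0 x : 0 <= expR (lam * x ^+ 2) * \1_(outer M) x.
Proof. by rewrite mulr_ge0 ?expR_ge0. Qed.

Let me : measurable_fun setT (fun x : R => expR (lam * x ^+ 2) * \1_(outer M) x).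
Proof.
apply: measurable_funM; last by apply: measurable_indic; exact: measurable_outer.
by apply: expR_measurable; apply: measurable_funM => //; exact: exprn_measurable.
Qed.

Lemma tilt_ge0 q x : (forall j, 0 <= q j) -> 0 <= tilt q x.
Proof.
by move=> q0; rewrite addr_ge0// csum_ge0// => j; rewrite divr_ge0// ltW.
Qed.

Lemma tilt_measurable q : measurable_fun setT (tilt q).
Proof. by apply: measurable_funD => //; have [] := @quadb_csum R M k (fun j => q j / p j). Qed.

Lemma tilt_expectation q : (forall j, 0 <= q j) -> \sum_j q j <= 1 ->
  (\int[N01]_x (tilt q x)%:E <= (1 + del)%:E)%E.
Proof.
move=> q0 q1; have mc := (@quadb_csum R M k (fun j => q j / p j)).1.
have qp j : 0 <= q j / p j by rewrite divr_ge0// ltW.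
rewrite integralD_EFin_ge0//; last by move=> x; exact: csum_ge0.
rewrite EFinD leeD//.
rewrite integral_sum_EFin_ge0; last 2 first.
- by move=> j; apply: measurable_funM => //; apply: measurable_indic; exact: measurable_cell.
- by move=> j x; rewrite mulr_ge0.
rewrite (eq_bigr (fun j => (q j)%:E)); last first.
  move=> j _; have mcj := measurable_cell M k j.
  rewrite integralZl_EFin_ge0//.
  rewrite (integral_indicT N01 mcj).
  rewrite -[X in (_ * X)%E](fineK (fin_num_measure N01 _ mcj)) -EFinM divfK//.
  by rewrite gt_eqF// p0.
by rewrite sumEFin lee_fin.
Qed.

(** An exponential cannot vanish, so the mass of the cell containing [x] has to be positive; this
    matters because a sample may leave other cells empty. *)
Lemma tilt_exp q x : (forall j : 'I_k, cell M k j x -> 0 < q j) ->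
  expR (csum M (fun j => ln (q j / p j)) x + lam * osqr M x) = tilt q x.
Proof.
have M0 : 0 < M by apply: lt_le_trans M1.
move=> q0; rewrite /tilt /csum; case: (cellP M0 k0 x) => [j xj nx sE|xo nx sE].
  rewrite !sE /osqr indicE memNset// !mulr0 !addr0 lnK// posrE divr_gt0//.
  exact: q0.
by rewrite !sE !add0r /osqr indicE mem_set// !mulr1.
Qed.

Lemma posfun_cell_entropy l : posfun l ->
  l (fun y => csum M (fun j : 'I_k => ln (l \1_(cell M k j) / p j)) y + lam * osqr M y) =
  cell_entropy M k l + lam * l (osqr M).
Proof.
move=> pl; rewrite (posfunD pl); [|exact: quadb_csum|by apply: quadbZ; exact: quadb_osqr].
rewrite (posfun_csum M _ pl) (posfunZ pl _ (quadb_osqr M)); congr (_ + _).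
by apply: eq_bigr => j _; rewrite mulrC.
Qed.

Definition freq n (tau : {ffun 'I_k -> 'I_n.+1}) (j : 'I_k) : R := (tau j)%:R / n%:R.

Lemma freq_ge0 n (tau : {ffun 'I_k -> 'I_n.+1}) j : 0 <= freq tau j.
Proof. exact: divr_ge0. Qed.

(** The sample is paired with its own type: every cell it visits then has positive frequency, and
    the logarithms of the likelihood ratios add up to n times the exponent. *)
Lemma tilt_prod n (x : nat -> R) : (0 < n)%N -> exists tau : {ffun 'I_k -> 'I_n.+1},
  (\sum_j (tau j : nat) <= n)%N /\
  \prod_(0 <= i < n) tilt (freq tau) (x i) = expR (n%:R * (cell_entropy M k (emp n x) + lam * emp n x (osqr M))).
Proof.
move=> n0; have pe := emp_posfun x n0.
pose c (j : 'I_k) := #|[pred i : 'I_n | x i \in cell M k j]|.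
have cn j : (c j < n.+1)%N by rewrite ltnS /c -[leqRHS]card_ord max_card.
pose tau : {ffun 'I_k -> 'I_n.+1} := [ffun j => Ordinal (cn j)].
have tauE j : (tau j)%:R / n%:R = emp n x \1_(cell M k j).
  rewrite ffunE/= /emp mulrC; congr (_ * _).
  rewrite /c -sum1_card natr_sum big_mkcond/=; apply: eq_bigr => i _.
  by rewrite indicE inE; case: (_ \in _).
exists tau; split.
  have := wt_sum1 M1 k0 pe; rewrite big_option/= => s1.
  have : \sum_(j < k) emp n x \1_(cell M k j) <= 1.
    by rewrite -s1 lerDr; apply: posfun_indic_ge0 => //; exact: measurable_outer.
  rewrite (eq_bigr (fun j => (tau j)%:R / n%:R)) => [|j _]; last by rewrite tauE.
  by rewrite -mulr_suml ler_pdivrMr ?ltr0n// mul1r -natr_sum ler_nat.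
rewrite -posfun_cell_entropy// -emp_sum// expR_sum big_mkord; apply: eq_bigr => i _.
rewrite -tilt_exp => [|j xj]; last first.
  rewrite /freq divr_gt0 ?ltr0n// ffunE/= /c; apply/card_gt0P; exists i.
  by change (is_true (x i \in cell M k j)); exact: mem_set.
by rewrite (_ : freq tau = fun j => emp n x \1_(cell M k j))//; apply/funext => j; exact: tauE.
Qed.

(** On the event, the product of ratios for the type of the sample is at least e^(n c). The sum over
    all types therefore dominates the indicator, and by independence each product has expectation at
    most (1 + del)^n. *)
Lemma types_bound (c u : R) n : (0 < n)%N ->
  (forall x, u <= fine (AD_statistic psi n x) ->
     c <= cell_entropy M k (emp n x) + lam * emp n x (osqr M)) ->
  (H_AD Z psi n u <= ((n.+1 ^ k)%:R * (expR (- (n%:R * c)) * (1 + del) ^+ n))%:E)%E.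
Proof.
move=> n0 Hc; rewrite /H_AD.
have mE := AD_event_measurable Z psi_ge0 psi_int n u.
rewrite -(integral_indicT P mE).
(* Types with total at most n have frequencies summing to at most 1, as [tilt_expectation] demands;
   the deficit is the number of points outside ]-M, M]. *)
pose Ad := [pred tau : {ffun 'I_k -> 'I_n.+1} | (\sum_j (tau j : nat) <= n)%N].
pose G (tau : {ffun 'I_k -> 'I_n.+1}) t := expR (- (n%:R * c)) * \prod_(i <- index_iota 0 n) tilt (freq tau) (Z i t).
have mtZ (tau : {ffun 'I_k -> 'I_n.+1}) i : measurable_fun setT (fun t => tilt (freq tau) (Z i t)).
  by apply: measurableT_comp; [exact: tilt_measurable|exact: measurable_funPT].
have mprod (tau : {ffun 'I_k -> 'I_n.+1}) :
  measurable_fun setT (fun t => \prod_(i <- index_iota 0 n) tilt (freq tau) (Z i t)).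
  exact: measurable_prod.
have prod0 (tau : {ffun 'I_k -> 'I_n.+1}) t : 0 <= \prod_(i <- index_iota 0 n) tilt (freq tau) (Z i t).
  by apply: prodr_ge0 => i _; apply: tilt_ge0; exact: freq_ge0.
apply: (@le_trans _ _ (\int[P]_t (\sum_tau (if tau \in Ad then G tau t else 0))%:E)%E).
  have mG tau : measurable_fun setT (fun t => if tau \in Ad then G tau t else 0).
    by case: (tau \in Ad) => //; exact: measurable_funM.
  have G0 tau t : 0 <= if tau \in Ad then G tau t else 0.
    by case: (tau \in Ad) => //; rewrite /G mulr_ge0 ?expR_ge0.
  apply: le_integral_EFin => //.
  - exact: measurable_sum.
  - move=> t; rewrite indicE; have [|_] := boolP (t \in _); last exact: sumr_ge0.
    rewrite inE/= => uT; have [tau [tn tE]] := tilt_prod (fun j => Z j t) n0.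
    rewrite (bigD1 tau)//= -[leLHS]addr0 lerD ?sumr_ge0//.
    rewrite /Ad inE tn /G tE -expRD -[leLHS]expR0 ler_expR addrC subr_ge0 ler_wpM2l//.
    by apply: Hc; rewrite -lee_fin fineK//; exact: AD_statistic_fin.
rewrite integral_sum_EFin_ge0; last 2 first.
- by move=> tau; case: (tau \in Ad) => //; exact: measurable_funM.
- by move=> tau t; case: (tau \in Ad) => //; rewrite /G mulr_ge0 ?expR_ge0.
apply: (@le_trans _ _ (\sum_(tau : {ffun 'I_k -> 'I_n.+1})
    (expR (- (n%:R * c)) * (1 + del) ^+ n)%:E)%E).
  apply: lee_sum => tau _; case: (boolP (tau \in Ad)) => tA; last first.
    by rewrite integral0_eq// lee_fin mulr_ge0 ?expR_ge0// exprn_ge0// addr_ge0.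
  rewrite integralZl_EFin_ge0 ?expR_ge0// EFinM lee_wpmul2l ?lee_fin ?expR_ge0//.
  have tA1 : \sum_j freq tau j <= 1.
    rewrite -mulr_suml ler_pdivrMr ?ltr0n// mul1r -natr_sum ler_nat; exact: tA.
  have tle := tilt_expectation (freq_ge0 tau) tA1.
  set I := (\int[N01]_x (tilt (freq tau) x)%:E)%E in tle.
  have I0 : (0 <= I)%E by apply: integral_ge0 => x _; rewrite lee_fin tilt_ge0// => j; exact: freq_ge0.
  have Ifin : I \is a fin_num by rewrite ge0_fin_numE// (le_lt_trans tle)// ltry.
  have [ind _] := Zn.
  rewrite (@expectation_prod _ _ _ P Z (fun=> tilt (freq tau)) (fun=> fine I))//.
  - rewrite lee_fin prodr_const_nat subn0 lerXn2r ?nnegrE ?fine_ge0 ?addr_ge0//.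
    by rewrite -lee_fin fineK.
  - by move=> j x; apply: tilt_ge0; exact: freq_ge0.
  - by move=> j; exact: tilt_measurable.
  - move=> j; rewrite normal_expectation ?fineK//; last exact: tilt_measurable.
    by move=> x; apply: tilt_ge0; exact: freq_ge0.
  - exact: iota_uniq.
rewrite sumEFin lee_fin sumr_const card_ffun !card_ord.
by rewrite -[leLHS]mulr_natl.
Qed.

End types.

Lemma upper_bound (alpha e u del : R) : 0 < e -> 0 < del ->
  (forall l, orlicz_dual l -> u - e <= AD_value psi l -> (alpha%:E <= J_Phi l)%E) ->
  exists n0, forall n, (n0 <= n)%N ->
    (H_AD Z psi n u <= (expR (- (n%:R * (alpha - del))))%:E)%E.
Proof.
move=> e0 d0 HJ; have [a0|a0] := leP alpha 0.
  exists 0%N => n _; apply: le_trans (probability_le1 _ _) _.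
    exact: AD_event_measurable.
  rewrite lee_fin -[leLHS]expR0 ler_expR oppr_ge0 mulr_ge0_le0//; lra.
(* One third of [del] goes to the exponent, one to (1 + del / 3)^n and one to the number of
   types. *)
have d3 : 0 < del / 3 by rewrite divr_gt0.
have [M [k [lam [[M1 k0 lam0 lam2] tail [n0 Hn0]]]]] :=
  upper_bound_exponent psi_ge0 psi_int a0 e0 d3 HJ.
(* For y = n del / (3 k), e^y >= 1 + y^2 / 2 >= 1 + n as soon as n >= 18 k^2 / del^2, so e^(n del /
   3) beats (n + 1)^k. *)
exists (maxn n0 (Num.truncn (18 * k%:R ^+ 2 / del ^+ 2)).+1) => n.
rewrite geq_max => /andP[nn0 nn1]; have n1 : (0 < n)%N by exact: leq_trans nn1.
apply: (le_trans (types_bound M1 k0 (ltW d3) tail n1 (fun x => Hn0 n x nn0))).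
rewrite lee_fin (_ : - (n%:R * (alpha - del)) =
   n%:R * (del / 3) + (- (n%:R * (alpha - del / 3)) + n%:R * (del / 3))); last by field.
have kR0 : 0 < k%:R :> R by rewrite ltr0n.
rewrite expRD ler_pM ?mulr_ge0 ?expR_ge0//.
- by rewrite exprn_ge0//; lra.
- rewrite (_ : n%:R * (del / 3) = k%:R * (n%:R * (del / 3) / k%:R)); last first.
    by field; rewrite gt_eqF.
  rewrite expRM_natl natrX lerXn2r ?nnegrE ?expR_ge0//.
  set y := n%:R * _ / _; have y0 : 0 <= y by apply: divr_ge0 => //; apply: mulr_ge0 => //; exact: ltW.
  apply: le_trans (expR_ge1Dxn 1 y0).
  rewrite -natr1 addrC lerD2l ler_pdivlMr ?ltr0n//.
  have nk : 18 * k%:R ^+ 2 / del ^+ 2 <= n%:R.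
    by apply/ltW; apply: lt_le_trans (truncnS_gt _) _; rewrite ler_nat.
  have nR0 : 0 < n%:R :> R by rewrite ltr0n.
  rewrite /y (_ : (n%:R * (del / 3) / k%:R) ^+ 2 = n%:R * (n%:R * (del ^+ 2 / (9 * k%:R ^+ 2)))); last first.
    by field; rewrite gt_eqF.
  rewrite ler_wpM2l ?(ltW nR0)//.
  rewrite mulrA ler_pdivlMr ?mulr_gt0 ?exprn_gt0//.
  by move: nk; rewrite ler_pdivrMr ?exprn_gt0// (_ : 2`!%:R = 2)//; lra.
rewrite expRD ler_wpM2l ?expR_ge0// expRM_natl lerXn2r ?nnegrE ?expR_ge0 ?expR_ge1Dx//.
lra.
Qed.

End upper_bound.

(** * Lower bound *)

Section lower_bound.
Context d (T : measurableType d) (R : realType) (P : probability T R).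
Local Notation N01 := (@normal_prob R 0 1).
Variable Z : nat -> {RV P >-> R}.
Hypothesis Zn : iid_std_normal Z.
Variable psi : R -> R.
Hypothesis psi_ge0 : forall x, 0 <= psi x.
Hypothesis psi_int : (@lebesgue_measure R).-integrable setT (EFin \o psi).

Lemma posfun_mix (l1 l2 : (R -> R) -> R) (t : R) : 0 <= t <= 1 ->
  posfun l1 -> posfun l2 -> posfun (fun f => (1 - t) * l1 f + t * l2 f).
Proof.
move=> /andP[t0 t1] [lin1 pos1 one1] [lin2 pos2 one2]; split.
- by move=> c f g qf qg; rewrite lin1// lin2//; ring.
- move=> f qf f0; rewrite addr_ge0// mulr_ge0 ?subr_ge0//; [exact: pos1|exact: pos2].
- by rewrite one1 one2; ring.
Qed.

Lemma entropy_bound_mix (l1 l2 : (R -> R) -> R) (t J0 : R) : 0 <= t <= 1 -> 0 <= J0 ->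
  entropy_bound l1 J0 -> entropy_bound l2 0 -> entropy_bound (fun f => (1 - t) * l1 f + t * l2 f) J0.
Proof.
move=> /andP[t0 t1] J00 e1 e2 f qf c c0 Ec.
have h1 := e1 f qf c c0 Ec; have h2 := e2 f qf c c0 Ec.
by move: (ln c) h1 h2 => x h1 h2; nra.
Qed.

(* Mixing in a little of the Gaussian expectation makes all cells of the
   partition charged, so that the logarithmic weights are finite. *)
Lemma charged_perturbation (l : (R -> R) -> R) (J0 u : R) : posfun l -> 0 <= J0 ->
  entropy_bound l J0 -> u < AD_value psi l -> exists l' : (R -> R) -> R, [/\ posfun l', entropy_bound l' J0,
  u < AD_value psi l' &
  forall A, measurable A -> 0 < fine (N01 A) -> 0 < l' \1_A].
Proof.
move=> pl J00 el uT.
have e0 : 0 < (AD_value psi l - u) / 2 by rewrite divr_gt0// subr_gt0.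
have [M [om [M1 om0 om1 Hcmp]]] := AD_compare psi_ge0 psi_int J00 e0.
have [k [dl [k0 dl0 dl1 H]]] := Hcmp M (lexx M).
pose B := `|gaussE (osqr M) - l (osqr M)|; have B0 : 0 <= B by exact: normr_ge0.
(* So small that no cell mass moves by more than [dl] and the outer second moment by no more than
   [om]. *)
pose t := Num.min dl (om / (B + 1)).
have B1 : 0 < B + 1 by lra.
have t0 : 0 < t by rewrite lt_min dl0 divr_gt0.
have td : t <= dl by rewrite ge_min lexx.
have to : t * B <= om.
  have : t <= om / (B + 1) by rewrite ge_min lexx orbT.
  by rewrite ler_pdivlMr// => h; nra.
have t01 : 0 <= t <= 1 by rewrite (ltW t0) (le_trans td).
have pl' := posfun_mix t01 pl (@gaussE_posfun R).
have el' := entropy_bound_mix t01 J00 el (@gaussE_entropy_bound R).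
exists (fun f => (1 - t) * l f + t * gaussE f); split => //; last first.
  move=> A mA pA; rewrite gaussE_indic//.
  have lA := posfun_indic_ge0 pl mA; have /andP[_ t1] := t01.
  by rewrite ltr_wpDl ?mulr_gt0// mulr_ge0// subr_ge0.
have mixE f : (1 - t) * l f + t * gaussE f - l f = t * (gaussE f - l f) by ring.
have h1 (j : 'I_k) : `|(1 - t) * l \1_(cell M k j) + t * gaussE \1_(cell M k j) -
    l \1_(cell M k j)| <= dl.
  have mc := measurable_cell M k j.
  rewrite mixE normrM gtr0_norm// (le_trans _ td)// ler_piMr ?(ltW t0)//.
  have := posfun_indic_ge0 pl mc; have := posfun_indic_le1 pl mc.
  have := posfun_indic_ge0 (@gaussE_posfun R) mc.
  have := posfun_indic_le1 (@gaussE_posfun R) mc.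
  by rewrite ler_norml => *; apply/andP; split; lra.
have := H (fun f => (1 - t) * l f + t * gaussE f) l _ pl' pl el h1 _ (sqrtr_ge0 _) _.
rewrite mixE normrM (gtr0_norm t0) -/B => /(_ _ to).
move=> /(_ ((1 - t) * l (fun x => x ^+ 2) + t * gaussE (fun x => x ^+ 2) -
  ((1 - t) * l (fun x => x) + t * gaussE (fun x => x)) ^+ 2)).
rewrite sqr_sqrtr; last by rewrite subr_ge0; exact: (posfun_variance_ge0 pl').
rewrite subrr normr0 => /(_ (ltW dl0)).
rewrite /AD_value; set a := fine _; set b := fine _; rewrite -/b in e0 uT *.
by rewrite ler_norml => /andP[+ _]; rewrite -/b; move: uT; rewrite /AD_value -/b; lra.
Qed.

(** The test function is the logarithm of the ratio [tilt] built from the cell masses of [l] itself;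
    its exponential mean is at most 1 + del, and ln (1 + del) <= del. *)
Lemma cell_entropy_le (M lam del J0 : R) (k : nat) (l : (R -> R) -> R) :
  1 <= M -> (0 < k)%N -> 0 <= del ->
  (\int[N01]_x (expR (lam * x ^+ 2) * \1_(outer M) x)%:E <= del%:E)%E ->
  posfun l -> entropy_bound l J0 -> (forall j : 'I_k, 0 < l \1_(cell M k j)) ->
  cell_entropy M k l + lam * l (osqr M) <= J0 + del.
Proof.
move=> M1 k0 d0 tail pl el lc0; rewrite -(posfun_cell_entropy M k lam pl).
apply: le_trans (_ : _ <= J0 + ln (1 + del)) _; last first.
  by rewrite lerD2l; apply: le_ln1Dx; lra.
apply: el; [|lra|].
  apply: quadbD; first exact: quadb_csum.
  by apply: quadbZ; exact: quadb_osqr.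
apply: le_trans (tilt_expectation M1 k0 tail (q := fun j => l \1_(cell M k j)) _ _).
- rewrite le_eqVlt; apply/orP; left; apply/eqP; apply: eq_integral => x _.
  by congr EFin; rewrite -tilt_exp.
- by move=> j; exact: ltW.
- have := wt_sum1 M1 k0 pl; rewrite big_option /= => <-; rewrite lerDr.
  by apply: posfun_indic_ge0 => //; exact: measurable_outer.
Qed.

Section sample.
Variables (M : R) (k : nat) (l : (R -> R) -> R).
Hypotheses (M1 : 1 <= M) (k0 : (0 < k)%N) (pl : posfun l).
Hypothesis tail0 : l \1_(outer M) = 0 -> l (osqr M) = 0.
Variables (n : nat) (s : {ffun 'I_n -> option 'I_k}) (x : nat -> R) (dl : R).
Hypothesis n0 : (0 < n)%N.
Hypothesis xs : forall j : 'I_n, fam M (tailN M l) (s j) (x j).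
Hypothesis occs : forall o, `|(occ s o)%:R - n%:R * wt M l o| <= n%:R * dl.

Let MN : M <= tailN M l. Proof. exact: tailN_ge. Qed.
Let nR : 0 < n%:R :> R. Proof. by rewrite ltr0n. Qed.

Let freq_close o : `|n%:R^-1 * (occ s o)%:R - wt M l o| <= dl.
Proof.
rewrite -(ler_pM2l nR) -[X in X * `|_|](gtr0_norm nR) -normrM mulrBr mulrA divff ?gt_eqF// mul1r.
exact: occs.
Qed.

Let occE o : (occ s o)%:R = \sum_(i < n) (s i == o)%:R :> R.
Proof. by rewrite /occ -sum1_card natr_sum big_mkcond/=; apply: eq_bigr => i _; rewrite unfold_in/=; case: (s i == o). Qed.

Lemma emp_cell_close (j : 'I_k) : `|emp n x \1_(cell M k j) - l \1_(cell M k j)| <= dl.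
Proof.
have := freq_close (Some j); rewrite occE /emp; congr (is_true (`|_ * _ - _| <= _)).
apply: eq_bigr => i _; rewrite indicE; congr (_%:R); congr nat_of_bool.
apply/eqP/idP => [si|]; first by rewrite inE; have := xs i; rewrite si.
by rewrite inE => xj; exact: (fam_inj M1 k0 MN (xs i) (xj : fam M _ (Some j) _)).
Qed.

(** The frequency error [dl] is multiplied by squares up to N^2 + 3; the spread 3 of x^2 on the tail
    interval is multiplied by its weight q <= l (osqr M) / M. *)
Lemma emp_osqr_close : `|emp n x (osqr M) - l (osqr M)| <=
  (tailN M l ^+ 2 + 3) * dl + 3 * l (osqr M) / M.
Proof.
set N := tailN M l; pose f : R := n%:R^-1 * (occ s None)%:R; set q := l \1_(outer M).
have fq : `|f - q| <= dl := freq_close None.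
have Nq : N ^+ 2 * q = l (osqr M) by exact: tailN_mass.
have term (i : 'I_n) : N ^+ 2 * (s i == None)%:R <= osqr M (x i) <= (N ^+ 2 + 3) * (s i == None)%:R.
  have := xs i; case: (s i) => [j|] xi /=.
    rewrite !mulr0 /osqr indicE memNset ?mulr0 ?lexx//.
    exact: (cell_not_outer M1 k0 xi).
  have xo : outer M (x i) by exact (fam_tail_outer MN xi).
  rewrite !mulr1 /osqr indicE (mem_set xo) mulr1.
  exact: (tail_sqr M1 MN xi).
have lo : N ^+ 2 * f <= emp n x (osqr M).
  rewrite /f mulrCA ler_wpM2l ?invr_ge0// occE mulr_sumr.
  by apply: ler_sum => i _; have /andP[] := term i.
have hi : emp n x (osqr M) <= (N ^+ 2 + 3) * f.
  rewrite /f mulrCA ler_wpM2l ?invr_ge0// occE mulr_sumr.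
  by apply: ler_sum => i _; have /andP[] := term i.
have N2 : 0 <= N ^+ 2 by exact: sqr_ge0.
have q0 : 0 <= q by apply: posfun_indic_ge0 => //; exact: measurable_outer.
have qM : 3 * q <= 3 * l (osqr M) / M.
  rewrite ler_pdivlMr; last by apply: lt_le_trans M1.
  have h := outer_sqr_mass M1 pl; rewrite -/q in h; rewrite -mulrA ler_wpM2l//.
  apply: le_trans h; rewrite mulrC ler_wpM2r// expr2 ler_peMr//.
  by rewrite (le_trans _ M1).
move: fq; rewrite !ler_norml => /andP[f1 f2].
move: (3 * l (osqr M) / M) qM => y qy; rewrite -Nq.
move: (emp n x (osqr M)) lo hi => z lo hi.
move: (N ^+ 2) N2 lo hi => a a0 lo hi.
by apply/andP; split; nra.
Qed.

End sample.

(** Words over the cells and the tail interval with counts near the weights of [l] force the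
    statistic above [u], wherever the points lie inside their sets; [sanov_lower_bound] estimates
    the probability of such words. *)
Lemma lower_bound_charged (l : (R -> R) -> R) (J0 u del : R) : posfun l -> 0 <= J0 ->
  entropy_bound l J0 -> u < AD_value psi l ->
  (forall A, measurable A -> 0 < fine (N01 A) -> 0 < l \1_A) -> 0 < del ->
  exists n0, forall n, (n0 <= n)%N ->
    ((expR (- (n%:R * (J0 + del))))%:E <= H_AD Z psi n u)%E.
Proof.
move=> pl J00 el uT lpos d0.
have e0 : 0 < AD_value psi l - u by rewrite subr_gt0.
have [M0 [om [M01 om0 om1 Hcmp]]] := AD_compare psi_ge0 psi_int J00 e0.
have [C HC] := @entropy_bound_sqr_bounded R.
pose K := `|4 * J0 + C| + 1; have K0 : 0 < K by rewrite ltr_wpDl.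
have lK : l (fun x => x ^+ 2) <= K.
  by apply: (le_trans (HC l J0 pl el J00)); rewrite (le_trans (ler_norm _))// lerDl.
pose lam := Num.max (1 / 4) (1 / 2 - del / (4 * K)).
have lam0 : 0 <= lam by rewrite le_max; apply/orP; left; lra.
have lamK : 1 / 2 - del / (4 * K) <= lam by rewrite le_max lexx orbT.
have dK : 0 < del / (4 * K) by rewrite divr_gt0// mulr_gt0.
have lam2 : lam < 1 / 2 by rewrite gt_max; apply/andP; split; lra.
have d4 : 0 < del / 4 by rewrite divr_gt0.
have [M1 M11 Htail] := gaussian_exp_square_tail lam0 lam2 d4.
pose cp : R := 3 - ln (normal_peak 1).
have lnp : ln (normal_peak 1) <= 0 :> R by rewrite ln_le0// normal_peak1_le1.
have cp0 : 0 < cp by rewrite /cp; lra.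
pose M := Num.max (Num.max M0 M1) (Num.max (4 * cp * K / del) (6 * K / om)).
have [MM0 MM1 Mcp Mom] : [/\ M0 <= M, M1 <= M, 4 * cp * K / del <= M & 6 * K / om <= M].
  by rewrite /M !le_max !lexx ?orbT.
clearbody K M lam.
have M1' : 1 <= M by exact: le_trans MM0.
have M0' : 0 < M by apply: lt_le_trans M1'.
have {}Mcp : cp * K / M <= del / 4.
  rewrite ler_pdivrMr//; move: Mcp; rewrite ler_pdivrMr// => h.
  by lra.
have {}Mom : 3 * K / M <= om / 2.
  rewrite ler_pdivrMr//; move: Mom; rewrite ler_pdivrMr// => h.
  by lra.
have [k [dl [k0 dl0 dl1 H]]] := Hcmp M MM0.
set b := l (osqr M) in H.
have b0 : 0 <= b by apply: posfun_ge0 => //; [exact: quadb_osqr|exact: osqr_ge0].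
have bK : b <= K.
  apply: le_trans lK; apply: posfun_le => //; [exact: quadb_osqr|exact: quadb_sqr|].
  by move=> y; exact: osqr_le_sqr.
set N := tailN M l; have MN : M <= N by exact: tailN_ge.
have wt0 (o : option 'I_k) : 0 < wt M l o.
  case: o => [j|] /=.
    by apply: lpos; [exact: measurable_cell|exact: (fam_gt0 M1' k0 MN (Some j))].
  have mf := measurable_fam M N (None : option 'I_k).
  apply: (lt_le_trans (lpos _ mf (fam_gt0 M1' k0 MN (None : option 'I_k)))).
  apply: posfun_le => //; [exact: quadb_indic|apply: quadb_indic; exact: measurable_outer|].
  move=> y; rewrite !indicE; have [|//] := boolP (y \in fam _ _ _).
  by rewrite inE => /(fam_tail_outer MN) yo; rewrite mem_set.
have tail0 : l \1_(outer M) = 0 -> l (osqr M) = 0.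
  by move=> h; have := wt0 None; rewrite /= h ltxx.
pose p (o : option 'I_k) := fine (N01 (fam M N o)).
(* Three losses of del / 4: from the test function, from lam < 1/2 and from the tail interval. The
   fourth quarter is left to [sanov_lower_bound]. *)
have ent : \sum_o wt M l o * ln (wt M l o / p o) <= J0 + 3 * del / 4.
  have h1 := @tail_entropy R M k l M1' k0 pl tail0.
  have h2 := cell_entropy_le M1' k0 (ltW d4) (Htail _ MM1) pl el (fun j => wt0 (Some j)).
  rewrite big_option [X in _ + X](_ : _ = cell_entropy M k l)//.
  have h3 : cp * b / M <= cp * K / M.
    by rewrite ler_wpM2r ?invr_ge0 ?(ltW M0')// ler_wpM2l// ltW.
  have h4 : (1 / 2 - lam) * b <= del / (4 * K) * K by apply: ler_pM => //; lra.
  have h5 : del / (4 * K) * K = del / 4 by field; rewrite gt_eqF.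
  rewrite h5 in h4; rewrite -/cp -/b in h1 h2; rewrite -/N in h1.
  move: (cell_entropy M k l) (_ * ln _) h1 h2 => x y h1 h2.
  move: (cp * b / M) (cp * K / M) h3 Mcp h1 => y1 y2 h3 Mcp h1.
  by clear -h1 h2 h3 h4 Mcp; lra.
have [dl2 dl20 Hsan] := sanov_lower_bound Zn (@measurable_fam R M k N)
  (fam_gt0 M1' k0 MN) (@fam_inj R M k N M1' k0 MN) wt0 (wt_sum1 M1' k0 pl) d4.
have N3 : 0 < N ^+ 2 + 3 by rewrite ltr_wpDl ?sqr_ge0.
(* The error of the tail frequency is multiplied by N^2 + 3, hence the finer tolerance; it takes
   half of [om], the spread on the tail interval the other half. *)
pose dl3 := Num.min (Num.min dl dl2) (om / (2 * (N ^+ 2 + 3))).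
have dl30 : 0 < dl3 by rewrite !lt_min dl0 dl20 divr_gt0// mulr_gt0.
have [le1 le2 le3] : [/\ dl3 <= dl, dl3 <= dl2 & (N ^+ 2 + 3) * dl3 <= om / 2].
  split; try by rewrite !ge_min lexx ?orbT.
  have : dl3 <= om / (2 * (N ^+ 2 + 3)) by rewrite ge_min lexx orbT.
  by rewrite ler_pdivlMr ?mulr_gt0// => h; clear -h; lra.
have [n0 Hn0] := Hsan _ dl30 le2.
pose B := M ^+ 2 + (K + 1); have B0 : 0 < B by rewrite !addr_gt0// exprn_gt0.
exists (maxn n0 (Num.truncn (B / dl)).+2) => n; rewrite geq_max => /andP[nn0 nn1].
have n1 : (1 < n)%N by exact: leq_trans nn1.
have np : (0 < n)%N by exact: ltnW.
have nB : B / (n%:R - 1) <= dl.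
  have nR : 0 < n%:R - 1 :> R by rewrite subr_gt0 ltr1n.
  rewrite ler_pdivrMr// mulrC -ler_pdivrMr//.
  rewrite -(subnKC np) natrD addrAC subrr add0r.
  apply/ltW/(lt_le_trans (truncnS_gt _)); rewrite ler_nat.
  by rewrite -(leq_add2l 1) subnKC.
apply: le_trans (Hn0 n nn0 _ (AD_event_measurable Z psi_ge0 psi_int n u) _).
  rewrite lee_fin ler_expR lerN2 ler_wpM2l//; rewrite -/p.
  by move: ent; set S := \sum_o _; clear => h; lra.
move=> s occs t Ft /=.
pose x j := Z j t.
have xs (j : 'I_n) : fam M (tailN M l) (s j) (x j) by exact: Ft.
have pe := emp_posfun x np.
have c1 (j : 'I_k) : `|emp n x \1_(cell M k j) - l \1_(cell M k j)| <= dl.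
  exact: (le_trans (emp_cell_close M1' k0 pl np xs occs j)).
have ob : `|emp n x (osqr M) - l (osqr M)| <= om.
  apply: (le_trans (emp_osqr_close M1' k0 pl tail0 np xs occs)).
  have h : 3 * l (osqr M) / M <= 3 * K / M.
    by rewrite ler_wpM2r ?invr_ge0 ?(ltW M0')// ler_wpM2l.
  rewrite -/N; move: (3 * l _ / M) (3 * K / M) h Mom le3 => y1 y2 h3 h4 h5.
  by clear -h3 h4 h5; lra.
have h2 : `|ssd n x ^+ 2 - (emp n x (fun y => y ^+ 2) - emp n x (fun y => y) ^+ 2)| <= dl.
  apply: (le_trans (ssd_sqr x n1)); apply: le_trans nB.
  rewrite ler_wpM2r ?invr_ge0 ?subr_ge0 ?ler1n//.
  rewrite (le_trans (posfun_sqr_le pe (ltW M0')))// lerD2l.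
  by move: ob; rewrite ler_norml => /andP[_]; move: bK; rewrite /b; lra.
have := H (emp n x) l (ssd n x) pe pl el c1 ob (sqrtr_ge0 _) h2.
rewrite -AD_statisticE ler_norml opprB lerD2r => /andP[h _].
by rewrite -[leRHS]fineK ?AD_statistic_fin// lee_fin.
Qed.

Lemma lower_bound (l : (R -> R) -> R) (J0 u del : R) : orlicz_dual l -> 0 <= J0 ->
  (J_Phi l <= J0%:E)%E -> u < AD_value psi l -> 0 < del ->
  exists n0, forall n, (n0 <= n)%N ->
    ((expR (- (n%:R * (J0 + del))))%:E <= H_AD Z psi n u)%E.
Proof.
move=> dl J00 Jl uT d0.
have pl := orlicz_dual_posfun dl Jl; have el := orlicz_dual_entropy_bound Jl.
have [l' [pl' el' uT' lpos]] := charged_perturbation pl J00 el uT.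
exact: lower_bound_charged pl' J00 el' uT' lpos d0.
Qed.

End lower_bound.

(** * Etemadi's strong law of large numbers *)

Section second_moment.
Context d (T : measurableType d) (R : realType) (P : probability T R).
Variable X : nat -> {RV P >-> R}.
Hypothesis X_iid : iid X.

Lemma measurable_ge_cst (f : T -> R) (e : R) : measurable_fun setT f ->
  measurable [set w | e <= f w].
Proof.
move=> mf; rewrite -[X in measurable X]setTI (_ : [set w | _] = f @^-1` `[e, +oo[%classic).
  exact: mf.
by apply/seteqP; split => w /=; rewrite in_itv/= andbT.
Qed.

Lemma iid_integral (h : R -> R) (j : nat) : (forall y, 0 <= h y) -> measurable_fun setT h ->
  (\int[P]_w (h (X j w))%:E = \int[P]_w (h (X 0%N w))%:E)%E.
Proof.
move=> h0 mh; apply: eq_law_integral => // A mA; exact: X_iid.2.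
Qed.

Section bounded_summand.
Variables (g : R -> R) (mu v : R).
Hypotheses (g0 : forall y, 0 <= g y) (mg : measurable_fun setT g).
Hypothesis gmu : (\int[P]_w (g (X 0%N w))%:E = mu%:E)%E.
Hypothesis gv : (\int[P]_w (g (X 0%N w) ^+ 2)%:E = v%:E)%E.

Let mgX j : measurable_fun setT (fun w => g (X j w)).
Proof. exact: measurableT_comp. Qed.

Let mS k : measurable_fun setT (fun w => \sum_(j < k) g (X j w)).
Proof. exact: measurable_sum. Qed.

Let S0 k w : 0 <= \sum_(j < k) g (X j w).
Proof. exact: sumr_ge0. Qed.

Lemma iid_sum_mean k : (\int[P]_w (\sum_(j < k) g (X j w))%:E = (k%:R * mu)%:E)%E.
Proof.
rewrite integral_sum_EFin_ge0//.
rewrite (eq_bigr (fun=> mu%:E)) => [|j _]; last by rewrite iid_integral.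
by rewrite sumEFin sumr_const card_ord mulr_natl.
Qed.

(** Adding one summand to the square only creates products of two distinct terms, so independence
    enters through pairs alone. *)
Lemma iid_sum_second_moment k : (\int[P]_w ((\sum_(j < k) g (X j w)) ^+ 2)%:E =
  (k%:R * v + k%:R * (k%:R - 1) * mu ^+ 2)%:E)%E.
Proof.
elim: k => [|k IH].
  by rewrite integral0_eq ?mul0r ?addr0// => w _; rewrite big_ord0 expr0n.
have mM j : measurable_fun setT (fun w => g (X j w) * g (X k w)) by exact: measurable_funM.
rewrite (_ : (\int[P]_w _ = \int[P]_w ((\sum_(j < k) g (X j w)) ^+ 2 +
    (2 * \sum_(j < k) (g (X j w) * g (X k w)) + g (X k w) ^+ 2))%:E)%E); last first.
  apply: eq_integral => w _; congr EFin; rewrite big_ord_recr/= -mulr_suml.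
  by ring.
have ms : measurable_fun setT (fun w => \sum_(j < k) (g (X j w) * g (X k w))).
  exact: measurable_sum.
have s0 w : 0 <= \sum_(j < k) (g (X j w) * g (X k w)).
  by apply: sumr_ge0 => j _; exact: mulr_ge0.
rewrite integralD_EFin_ge0//; last 4 first.
- exact: measurable_funX.
- apply: measurable_funD; [exact: measurable_funM|exact: measurable_funX].
- by move=> w; exact: sqr_ge0.
- by move=> w; rewrite addr_ge0 ?sqr_ge0// mulr_ge0.
rewrite integralD_EFin_ge0//; last 4 first.
- exact: measurable_funM.
- exact: measurable_funX.
- by move=> w; rewrite mulr_ge0.
- by move=> w; exact: sqr_ge0.
rewrite IH integralZl_EFin_ge0// integral_sum_EFin_ge0//; last first.
  by move=> j w; exact: mulr_ge0.
rewrite (eq_bigr (fun=> (mu ^+ 2)%:E)) => [|j _]; last first.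
  have jk : (j : nat) != k by rewrite neq_ltn ltn_ord.
  have := @expectation_prod _ _ _ P X (fun=> g) (fun=> mu) [:: j : nat; k] X_iid.1
    (fun=> g0) (fun=> mg) _ _.
  move=> /(_ (fun i => etrans (iid_integral i g0 mg) gmu)).
  rewrite /= inE jk => /(_ isT); rewrite !big_cons big_nil mulr1 => <-.
  by apply: eq_integral => w _; rewrite !big_cons big_nil mulr1.
rewrite (@iid_integral (fun y => g y ^+ 2) k) ?gv//; last 2 first.
- by move=> y; exact: sqr_ge0.
- exact: measurable_funX.
rewrite sumEFin sumr_const card_ord -EFinM -!EFinD; congr EFin.
by rewrite -[_ *+ k]mulr_natl -natr1; ring.
Qed.

Lemma iid_chebyshev k (e : R) : (0 < k)%N -> 0 < e -> 0 <= mu ->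
  (P [set w | (e <= `|k%:R^-1 * \sum_(j < k) g (X j w) - mu|)%R] <=
    (v / (k%:R * e ^+ 2))%:E)%E.
Proof.
move=> k0 e0 mu0; have kR : 0 < k%:R :> R by rewrite ltr0n.
set S := fun w => \sum_(j < k) g (X j w); set E := [set w | _].
have mSk : measurable_fun setT S by exact: mS.
have S0k w : 0 <= S w by exact: S0.
have mD : measurable_fun setT (fun w => `|k%:R^-1 * S w - mu|).
  apply: measurableT_comp => //; apply: measurable_funB => //.
  by apply: measurable_funM => //; exact: mS.
have mE : measurable E by exact: measurable_ge_cst mD.
have mQ : measurable_fun setT (fun w => (S w - k%:R * mu) ^+ 2).
  by apply: measurable_funX; exact: measurable_funB.
have Q0 w : 0 <= (S w - k%:R * mu) ^+ 2 by exact: sqr_ge0.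
(* The identity (S - k mu)^2 + 2 k mu S = S^2 + (k mu)^2 has nonnegative terms only, so the variance
   is computed without subtracting integrals. *)
have key : (\int[P]_w ((S w - k%:R * mu) ^+ 2)%:E + (2 * k%:R * mu * (k%:R * mu))%:E =
   (k%:R * v + k%:R * (k%:R - 1) * mu ^+ 2 + (k%:R * mu) ^+ 2)%:E)%E.
  have c0 : 0 <= 2 * k%:R * mu by rewrite !mulr_ge0.
  rewrite [X in (_ + X)%E]EFinM -iid_sum_mean -integralZl_EFin_ge0//.
  rewrite -integralD_EFin_ge0//; last 2 first.
  - exact: measurable_funM.
  - by move=> w; exact: mulr_ge0.
  rewrite [RHS]EFinD -iid_sum_second_moment -(integral_cstP P ((k%:R * mu) ^+ 2)).
  rewrite -integralD_EFin_ge0//; last 3 first.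
  - exact: measurable_funX.
  - by move=> w; exact: sqr_ge0.
  - by move=> w; exact: sqr_ge0.
  by apply: eq_integral => w _; congr EFin; rewrite -/(S w); ring.
have keyle : (\int[P]_w ((S w - k%:R * mu) ^+ 2)%:E <= (k%:R * v)%:E)%E.
  have I0 : (0 <= \int[P]_w ((S w - k%:R * mu) ^+ 2)%:E)%E.
    by apply: integral_ge0 => w _; rewrite lee_fin.
  move: key I0; case: (integral _ _ _) => [r|//|//].
  by rewrite -EFinD => -[h] _; rewrite lee_fin; have := sqr_ge0 mu; nra.
have e2 : 0 < (k%:R * e) ^+ 2 by rewrite exprn_gt0// mulr_gt0.
rewrite -(@lee_pmul2l _ ((k%:R * e) ^+ 2)%:E)// ?lte_fin//.
rewrite -EFinM (_ : _ * (v / _) = k%:R * v); last first.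
  by field; rewrite !gt_eqF.
apply: le_trans keyle; rewrite -(integral_indicT P mE) -integralZl_EFin_ge0 ?(ltW e2)//.
  apply: le_integral_EFin => //.
  - by apply: measurable_funM => //; exact: measurable_indic.
  - by move=> w; rewrite mulr_ge0 ?(ltW e2).
  - move=> w; rewrite indicE; have [|_] := boolP (w \in E); last by rewrite mulr0.
    rewrite inE /E/= mulr1 => ew; rewrite -[leRHS]real_normK ?num_real//.
    rewrite lerXn2r ?nnegrE ?mulr_ge0 ?(ltW e0)//.
    rewrite (_ : S w - _ = k%:R * (k%:R^-1 * S w - mu)); last by field; rewrite gt_eqF.
    by rewrite normrM gtr0_norm// ler_wpM2l.
Qed.

End bounded_summand.

Section truncation.
Variables (h : R -> R) (m : R).
Hypotheses (h0 : forall y, 0 <= h y) (mh : measurable_fun setT h).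
Hypothesis hm : (\int[P]_w (h (X 0%N w))%:E = m%:E)%E.

Definition trunc_le (c y : R) : R := if y <= c then y else 0.

Lemma trunc_le_ge0 c y : 0 <= y -> 0 <= trunc_le c y.
Proof. by rewrite /trunc_le; case: ifP. Qed.

Lemma trunc_le_le c y : 0 <= y -> trunc_le c y <= y.
Proof. by rewrite /trunc_le; case: ifP. Qed.

Lemma measurable_trunc_le c : measurable_fun setT (trunc_le c).
Proof.
apply: measurable_fun_ifT => //.
by apply: measurable_fun_ler => //; exact: measurable_id.
Qed.

Definition tmean (c : R) : R := fine (\int[P]_w (trunc_le c (h (X 0%N w)))%:E)%E.

Let hX0 w : 0 <= h (X 0%N w). Proof. exact: h0. Qed.
Let mhX j : measurable_fun setT (fun w => h (X j w)).
Proof. exact: measurableT_comp. Qed.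
Let mtX c : measurable_fun setT (fun w => trunc_le c (h (X 0%N w))).
Proof. by apply: measurableT_comp => //; exact: measurable_trunc_le. Qed.

Lemma tmeanE c : (\int[P]_w (trunc_le c (h (X 0%N w)))%:E = (tmean c)%:E)%E.
Proof.
rewrite /tmean fineK// ge0_fin_numE; last first.
  by apply: integral_ge0 => w _; rewrite lee_fin trunc_le_ge0.
apply: (@le_lt_trans _ _ m%:E); last exact: ltry.
rewrite -hm; apply: le_integral_EFin => // w; first exact: trunc_le_ge0.
exact: trunc_le_le.
Qed.

Lemma tmean_ge0 c : 0 <= tmean c.
Proof.
by rewrite -lee_fin -tmeanE; apply: integral_ge0 => w _; rewrite lee_fin trunc_le_ge0.
Qed.

Lemma tmean_le c : tmean c <= m.
Proof.
rewrite -lee_fin -tmeanE -hm; apply: le_integral_EFin => // w; first exact: trunc_le_ge0.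
exact: trunc_le_le.
Qed.

Lemma tmean_cvg (e : R) : 0 < e -> exists k0 : nat, forall k : nat, (k0 <= k)%N ->
  m - e <= tmean k%:R.
Proof.
move=> e0.
have nd : forall w, [set: T] w -> {homo (fun k : nat => (trunc_le k%:R (h (X 0%N w)))%:E) :
    i j / (i <= j)%N >-> (i <= j)%E}.
  move=> w _ i j ij; rewrite lee_fin /trunc_le; have [hi|_] := leP (h (X 0%N w)) i%:R.
    by rewrite ifT// (le_trans hi)// ler_nat.
  by case: ifP.
have := @cvg_monotone_convergence _ T R P setT measurableT
  (fun k w => (trunc_le k%:R (h (X 0%N w)))%:E) _ _ nd.
have mt k : measurable_fun setT (fun w => (trunc_le k%:R (h (X 0%N w)))%:E).
  exact/measurable_EFinP.
move=> /(_ mt).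
have g0 : forall (n : nat) (x : T), [set: T] x -> (0 <= (trunc_le n%:R (h (X 0%N x)))%:E)%E.
  by move=> n w _; rewrite lee_fin trunc_le_ge0.
move=> /(_ g0).
rewrite (_ : (\int[P]_x _ = m%:E)%E); last first.
  rewrite -hm; apply: eq_integral => w _; apply/cvg_lim => //.
  apply: cvg_near_cst; near=> k; congr EFin; rewrite /trunc_le ifT//.
  near: k; exists (Num.truncn (h (X 0%N w))).+1 => // k /= kk.
  by apply/ltW; apply: lt_le_trans (truncnS_gt _) _; rewrite ler_nat.
move=> /fine_cvgP[_ /cvgrPdist_le /(_ e e0)][k0 _ Hk]; exists k0 => k kk.
by have := Hk k kk; rewrite /= -/(tmean _) ler_norml => /andP[_]; lra.
Unshelve. all: by end_near. Qed.

(* h > k pays k for the union bound on the untruncated values, h <= k pays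
   h^2 / k for Chebyshev's inequality. *)
Definition trunc_cost (k y : R) : R := if y <= k then y ^+ 2 / k else k.

Lemma truncation_deviation (k : nat) (e : R) : (0 < k)%N -> 0 < e ->
  (P [set w | (e <= `|k%:R^-1 * \sum_(j < k) h (X j w) - tmean k%:R|)%R] <=
    (1 + e ^- 2)%:E * \int[P]_w (trunc_cost k%:R (h (X 0%N w)))%:E)%E.
Proof.
move=> k0 e0; have kR : 0 < k%:R :> R by rewrite ltr0n.
pose g := fun y => trunc_le k%:R (h y).
have g0 y : 0 <= g y by exact: trunc_le_ge0.
have mg : measurable_fun setT g by apply: measurableT_comp => //; exact: measurable_trunc_le.
have gk y : g y <= k%:R by rewrite /g /trunc_le; case: ifP.
have mg2 : measurable_fun setT (fun w => g (X 0%N w) ^+ 2).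
  by apply: measurable_funX; exact: measurableT_comp.
pose v := fine (\int[P]_w (g (X 0%N w) ^+ 2)%:E)%E.
have gv : (\int[P]_w (g (X 0%N w) ^+ 2)%:E = v%:E)%E.
  rewrite /v fineK// ge0_fin_numE; last first.
    by apply: integral_ge0 => w _; rewrite lee_fin sqr_ge0.
  apply: (@le_lt_trans _ _ (k%:R ^+ 2)%:E); last exact: ltry.
  rewrite -(integral_cstP P); apply: le_integral_EFin => // w; first exact: sqr_ge0.
  by rewrite lerXn2r ?nnegrE.
have cheb := iid_chebyshev g0 mg (tmeanE k%:R) gv k0 e0 (tmean_ge0 _).
set D := [set w | _]; set E := [set w | _] in cheb.
pose B := [set y | k%:R < h y].
have mB : measurable B.
  rewrite -[B]setTI (_ : B = h @^-1` `]k%:R, +oo[%classic); first exact: mh.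
  by apply/seteqP; split => w /=; rewrite in_itv/= andbT.
have mIB : measurable_fun setT (\1_B : R -> R) by exact: measurable_indic.
have mdev (f : T -> R) (c : R) : measurable_fun setT f -> measurable [set w | e <= `|k%:R^-1 * f w - c|].
  move=> mf; apply: measurable_ge_cst.
  by apply: measurableT_comp => //; apply: measurable_funB => //; apply: measurable_funM.
have mD : measurable D by apply: mdev; exact: measurable_sum.
have mE : measurable E.
  apply: (mdev (fun w => \sum_(j < k) g (X j w))); apply: measurable_sum => j.
  exact: measurableT_comp.
have mIBX j : measurable_fun setT (fun w => \1_B (X j w) : R) by exact: measurableT_comp.
have mIE : measurable_fun setT (\1_E : T -> R) by exact: measurable_indic.
have mc : measurable_fun setT (fun w => trunc_cost k%:R (h (X 0%N w))).
  apply: measurable_fun_ifT => //; first exact: measurable_fun_ler.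
  by apply: measurable_funM => //; exact: measurable_funX.
have c0 w : 0 <= trunc_cost k%:R (h (X 0%N w)).
  by rewrite /trunc_cost; case: ifP => // _; rewrite divr_ge0 ?sqr_ge0.
(* If no summand exceeds [k], truncation changes nothing and the truncated sum deviates; otherwise
   some indicator of [B] equals 1. *)
apply: (@le_trans _ _ (\int[P]_w (\sum_(j < k) \1_B (X j w) + \1_E w)%:E)%E).
  rewrite -(integral_indicT P mD); apply: le_integral_EFin => //.
  - by apply: measurable_funD => //; exact: measurable_sum.
  - move=> w; rewrite indicE; have [|_] := boolP (w \in D); last first.
      by rewrite addr_ge0// sumr_ge0// => j _; rewrite indicE.
    rewrite inE /D/= => Dw.
    have [[j Bj]|nB] := pselect (exists j : 'I_k, B (X j w)).
      rewrite (bigD1 j)//= [X in X + _ + _]indicE mem_set// -addrA lerDl addr_ge0//.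
      by rewrite sumr_ge0// => i _; rewrite indicE.
    rewrite [X in _ + X]indicE mem_set ?lerDr ?sumr_ge0//.
    rewrite /E/= (eq_bigr (fun j : 'I_k => h (X j w)))// => j _.
    rewrite /g /trunc_le ifT// leNgt; apply/negP => Bj; apply: nB; by exists j.
rewrite integralD_EFin_ge0//; last 2 first.
- exact: measurable_sum.
- by move=> w; rewrite sumr_ge0// => j _; rewrite indicE.
rewrite integral_sum_EFin_ge0//.
rewrite (eq_bigr (fun=> \int[P]_w (\1_B (X 0%N w))%:E)%E) => [|j _]; last first.
  exact: (@iid_integral \1_B).
rewrite (integral_indicT P mE).
apply: (@le_trans _ _ (\int[P]_w (trunc_cost k%:R (h (X 0%N w)))%:E +
  (e ^- 2)%:E * \int[P]_w (trunc_cost k%:R (h (X 0%N w)))%:E)%E); last first.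
  rewrite EFinD ge0_muleDl ?mul1e// lee_fin ?invr_ge0//.
  by rewrite exprn_ge0// ltW.
apply: leeD.
  rewrite -integral_sum_EFin_ge0//; apply: le_integral_EFin => //.
  - exact: measurable_sum.
  - by move=> w; rewrite sumr_ge0// => j _; rewrite indicE.
  - move=> w; rewrite sumr_const card_ord indicE /trunc_cost.
    have [|nB] := boolP (X 0%N w \in B).
      by rewrite inE /B/= => Bw; rewrite ifF// leNgt Bw.
    rewrite mul0rn; case: ifP => // _; by rewrite divr_ge0 ?sqr_ge0.
apply: (le_trans cheb).
rewrite (_ : v / _ = e ^- 2 * (k%:R^-1 * v)); last by field; rewrite !gt_eqF.
rewrite EFinM lee_wpmul2l ?lee_fin ?invr_ge0 ?exprn_ge0 ?(ltW e0)//.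
rewrite EFinM -gv -integralZl_EFin_ge0 ?invr_ge0//; last by move=> w; exact: sqr_ge0.
apply: le_integral_EFin => //.
- exact: measurable_funM.
- by move=> w; rewrite mulr_ge0 ?invr_ge0 ?sqr_ge0.
- move=> w; rewrite /g /trunc_le /trunc_cost; case: ifP => _; first by rewrite mulrC.
  by rewrite expr0n mulr0.
Qed.

Definition geom (al : R) (n : nat) : nat := (Num.truncn (al ^+ n)).+1.

Lemma bernoulli_ge (q : R) (n : nat) : 0 <= q -> 1 + n%:R * q <= (1 + q) ^+ n.
Proof.
move=> q0; elim: n => [|n IH]; first by rewrite mul0r addr0.
rewrite exprS -natr1; apply: (@le_trans _ _ ((1 + q) * (1 + n%:R * q))).
  have : 0 <= n%:R * q * q by rewrite !mulr_ge0.
  lra.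
by rewrite ler_wpM2l// addr_ge0.
Qed.

Section geometric.
Variable al : R.
Hypothesis al1 : 1 < al.

Let al0 : 0 < al. Proof. exact: lt_trans al1. Qed.
Let a0 n : 0 < al ^+ n. Proof. by rewrite exprn_gt0. Qed.

Lemma geom_gt n : al ^+ n < (geom al n)%:R.
Proof. exact: truncnS_gt. Qed.

Lemma geom_le n : (geom al n)%:R <= al ^+ n + 1.
Proof. by rewrite -natr1 lerD2r truncn_le// ltW. Qed.

Lemma geom_homo : {homo geom al : i j / (i <= j)%N}.
Proof.
move=> i j ij; rewrite ltnS; apply: le_truncn.
by rewrite ler_weXn2l// ltW.
Qed.

(* The potential of the telescoping sum: it grows by at least
   min(a, y^2 / a) when a is multiplied by al. *)
Let pot (y a : R) : R := al / (al - 1) * (if a <= y then a else 2 * y - y ^+ 2 / a).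

Let pot_step (y a : R) : 0 <= y -> 0 < a -> Num.min a (y ^+ 2 / a) <= pot y (al * a) - pot y a.
Proof.
move=> y0 ap; have d0 : 0 < al - 1 by rewrite subr_gt0.
have aa : 0 < al * a by rewrite mulr_gt0.
rewrite /pot -mulrBr -[al / _ * _]mulrA [_^-1 * _]mulrC mulrA ler_pdivlMr//.
have [ay|ya] := leP a y; last first.
  have -> : (al * a <= y) = false by apply/negbTE; rewrite -ltNge; nra.
  rewrite (_ : al * _ = y ^+ 2 / a * (al - 1)).
    by rewrite ler_wpM2r ?(ltW d0)// ge_min lexx orbT.
  by field; rewrite !gt_eqF.
have [aay|yaa] := leP (al * a) y.
  apply: (@le_trans _ _ (a * (al - 1))); first by rewrite ler_wpM2r ?(ltW d0)// ge_min lexx.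
  rewrite -subr_ge0 (_ : _ - _ = a * (al - 1) ^+ 2); last by ring.
  by rewrite mulr_ge0 ?sqr_ge0// ltW.
apply: (@le_trans _ _ (a * (al - 1))); first by rewrite ler_wpM2r ?(ltW d0)// ge_min lexx.
rewrite (_ : al * _ = (2 * al * y * a - y ^+ 2 - al * a ^+ 2) / a); last by field; rewrite !gt_eqF.
rewrite ler_pdivlMr//.
have : 0 <= (y - a) * (2 * al * a - y - a) by rewrite mulr_ge0//; nra.
nra.
Qed.

(** Along a geometric sequence the costs below y are dominated by the last of them and those above y
    by the first, hence the multiple of y. The potential treats both ranges by one telescoping sum;
    rounding al^n up to an integer loses a factor 2. *)
Lemma geom_cost_sum (y : R) (N : nat) : 0 <= y ->
  \sum_(n < N) trunc_cost (geom al n)%:R y <= 4 * (al / (al - 1)) * y.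
Proof.
move=> y0; have d0 : 0 < al - 1 by rewrite subr_gt0.
have c0 : 0 < al / (al - 1) by rewrite divr_gt0.
have pot0 (a : R) : 0 < a -> 0 <= pot y a <= al / (al - 1) * (2 * y).
  move=> ap; rewrite /pot; apply/andP; split.
    rewrite mulr_ge0 ?(ltW c0)//; have [_|ya] := leP a y; first exact: ltW.
    by rewrite subr_ge0 ler_pdivrMr//; nra.
  rewrite ler_wpM2l ?(ltW c0)//; have [ay|ya] := leP a y; first lra.
  by rewrite gerBl divr_ge0 ?sqr_ge0// ltW.
apply: (@le_trans _ _ (2 * (pot y (al ^+ N) - pot y 1))); last first.
  have /andP[p1 _] := pot0 1 ltr01; have /andP[_ p2] := pot0 _ (a0 N).
  by move: (al / (al - 1)) (pot y _) (pot y 1) p2 p1 => c u z p2 p1; lra.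
elim: N => [|N IH]; first by rewrite big_ord0 expr0 subrr mulr0.
rewrite big_ord_recr/=.
have := pot_step y0 (a0 N); rewrite -exprS => st.
suff : trunc_cost (geom al N)%:R y <= 2 * Num.min (al ^+ N) (y ^+ 2 / al ^+ N).
  move: IH st; set u := pot y _; set z := pot y 1; set x := pot y _; set S := \sum_(_ < _) _.
  by lra.
have g1 := geom_gt N; have g2 := geom_le N.
have a1 : 1 <= al ^+ N by rewrite exprn_ege1// ltW.
move: ((geom al N)%:R : R) (al ^+ N) (a0 N) g1 g2 a1 => k a ap g1 g2 a1.
have kp : 0 < k by lra.
rewrite /trunc_cost; have [yk|yk] := leP y k.
  rewrite minr_pMr// le_min; apply/andP; split.
    by rewrite ler_pdivrMr//; nra.
  have ya0 : 0 <= y ^+ 2 / a by rewrite divr_ge0 ?sqr_ge0// ltW.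
  apply: (@le_trans _ _ (y ^+ 2 / a)); last lra.
  by rewrite ler_wpM2l ?sqr_ge0// lef_pV2 ?posrE// ltW.
rewrite minr_pMr// le_min; apply/andP; split; first lra.
by rewrite mulrA ler_pdivlMr//; nra.
Qed.

(** Borel-Cantelli: the deviation probabilities are summable, because the truncation costs add up to
    a multiple of h(X_0), whose mean is [m]. *)
Lemma geometric_deviations (e : R) : 0 < e ->
  {ae P, forall w, exists n0, forall n, (n0 <= n)%N ->
    `|(geom al n)%:R^-1 * \sum_(j < geom al n) h (X j w) - tmean (geom al n)%:R| < e}.
Proof.
move=> e0; pose D n := [set w | e <= `|(geom al n)%:R^-1 * \sum_(j < geom al n) h (X j w) - tmean (geom al n)%:R|].
have mD n : measurable (D n).
  apply: measurable_ge_cst; apply: measurableT_comp => //; apply: measurable_funB => //.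
  by apply: measurable_funM => //; exact: measurable_sum.
have c0 (k : nat) w : 0 <= trunc_cost k%:R (h (X 0%N w)).
  by rewrite /trunc_cost; case: ifP => // _; rewrite divr_ge0 ?sqr_ge0.
have mc (k : nat) : measurable_fun setT (fun w => trunc_cost k%:R (h (X 0%N w))).
  apply: measurable_fun_ifT => //; first exact: measurable_fun_ler.
  by apply: measurable_funM => //; exact: measurable_funX.
pose C := (1 + e ^- 2) * (4 * (al / (al - 1)) * m).
have d0 : 0 < al - 1 by rewrite subr_gt0.
have ep : 0 <= 1 + e ^- 2 by rewrite addr_ge0// invr_ge0 exprn_ge0// ltW.
have c4 : 0 <= 4 * (al / (al - 1)) by rewrite mulr_ge0// divr_ge0// ltW.
have sum_le : (\sum_(n <oo) P (D n) <= C%:E)%E.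
  apply: lime_le; first exact: is_cvg_nneseries.
  apply: nearW => N; rewrite big_mkord.
  apply: (@le_trans _ _ (\sum_(n < N) (1 + e ^- 2)%:E * \int[P]_w (trunc_cost (geom al n)%:R (h (X 0%N w)))%:E)%E).
    by apply: lee_sum => n _; exact: truncation_deviation.
  rewrite -ge0_sume_distrr => [|n _]; last by apply: integral_ge0 => w _; rewrite lee_fin.
  rewrite /C EFinM lee_wpmul2l ?lee_fin// -integral_sum_EFin_ge0//.
  rewrite EFinM -hm -integralZl_EFin_ge0//; apply: le_integral_EFin => //.
  - exact: measurable_sum.
  - exact: measurable_funM.
  - by move=> w; exact: sumr_ge0.
  - by move=> w; exact: geom_cost_sum.
have lim0 : P (lim_sup_set D) = 0%E.
  by apply: lim_sup_set_cvg0 => //; rewrite (le_lt_trans sum_le)// ltry.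
exists (lim_sup_set D); split => //.
  by apply: bigcap_measurable => // n _; apply: bigcup_measurable => i _; exact: mD.
move=> w /= nw n _; apply: contrapT => nn; apply: nw; exists n => i ni.
rewrite ltNge; apply/negP => Di; apply: nn; exists i => //.
Qed.

End geometric.

(** Between consecutive geometric indices k <= N < k' monotonicity squeezes s N between s k and s
    k', with k' / k <= 1 + 2 q. The constant comes from (M + q) (1 + 2 q) <= M + (3 + 2 M) q for q
    <= 1. *)
Lemma geometric_interpolation (s : nat -> R) (M : R) (mu : nat -> R) (q : R) (n0 : nat) :
  (forall i j, (i <= j)%N -> s i <= s j) -> (forall i, 0 <= s i) -> 0 <= M ->
  0 < q -> q <= 1 ->
  (forall k, mu k <= M) -> (forall n, (n0 <= n)%N -> M - q <= mu (geom (1 + q) n)) ->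
  (forall n, (n0 <= n)%N ->
    `|(geom (1 + q) n)%:R^-1 * s (geom (1 + q) n) - mu (geom (1 + q) n)| < q) ->
  exists N0, forall N, (N0 <= N)%N -> `|N%:R^-1 * s N - M| <= (3 + 2 * M) * q.
Proof.
move=> sh s0 M0 q0 q1 muM muM' dev.
have q1' : 1 < 1 + q by rewrite ltrDl.
(* From n >= q^(-2) and Bernoulli's inequality, q (1 + q)^n >= 1: the rounding error 1 is absorbed
   in passing from 1 + q to 1 + 2 q. *)
pose n1 := maxn n0 (Num.truncn (q ^- 2)).+1.
exists (geom (1 + q) n1) => N nN.
have Np : (0 < N)%N by apply: leq_trans nN.
have NR : 0 < N%:R :> R by rewrite ltr0n.
have ex : exists n, (N < geom (1 + q) n)%N.
  exists (Num.truncn (N%:R / q)).+1; rewrite -(ltr_nat R).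
  apply: lt_trans (geom_gt _ _); apply: lt_le_trans (bernoulli_ge _ (ltW q0)).
  have : N%:R / q < (Num.truncn (N%:R / q)).+1%:R by exact: truncnS_gt.
  by rewrite ltr_pdivrMr// => h'; rewrite ltr_wpDl.
case: (ex_minnP ex) => -[|n] Nn nmin.
  have := leq_trans Nn (leq_trans (geom_homo q1' (leq0n n1)) nN); by rewrite ltnn.
have nN' : (geom (1 + q) n <= N)%N.
  by rewrite leqNgt; apply/negP => /nmin; rewrite ltnn.
have n1n : (n1 <= n)%N.
  rewrite leqNgt; apply/negP => nn1.
  by have := leq_trans Nn (leq_trans (geom_homo q1' nn1) nN); rewrite ltnn.
have n0n : (n0 <= n)%N by rewrite (leq_trans _ n1n)// leq_maxl.
have qn : 1 <= q * (1 + q) ^+ n.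
  have h1 := bernoulli_ge n (ltW q0).
  have h2 : q ^- 2 <= n%:R.
    apply/ltW/(lt_le_trans (truncnS_gt _)); rewrite ler_nat.
    by rewrite (leq_trans _ n1n)// leq_maxr.
  have h3 : 1 <= n%:R * q ^+ 2 by rewrite -ler_pdivrMr ?exprn_gt0// div1r.
  by move: h1 h3; move: (n%:R : R) ((1 + q) ^+ n) => x y h1 h3; nra.
have k1 := geom_gt (1 + q) n; have k2 := geom_le q1' n.+1.
set k := geom (1 + q) n in nN' k1 *; set k' := geom (1 + q) n.+1 in Nn k2 *.
have kp : 0 < k%:R :> R by rewrite ltr0n.
have kp' : 0 < k'%:R :> R by rewrite ltr0n.
have kk' : k'%:R <= (1 + 2 * q) * k%:R.
  rewrite exprS in k2; move: k1 k2 qn; move: ((1 + q) ^+ n) (k%:R : R) (k'%:R : R) => a x y.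
  by move=> k1 k2 qn; nra.
have kN : k%:R <= N%:R :> R by rewrite ler_nat.
have Nk' : N%:R <= k'%:R :> R by rewrite ler_nat ltnW.
have d1 := dev n n0n; have d2 := dev n.+1 (leqW n0n); rewrite -/k -/k' in d1 d2.
have m1 := muM' n n0n; rewrite -/k in m1; have m2 := muM k'.
have s1 : s k <= s N by exact: sh.
have s2 : s N <= s k' by apply: sh; exact: ltnW.
have u2 : s k' <= (M + q) * k'%:R.
  by rewrite -ler_pdivrMr// [_ / _]mulrC; move: d2; rewrite ltr_norml => /andP[_]; lra.
have u1 : (M - 2 * q) * k%:R <= s k.
  by rewrite -ler_pdivlMr// [_ / _]mulrC; move: d1; rewrite ltr_norml => /andP[+ _]; lra.
have hi : N%:R^-1 * s N <= M + (3 + 2 * M) * q.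
  rewrite mulrC ler_pdivrMr//; apply: (le_trans s2); apply: (le_trans u2).
  apply: (@le_trans _ _ ((M + q) * ((1 + 2 * q) * k%:R))).
    by rewrite ler_wpM2l// addr_ge0// ltW.
  rewrite mulrA; apply: ler_pM => //; last by nra.
  by rewrite mulr_ge0// addr_ge0// ?mulr_ge0// ltW.
have lo : M - (3 + 2 * M) * q <= N%:R^-1 * s N.
  have [M2|M2] := leP (M - 2 * q) 0.
    by apply: (@le_trans _ _ 0); [nra|rewrite mulr_ge0 ?invr_ge0].
  rewrite [leRHS]mulrC ler_pdivlMr//; apply: le_trans s1; apply: le_trans u1.
  have : N%:R <= (1 + 2 * q) * k%:R by exact: le_trans kk'.
  move: (N%:R : R) (k%:R : R) NR kp => x y x0 y0 xy.
  have [neg|pos] := leP (M - (3 + 2 * M) * q) 0; first nra.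
  apply: (@le_trans _ _ ((M - (3 + 2 * M) * q) * ((1 + 2 * q) * y))).
    by rewrite ler_wpM2l// ltW.
  by rewrite mulrA ler_wpM2r ?(ltW y0)//; nra.
by rewrite ler_norml; apply/andP; split; [move: lo|move: hi]; set z := N%:R^-1 * _; lra.
Qed.

Lemma slln_ge0 : {ae P, forall w, forall e : R, 0 < e -> exists N0, forall N, (N0 <= N)%N ->
  `|N%:R^-1 * \sum_(j < N) h (X j w) - m| <= e}.
Proof.
have M0 : 0 <= m by rewrite -lee_fin -hm; apply: integral_ge0 => w _; rewrite lee_fin.
have q0 (p : nat) : 0 < (p.+1%:R : R)^-1 by rewrite invr_gt0.
have al1 (p : nat) : 1 < 1 + (p.+1%:R : R)^-1 by rewrite ltrDl.
(* Countably many ratios 1 + 1 / (p + 1) keep the exceptional set null; [p] is chosen from [e] only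
   afterwards. *)
have := ae_foralln (fun p => geometric_deviations (al1 p) (q0 p)).
apply: filterS => w Hw e e0.
have K0 : 0 < 3 + 2 * m by lra.
pose p := Num.truncn ((3 + 2 * m) / e).
have pe : (3 + 2 * m) * (p.+1%:R)^-1 <= e.
  rewrite ler_pdivrMr// [e * _]mulrC -ler_pdivrMr//; apply/ltW; exact: truncnS_gt.
have [n0 Hn0] := Hw p.
have [k0 Hk0] := tmean_cvg (q0 p).
have [k1 Hk1] : exists n1, forall n, (n1 <= n)%N -> (k0 <= geom (1 + (p.+1%:R)^-1) n)%N.
  exists (k0 * p.+1)%N => n nn; rewrite -(ler_nat R).
  apply/ltW; apply: le_lt_trans (geom_gt _ _).
  apply: le_trans (bernoulli_ge _ (ltW (q0 p))).
  have : k0%:R <= n%:R * (p.+1%:R)^-1 :> R by rewrite ler_pdivlMr// -natrM ler_nat.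
  by move=> /le_trans; apply; rewrite lerDr.
have sh i j : (i <= j)%N -> \sum_(a < i) h (X a w) <= \sum_(a < j) h (X a w).
  move=> ij; rewrite -(subnKC ij) big_split_ord/= lerDl.
  by apply: sumr_ge0.
have q1 : (p.+1%:R : R)^-1 <= 1 by rewrite invf_le1// ler1n.
have A1 n : (maxn n0 k1 <= n)%N -> m - (p.+1%:R)^-1 <= tmean (geom (1 + (p.+1%:R)^-1) n)%:R.
  by rewrite geq_max => /andP[_ /Hk1]; exact: Hk0.
have A2 n : (maxn n0 k1 <= n)%N -> `|(geom (1 + (p.+1%:R)^-1) n)%:R^-1 *
    \sum_(j < geom (1 + (p.+1%:R)^-1) n) h (X j w) -
    tmean (geom (1 + (p.+1%:R)^-1) n)%:R| < (p.+1%:R)^-1.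
  by rewrite geq_max => /andP[/Hn0].
have [N0 HN0] := @geometric_interpolation (fun N => \sum_(j < N) h (X j w)) m (fun k => tmean k%:R)
  (p.+1%:R)^-1 (maxn n0 k1) sh (fun i => sumr_ge0 _ (fun _ _ => h0 _)) M0 (q0 p)
  q1 (fun k => tmean_le _) A1 A2.
exists N0 => N /HN0 /le_trans; exact.
Qed.

End truncation.

End second_moment.

(** * Almost sure convergence of the statistic *)

Section statistic_convergence.
Context d (T : measurableType d) (R : realType) (P : probability T R).
Variable X : nat -> {RV P >-> R}.
Hypothesis X_iid : iid X.
Variable F : R -> R.
Hypothesis F_cdf : forall r, cdf (X 0%N) r = (F r)%:E.
Hypothesis F_cont : continuous F.
Hypothesis X_sq : P.-integrable setT (fun w => (X 0%N w ^+ 2)%:E).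

Let F_homo : {homo F : s t / s <= t}.
Proof. by move=> s t st; rewrite -lee_fin -!F_cdf; exact: cdf_nondecreasing. Qed.

Let F01 t : 0 <= F t <= 1.
Proof. by rewrite -!lee_fin -F_cdf cdf_ge0 cdf_le1. Qed.

Let F_lt s t : F s < F t -> s < t.
Proof. by rewrite !ltNge; apply: contra; exact: F_homo. Qed.

Lemma cdf_surjective (y : R) : 0 < y < 1 -> exists t, F t = y.
Proof.
move=> /andP[y0 y1].
have FE : cdf (X 0%N) = EFin \o F by apply/funext => r; exact: F_cdf.
have [a ay] : exists a, F a < y.
  have := cvg_cdfNy0 (X 0%N); rewrite FE => /fine_cvgP[_ /cvgrPdist_lt/(_ _ y0) [a [_ Ha]]].
  exists (a - 1); have := Ha (a - 1); rewrite ltrBlDr ltrDl ltr01 => /(_ isT).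
  by rewrite sub0r normrN/= ger0_norm//; have /andP[] := F01 (a - 1).
have [b yb] : exists b, y < F b.
  have y1' : 0 < 1 - y by rewrite subr_gt0.
  have := cvg_cdfy1 (X 0%N); rewrite FE => /fine_cvgP[_ /cvgrPdist_lt/(_ _ y1') [b [_ Hb]]].
  exists (b + 1); have := Hb (b + 1); rewrite ltrDl ltr01 => /(_ isT).
  by have /andP[_ b1] := F01 (b + 1); rewrite /= ger0_norm ?subr_ge0//; lra.
have ab : a <= b by apply/ltW; apply: F_lt; exact: lt_trans yb.
have [|t _ ty] := @IVT R F a b y ab (continuous_subspaceT F_cont).
  by rewrite (min_idPl _) ?(max_idPr _) ?F_homo// !ltW.
by exists t.
Qed.

Section quantiles.
Variables (K : nat) (t : nat -> R).
Hypothesis tK : forall i, (0 < i < K)%N -> F (t i) = i%:R / K%:R.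
Hypothesis K0 : (0 < K)%N.

Let KR : 0 < K%:R :> R. Proof. by rewrite ltr0n. Qed.

Let level (u : R) : exists i, [/\ (i <= K)%N, i%:R / K%:R <= F u & F u < i.+1%:R / K%:R].
Proof.
have /andP[u0 u1] := F01 u.
have K1 : 0 <= K%:R * F u by rewrite mulr_ge0.
exists (Num.truncn (K%:R * F u)); split.
- rewrite -(ler_nat R) (@le_trans _ _ (K%:R * F u)) ?truncn_le//.
  by rewrite ler_piMr.
- by rewrite ler_pdivrMr// [F u * _]mulrC truncn_le.
- by rewrite ltr_pdivlMr// mulrC; exact: truncnS_gt.
Qed.

(* On a segment of length below the smallest gap between consecutive quantiles F
   grows by less than 3 levels. *)
Lemma quantile_modulus : exists2 rho : R, 0 < rho & forall u v : R,
  `|u - v| <= rho -> `|F u - F v| <= 3 / K%:R.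
Proof.
have [rho rho0 Hrho] : exists2 rho : R, 0 < rho & forall i, (0 < i)%N -> (i.+1 < K)%N ->
    rho < t i.+1 - t i.
  have main n : (n <= K)%N -> exists2 rho : R, 0 < rho & forall i, (0 < i)%N -> (i.+1 < n)%N ->
    rho < t i.+1 - t i.
    elim: n => [|n IH] nK; first by exists 1.
    have [rho rho0 H] := IH (ltnW nK).
    have [n1|n1] := leqP n 1.
      exists rho => // i i0 ni; have : (1 < n)%N by exact: leq_ltn_trans i0 ni.
      by rewrite ltnNge n1.
    have tt : 0 < t n - t n.-1.
      rewrite subr_gt0; apply: F_lt; rewrite !tK ?nK ?andbT; last 2 first.
      - by apply: leq_trans n1.
      - by rewrite -subn1 subn_gt0 n1 (leq_ltn_trans (leq_subr _ _) nK).
      by rewrite ltr_pM2r ?invr_gt0// ltr_nat prednK// ltnW.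
    exists (Num.min rho ((t n - t n.-1) / 2)); first by rewrite lt_min rho0 divr_gt0.
    move=> i i0; rewrite ltnS leq_eqVlt => /predU1P[ni|ni].
      rewrite -ni/= in tt *; rewrite gt_min; apply/orP; right; lra.
    by rewrite gt_min H.
  have [rho rho0 H] := main K (leqnn K).
  by exists rho.
exists rho => // u v uv.
suff S (a b : R) : a <= b -> b - a <= rho -> F b - F a <= 3 / K%:R.
  rewrite ler_norml; apply/andP; split.
    have [uv'|/ltW/F_homo vu] := leP u v.
      rewrite lerNl opprB; apply: S => //; rewrite (le_trans _ uv)// distrC ler_norm//.
    by apply: (@le_trans _ _ 0); [rewrite oppr_le0 divr_ge0|rewrite subr_ge0].
  have [vu|/ltW/F_homo uv'] := leP v u.
    by apply: S => //; rewrite (le_trans _ uv)// ler_norm.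
  by apply: (@le_trans _ _ 0); [rewrite subr_le0|rewrite divr_ge0].
move=> ab bar; have [i [iK iF Fi]] := level a.
rewrite leNgt; apply/negP => big.
have Fb : i.+2%:R / K%:R < F b.
  have : i.+2%:R / K%:R <= i%:R / K%:R + 3 / K%:R :> R.
    by rewrite -mulrDl ler_wpM2r ?invr_ge0// -natrD ler_nat addnC.
  by move: (_ / _) (_ / _) (_ / _) iF big => x y z; lra.
have iK2 : (i.+2 < K)%N.
  have /andP[_ b1] := F01 b; have := lt_le_trans Fb b1.
  by rewrite ltr_pdivrMr// mul1r ltr_nat.
have ta : a < t i.+1 by apply: F_lt; rewrite tK// (ltn_trans _ iK2).
have tb : t i.+2 < b by apply: F_lt; rewrite tK.
have := Hrho i.+1 isT iK2; lra.
Qed.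

(** The Glivenko-Cantelli argument: monotonicity of [G] and [F] extends closeness at the quantiles
    to every point, at the loss of a few levels 1 / K. *)
Lemma quantile_uniform (G : R -> R) : subcdf G ->
  (forall i, (i < K)%N -> `|G (t i) - F (t i)| <= K%:R^-1) ->
  forall u, `|G u - F u| <= 3 / K%:R.
Proof.
move=> [Gh G01] cl u; have [i [iK iF Fi]] := level u.
have /andP[g0 g1] := G01 u; have Ki : 0 < K%:R^-1 :> R by rewrite invr_gt0.
have sE (n : nat) : n.+1%:R / K%:R = n%:R / K%:R + K%:R^-1 :> R.
  by rewrite -natr1 mulrDl mul1r.
rewrite ler_norml; apply/andP; split.
  (* Only a strict inequality between values of [F] orders the arguments, so the quantile below [u]
     is taken one level down; on the two lowest levels F u < 2 / K already suffices. *)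
  case: i iK iF Fi => [|[|i]] iK iF Fi.
  - by move: Fi; rewrite mul1r; lra.
  - by move: Fi; rewrite sE mul1r; lra.
  have ik : (0 < i.+1 < K)%N by [].
  have tu : t i.+1 <= u.
    apply/ltW/F_lt; rewrite tK//; apply: lt_le_trans iF.
    by rewrite [ltRHS]sE ltrDl.
  have := Gh _ _ tu; have := cl i.+1 iK; rewrite tK// ler_norml => /andP[+ _].
  by rewrite (sE i.+2) (sE i.+1) in Fi; lra.
have [Ki1|Ki1] := leqP K i.+1.
  have : 1 <= i.+1%:R / K%:R :> R by rewrite ler_pdivlMr// mul1r ler_nat.
  by rewrite sE; lra.
have tu : u <= t i.+1 by apply/ltW/F_lt; rewrite tK.
have := Gh _ _ tu; have := cl i.+1 Ki1; rewrite tK// ler_norml sE => /andP[_].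
lra.
Qed.

End quantiles.

Lemma eventually_all_lt (Q : nat -> nat -> Prop) :
  (forall i, exists N0, forall N, (N0 <= N)%N -> Q i N) ->
  forall K, exists N0, forall N, (N0 <= N)%N -> forall i, (i < K)%N -> Q i N.
Proof.
move=> H; elim=> [|K [N0 HN0]]; first by exists 0%N.
have [N1 HN1] := H K; exists (maxn N0 N1) => N; rewrite geq_max => /andP[h0 h1] i.
rewrite ltnS leq_eqVlt => /predU1P[->|iK]; [exact: HN1|exact: HN0].
Qed.

Let X_int : P.-integrable setT (EFin \o X 0%N).
Proof.
have h1 : P.-integrable setT (fun w => (1 + X 0%N w ^+ 2)%:E).
  have := integrableD measurableT (finite_measure_integrable_cst P 1 measurableT) X_sq.
  by apply: eq_integrable => // w _.
apply: le_integrable h1 => //; first exact/measurable_EFinP.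
move=> w _; rewrite lee_fin [leRHS]ger0_norm ?addr_ge0 ?sqr_ge0//.
by rewrite ler_norml; apply/andP; split; nra.
Qed.

Let mu : R := fine 'E_P[X 0%N]%E.
Let m2 : R := fine (\int[P]_w (X 0%N w ^+ 2)%:E)%E.

Lemma slln_mean : {ae P, forall w, forall e : R, 0 < e -> exists N0, forall N, (N0 <= N)%N ->
  `|emp N (fun j => X j w) (fun y => y) - mu| <= e}.
Proof.
(* [slln_ge0] is about nonnegative summands, hence the positive and negative parts. *)
pose hp (y : R) := Num.max y 0; pose hn (y : R) := Num.max (- y) 0.
have mhp : measurable_fun setT hp by apply: measurable_maxr => //; exact: measurable_id.
have mhn : measurable_fun setT hn by apply: measurable_maxr => //; exact: measurable_funN.
have hp0 y : 0 <= hp y by rewrite le_max lexx orbT.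
have hn0 y : 0 <= hn y by rewrite le_max lexx orbT.
have hE y : y = hp y - hn y.
  rewrite /hp /hn; have [y0|y0] := leP y 0.
    by rewrite (max_idPl _) ?oppr_ge0// sub0r opprK.
  by rewrite (max_idPr _) ?subr0// oppr_le0 ltW.
have ip : P.-integrable setT (EFin \o (fun w => hp (X 0%N w))).
  apply: le_integrable X_int => //; first by apply/measurable_EFinP; exact: measurableT_comp.
  move=> w _; rewrite lee_fin ger0_norm// /hp ge_max normr_ge0 andbT; exact: ler_norm.
have in_ : P.-integrable setT (EFin \o (fun w => hn (X 0%N w))).
  apply: le_integrable X_int => //; first by apply/measurable_EFinP; exact: measurableT_comp.
  move=> w _; rewrite lee_fin ger0_norm// /hn ge_max normr_ge0 andbT -normrN; exact: ler_norm.
have fp := integrable_fin_num measurableT ip; have fn := integrable_fin_num measurableT in_.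
have muE : mu = fine (\int[P]_w (hp (X 0%N w))%:E)%E - fine (\int[P]_w (hn (X 0%N w))%:E)%E.
  rewrite -fineB//; congr fine; rewrite unlock -integralB//.
  by apply: eq_integral => w _; rewrite /= -EFinB -hE.
have := slln_ge0 X_iid hp0 mhp (esym (fineK fp)); have := slln_ge0 X_iid hn0 mhn (esym (fineK fn)).
apply: filterS2 => w Hn Hp e e0.
have [e20] : 0 < e / 2 by rewrite divr_gt0.
have [N1 H1] := Hn _ e20; have [N2 H2] := Hp _ e20.
exists (maxn N1 N2) => N; rewrite geq_max => /andP[/H1 h1 /H2 h2].
rewrite muE (_ : emp _ _ _ = N%:R^-1 * (\sum_(j < N) hp (X j w)) - N%:R^-1 * (\sum_(j < N) hn (X j w))).
  by move: h1 h2; rewrite !ler_norml => /andP[? ?] /andP[? ?]; apply/andP; split; lra.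
by rewrite -mulrBr -sumrB; congr (_ * _); apply: eq_bigr => j _; exact: hE.
Qed.

Lemma slln_sqr : {ae P, forall w, forall e : R, 0 < e -> exists N0, forall N, (N0 <= N)%N ->
  `|emp N (fun j => X j w) (fun y => y ^+ 2) - m2| <= e}.
Proof.
have f2 := integrable_fin_num measurableT X_sq.
have s0 (y : R) : 0 <= y ^+ 2 by exact: sqr_ge0.
exact: (slln_ge0 X_iid s0 (exprn_measurable 2) (esym (fineK f2))).
Qed.

Lemma slln_cdf (t : R) : {ae P, forall w, forall e : R, 0 < e -> exists N0, forall N, (N0 <= N)%N ->
  `|emp N (fun j => X j w) \1_(`]-oo, t]) - F t| <= e}.
Proof.
have i0 (y : R) : 0 <= \1_(`]-oo, t]%classic) y :> R by rewrite indicE.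
apply: (slln_ge0 X_iid i0) => //.
have mA : measurable (X 0%N @^-1` `]-oo, t]) by exact: measurable_funPTI.
by rewrite -F_cdf /cdf -[RHS](integral_indicT P mA).
Qed.

Lemma variance_moments : fine 'V_P[X 0%N]%E = m2 - mu ^+ 2.
Proof.
have X1 : (X 0%N : T -> R) \in Lfun P 1 by exact: ((Lfun1_integrable P _).2 X_int).
have X2 : ((X 0%N : T -> R) * (X 0%N : T -> R))%R \in Lfun P 1.
  apply: ((Lfun1_integrable P _).2); apply: eq_integrable X_sq => // w _ /=.
rewrite [X in fine X]covarianceE// fineB ?fineM; last 4 first.
- exact: expectation_fin_num.
- exact: expectation_fin_num.
- exact: expectation_fin_num.
- by rewrite fin_numM// expectation_fin_num.
rewrite /m2 /mu; congr (fine _ - _); rewrite unlock; apply: eq_integral => w _ /=.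
done.
Qed.

Variable psi : R -> R.
Hypothesis psi_ge0 : forall x, 0 <= psi x.
Hypothesis psi_int : (@lebesgue_measure R).-integrable setT (EFin \o psi).

Lemma AD_statistic_cvg : {ae P, forall w, forall e : R, 0 < e ->
  exists N0, forall N, (N0 <= N)%N ->
  `|fine (AD_statistic psi N (fun j => X j w)) -
    fine (AD_functional psi F mu (Num.sqrt (fine 'V_P[X 0%N]%E)))| <= e}.
Proof.
(* The quantiles are fixed for all [K] before the sample point, so that the strong law is applied to
   countably many rays only. *)
have [t tE] : exists t : nat -> nat -> R, forall K i, (0 < i < K)%N -> F (t K i) = i%:R / K%:R.
  have H K i : exists t, (0 < i < K)%N -> F t = i%:R / K%:R.
    have [/andP[i0 iK]|nh] := boolP (0 < i < K)%N; last by exists 0.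
    have K0 : 0 < K%:R :> R by rewrite ltr0n (leq_ltn_trans _ iK).
    have [|x xE] := @cdf_surjective (i%:R / K%:R); last by exists x.
    by apply/andP; split; [rewrite divr_gt0// ltr0n|rewrite ltr_pdivrMr// mul1r ltr_nat].
  have H' K : exists f : nat -> R, forall i, (0 < i < K)%N -> F (f i) = i%:R / K%:R.
    by have [f fE] := choice (H K); exists f.
  by have [t tE] := choice H'; exists t.
have aec := ae_foralln (fun K => ae_foralln (fun i => slln_cdf (t K i))).
move: slln_mean slln_sqr aec; apply: filterS3 => w Hm Hs Hc e e0.
have [eta [tau [eta0 tau0 H]]] := AD_functional_continuous psi_ge0 psi_int e0.
pose K := (Num.truncn (3 / eta)).+1.
have KR : 0 < K%:R :> R by rewrite ltr0n.
have Keta : 3 / K%:R <= eta.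
  by rewrite ler_pdivrMr// mulrC -ler_pdivrMr//; apply/ltW; exact: truncnS_gt.
have [rho rho0 Hrho] := quantile_modulus (tE K) isT.
have Ki : 0 < K%:R^-1 :> R by rewrite invr_gt0.
have [N1 HN1] := eventually_all_lt (fun i => Hc K i _ Ki) K.
have r2 : 0 < rho / 2 by rewrite divr_gt0.
have [N2 HN2] := Hm _ r2.
pose z := rho / 2 / tau; have z0 : 0 < z by rewrite divr_gt0.
pose z2 := z ^+ 2; have z20 : 0 < z2 by rewrite exprn_gt0.
have z3 : 0 < z2 / 3 by rewrite divr_gt0.
(* Gives |a^2 - mu^2| <= g (2 |mu| + 1) <= z2 / 3; the second moment and the divisor n - 1 take the
   other two thirds of the variance tolerance [z2]. *)
pose g := Num.min 1 (z2 / 3 / (2 * `|mu| + 1)).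
have mu1 : 0 < 2 * `|mu| + 1 by rewrite ltr_wpDl// mulr_ge0.
have g0 : 0 < g by rewrite lt_min ltr01 divr_gt0.
have [N3 HN3] := Hm _ g0; have [N4 HN4] := Hs _ z3.
have m20 : 0 <= m2 by rewrite fine_ge0// integral_ge0// => y _; rewrite lee_fin sqr_ge0.
pose N5 := (Num.truncn ((m2 + z2 / 3) / (z2 / 3))).+2.
exists (maxn (maxn N1 N2) (maxn (maxn N3 N4) N5)) => N.
rewrite !geq_max => /andP[/andP[/HN1 h1 /HN2 h2] /andP[/andP[/HN3 h3 /HN4 h4] h5]].
have N1' : (1 < N)%N by exact: leq_trans h5.
have Np : (0 < N)%N by exact: ltnW.
have pe := emp_posfun (fun j => X j w) Np.
rewrite AD_statisticE; apply: (H _ _ _ _ _ _ rho) => //.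
- exact: posfun_subcdf.
- by move=> u v /Hrho /le_trans; exact.
- move=> u; apply: le_trans Keta.
  by apply: (quantile_uniform (tE K) isT (posfun_subcdf pe)) => i iK; exact: h1.
rewrite -ler_pdivlMr// -/z; apply: sqrt_dist_le; rewrite ?sqrtr_ge0 ?(ltW z0)// -/z2.
have V0 : 0 <= fine 'V_P[X 0%N]%E by rewrite fine_ge0// variance_ge0.
rewrite [X in _ - X]sqr_sqrtr// variance_moments.
have ss := ssd_sqr (fun j => X j w) N1'.
set a := emp _ _ (fun y => y) in h3 ss; set b := emp _ _ (fun y => y ^+ 2) in h4 ss.
have NR : 0 < N%:R - 1 :> R by rewrite subr_gt0 ltr1n.
have bb : b / (N%:R - 1) <= z2 / 3.
  rewrite ler_pdivrMr// mulrC -ler_pdivrMr//.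
  apply: (@le_trans _ _ ((m2 + z2 / 3) / (z2 / 3))).
    rewrite ler_wpM2r ?invr_ge0 ?(ltW z3)//.
    by move: h4; rewrite ler_norml => /andP[_]; lra.
  apply/ltW/(lt_le_trans (truncnS_gt _)).
  by rewrite lerBrDr natr1 ler_nat.
have aa : `|a ^+ 2 - mu ^+ 2| <= z2 / 3.
  rewrite subr_sqr normrM.
  have g1 : g <= 1 by rewrite ge_min lexx.
  have gz : g <= z2 / 3 / (2 * `|mu| + 1) by rewrite ge_min lexx orbT.
  apply: (@le_trans _ _ (g * (2 * `|mu| + 1))); last by rewrite -ler_pdivlMr.
  apply: ler_pM => //; rewrite -[a + mu](subrK (2 * mu)).
  apply: (le_trans (ler_normD _ _)); rewrite normrM ger0_norm// addrC lerD2l.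
  by rewrite (_ : a + mu - 2 * mu = a - mu); [exact: le_trans g1|ring].
move: ss bb aa h4; rewrite !ler_norml => /andP[? ?] ? /andP[? ?] /andP[? ?].
by apply/andP; split; lra.
Qed.

End statistic_convergence.

(** * The exponential rates *)

Section rates.
Context {R : realType}.
Implicit Types (u : (\bar R)^nat) (a : \bar R) (x : R).

Lemma limn_einf_ge u a : (exists n0, forall n, (n0 <= n)%N -> (a <= u n)%E) ->
  (a <= limn_einf u)%E.
Proof.
move=> [n0 H]; rewrite limn_einf_lim; apply: lime_ge; first exact: is_cvg_einfs.
exists n0 => // n /= n0n; apply: le_ereal_inf_tmp => _ [k /= nk <-].
by apply: H; exact: leq_trans nk.
Qed.

Lemma limn_esup_le u a : (exists n0, forall n, (n0 <= n)%N -> (u n <= a)%E) ->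
  (limn_esup u <= a)%E.
Proof.
move=> [n0 H]; rewrite limn_esup_lim; apply: lime_le; first exact: is_cvg_esups.
exists n0 => // n /= n0n; apply: ge_ereal_sup => _ [k /= nk <-].
by apply: H; exact: leq_trans nk.
Qed.

Lemma rate_ge (n : nat) (h : \bar R) x : (0 < n)%N -> h \is a fin_num ->
  ((expR (- (n%:R * x)))%:E <= h)%E -> ((- x)%:E <= n%:R^-1%:E * lne h)%E.
Proof.
move=> n0; case: h => [h _|//|//]; rewrite lee_fin => hx.
have h0 : 0 < h by exact: lt_le_trans (expR_gt0 _) hx.
have nR : 0 < n%:R :> R by rewrite ltr0n.
rewrite lne_EFin// -EFinM lee_fin mulrC ler_pdivlMr//.
by rewrite mulNr mulrC -[leLHS]expRK ler_ln ?posrE ?expR_gt0.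
Qed.

Lemma rate_le (n : nat) (h : \bar R) x : (0 < n)%N -> h \is a fin_num ->
  (h <= (expR (- (n%:R * x)))%:E)%E -> (n%:R^-1%:E * lne h <= (- x)%:E)%E.
Proof.
move=> n0; case: h => [h _|//|//]; rewrite lee_fin => hx.
have nR : 0 < n%:R :> R by rewrite ltr0n.
have [h0|h0] := leP h 0; last first.
  rewrite lne_EFin// -EFinM lee_fin mulrC ler_pdivrMr//.
  by rewrite mulNr mulrC -[leRHS]expRK ler_ln ?posrE ?expR_gt0.
by rewrite /lne h0 gt0_muleNy ?leNye// lte_fin invr_gt0.
Qed.

End rates.

Section rate_function.
Context {R : realType}.
Variable psi : R -> R.
Hypothesis psi_ge0 : forall x, 0 <= psi x.
Hypothesis psi_int : (@lebesgue_measure R).-integrable setT (EFin \o psi).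

Lemma G_AD_nondecreasing (u v : R) : u <= v -> (G_AD psi u <= G_AD psi v)%E.
Proof.
move=> uv; apply: ereal_inf_le_tmp => _ [l [dl lv] <-]; exists l => //; split => //.
by apply: le_trans lv; rewrite lee_fin.
Qed.

Lemma J_Phi_ge0 (l : (R -> R) -> R) : orlicz_dual l -> (0 <= J_Phi l)%E.
Proof.
move=> [lin _]; have o0 : orlicz (fun _ : R => 0 : R) by apply: quadb_orlicz; exact: quadb_cst.
have l0 : l (fun=> 0) = 0.
  have := lin 1 _ _ o0 o0; rewrite (_ : (fun x => _) = fun=> 0); last first.
    by apply/funext => x; rewrite mulr0 addr0.
  lra.
apply: ereal_sup_ubound; exists (fun=> 0) => //.
by rewrite l0 unlock expR0 integral_cstP lne1 sube0.
Qed.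

Lemma G_AD_ge0 (u : R) : (0 <= G_AD psi u)%E.
Proof. by apply: le_ereal_inf_tmp => _ [l [dl _] <-]; exact: J_Phi_ge0. Qed.

Lemma AD_functional_value (l : (R -> R) -> R) : posfun l ->
  AD_functional psi (fun t => l \1_(`]-oo, t])) (l (fun s => s))
    (Num.sqrt (l (fun s => s ^+ 2) - l (fun s => s) ^+ 2)) = (AD_value psi l)%:E.
Proof.
move=> pl; rewrite /AD_value fineK//; apply: AD_functional_fin => //.
exact: posfun_subcdf.
Qed.

Lemma G_AD_lt (u : R) (a : \bar R) : (G_AD psi u < a)%E ->
  exists l, [/\ orlicz_dual l, (J_Phi l < a)%E & u <= AD_value psi l].
Proof.
move=> /ereal_inf_lt[_ [l [dl lu] <-] Ja]; exists l; split => //.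
have Jf : J_Phi l \is a fin_num.
  by rewrite ge0_fin_numE ?J_Phi_ge0// (lt_le_trans Ja)// leey.
have pl : posfun l by apply: (orlicz_dual_posfun dl (J0 := fine (J_Phi l))); rewrite fineK.
by move: lu; rewrite /= AD_functional_value// lee_fin.
Qed.

Lemma G_AD_le (u : R) (l : (R -> R) -> R) : orlicz_dual l -> u <= AD_value psi l ->
  (G_AD psi u <= J_Phi l)%E.
Proof.
move=> dl lu; have := J_Phi_ge0 dl; case EJ : (J_Phi l) => [r| |] // _; last by rewrite leey.
have pl : posfun l by apply: (orlicz_dual_posfun dl (J0 := r)); rewrite EJ.
rewrite -EJ; apply: ereal_inf_lbound; exists l => //; split => //=.
by rewrite AD_functional_value// lee_fin.
Qed.

(** Monotonicity of [G_AD] alone makes the one-sided limit exist and identifies it with an infimum;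
    from the other side it is a supremum. *)
Lemma G_AD_cvg_right (c : R) : G_AD psi (c + del) @[del --> 0^'+] -->
  ereal_inf ((fun del => G_AD psi (c + del)) @` `]0, +oo[%classic).
Proof.
apply: (nondecreasing_at_right_cvge +oo%O) => // x y _ _ xy.
by apply: G_AD_nondecreasing; rewrite lerD2l.
Qed.

Lemma G_AD_cvg_left (c : R) : G_AD psi (c - del) @[del --> 0^'+] -->
  ereal_sup ((fun del => G_AD psi (c - del)) @` `]0, +oo[%classic).
Proof.
apply: (nonincreasing_at_right_cvge +oo%O) => // x y _ _ xy.
by apply: G_AD_nondecreasing; rewrite lerB.
Qed.

Context d (T : measurableType d) (P : probability T R).
Variable Z : nat -> {RV P >-> R}.
Hypothesis Zn : iid_std_normal Z.

Lemma H_AD_fin n (u : R) : H_AD Z psi n u \is a fin_num.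
Proof. by apply: fin_num_measure; exact: AD_event_measurable. Qed.

Lemma H_AD_antitone n (u v : R) : u <= v -> (H_AD Z psi n v <= H_AD Z psi n u)%E.
Proof.
move=> uv; apply: le_measure; rewrite ?inE; try exact: AD_event_measurable.
by move=> t /=; apply: le_trans; rewrite lee_fin.
Qed.

Section sequence.
Variables (S : nat -> R) (c : R).
Hypothesis Sc : forall e : R, 0 < e -> exists N0, forall N, (N0 <= N)%N -> `|S N - c| <= e.

Let rate n := (n%:R^-1%:E * lne (H_AD Z psi n (S n)))%E.

Lemma rate_lower : (- lim (G_AD psi (c + del) @[del --> 0^'+]) <= limn_einf rate)%E.
Proof.
rewrite (cvg_lim _ (@G_AD_cvg_right c))//; set L := ereal_inf _.
have L0 : (0 <= L)%E by apply: le_ereal_inf_tmp => _ [del _ <-]; exact: G_AD_ge0.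
have claim (r e : R) : (L < r%:E)%E -> 0 < e -> ((- (r + e))%:E <= limn_einf rate)%E.
  move=> /ereal_inf_lt[_ [del + <-]]; rewrite /= in_itv/= andbT => d0 Gr e0.
  have [l [dl Jl lT]] := G_AD_lt Gr.
  have r0 : 0 <= r by rewrite -lee_fin (le_trans (J_Phi_ge0 dl))// ltW.
  (* Half of [del] keeps [c + del / 2] strictly below the value at [l], the other half absorbs the
     deviation of [S n] from [c]. *)
  have d2 : 0 < del / 2 by rewrite divr_gt0.
  have [|n0 Hn0] := lower_bound Zn psi_ge0 psi_int (u := c + del / 2) dl r0 (ltW Jl) _ e0.
    by apply: lt_le_trans lT; lra.
  have [N0 HN0] := Sc d2; apply: limn_einf_ge; exists (maxn (maxn n0 N0) 1) => n.
  rewrite !geq_max => /andP[/andP[/Hn0 h1 /HN0 h2] n1].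
  apply: rate_ge => //; first exact: H_AD_fin.
  apply: (le_trans h1); apply: H_AD_antitone.
  by move: h2; rewrite ler_norml => /andP[_]; lra.
case: L L0 claim => [r _ claim|_ _|//]; last by rewrite leNye.
apply/lee_subgt0Pr => e e0; rewrite -EFinN -EFinB.
have -> : - r - e = - ((r + e / 2) + e / 2) by lra.
by apply: claim; [rewrite lte_fin ltrDl divr_gt0|rewrite divr_gt0].
Qed.

Lemma rate_upper : (limn_esup rate <= - lim (G_AD psi (c - del) @[del --> 0^'+]))%E.
Proof.
rewrite (cvg_lim _ (@G_AD_cvg_left c))//; set L := ereal_sup _.
have claim (r e : R) : (r%:E < L)%E -> 0 < e -> (limn_esup rate <= (- (r - e))%:E)%E.
  move=> /ereal_sup_gt[_ [del + <-]]; rewrite /= in_itv/= andbT => d0 Gr e0.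
  have d2 : 0 < del / 2 by rewrite divr_gt0.
  (* The level is [c - del / 2], and [upper_bound] looks at all [l] whose value falls short of it by
     at most [del / 2], that is down to [c - del]. *)
  have [|n0 Hn0] := @upper_bound _ _ _ _ Z Zn psi psi_ge0 psi_int r (del / 2) (c - del / 2) e d2 e0.
    move=> l dl lT; apply: (le_trans (ltW Gr)); apply: G_AD_le => //.
    by apply: le_trans lT; lra.
  have [N0 HN0] := Sc d2; apply: limn_esup_le; exists (maxn (maxn n0 N0) 1) => n.
  rewrite !geq_max => /andP[/andP[/Hn0 h1 /HN0 h2] n1].
  apply: rate_le => //; first exact: H_AD_fin.
  apply: le_trans h1; apply: H_AD_antitone.
  by move: h2; rewrite ler_norml => /andP[+ _]; lra.
case: L claim => [r| |_]; last by rewrite leey.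
  move=> claim; apply/lee_addgt0Pr => e e0; rewrite -EFinN -EFinD.
  have -> : - r + e = - ((r - e / 2) - e / 2) by lra.
  by apply: claim; [rewrite lte_fin gtrBl divr_gt0|rewrite divr_gt0].
(* When the supremum is infinite, [claim] holds for every real rate, which forces the limsup to be
   -oo. *)
move=> claim; have {}claim A : (limn_esup rate <= A%:E)%E.
  by have := claim (- A + 1) 1 (ltry _) ltr01; rewrite addrK opprK.
rewrite /=; case: (limn_esup rate) claim => [s|/(_ 0)|//] //.
by move=> /(_ (s - 1)); rewrite lee_fin lerBrDr gerDl ler10.
Qed.

End sequence.

End rate_function.

Theorem theorem2p3 (R : realType)
  (psi : R -> R)
  (psi_ge0 : forall x, 0 <= psi x)
  (psi_int : (@lebesgue_measure R).-integrable setT (EFin \o psi))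
  (d' : measure_display) (T' : measurableType d') (P_Phi : probability T' R)
  (Z : nat -> {RV P_Phi >-> R})
  (Z_normal : iid_std_normal Z)
  (d : measure_display) (T : measurableType d) (P : probability T R)
  (X : nat -> {RV P >-> R})
  (X_iid : iid X)
  (F : R -> R)
  (F_cdf : forall r, cdf (X 0%N) r = (F r)%:E)
  (F_cont : continuous F)
  (X_sq : P.-integrable setT (fun w => (X 0%N w ^+ 2)%:E)) :
  let mu_F : R := fine 'E_P[X 0%N]%E in
  let sigma_F : R := Num.sqrt (fine 'V_P[X 0%N]%E) in
  let c : R := fine (AD_functional psi F mu_F sigma_F) in
  let L (w : T) (n : nat) : \bar R :=
    (n%:R^-1%:E *
     lne (H_AD Z psi n (fine (AD_statistic psi n (fun j => X j w)))))%E in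
  [/\ cvg (G_AD psi (c + del) @[del --> 0^'+]),
      cvg (G_AD psi (c - del) @[del --> 0^'+]) &
      {ae P, forall w,
        [/\ (- lim (G_AD psi (c + del) @[del --> 0^'+]) <= limn_einf (L w))%E,
            (limn_einf (L w) <= limn_esup (L w))%E &
            (limn_esup (L w) <=
             - lim (G_AD psi (c - del) @[del --> 0^'+]))%E]}].
Proof.
move=> mu_F sigma_F c L; split.
- by apply/cvg_ex; eexists; exact: G_AD_cvg_right.
- by apply/cvg_ex; eexists; exact: G_AD_cvg_left.
(* The only exceptional null set is that of the strong laws; at any other [w] both bounds are
   deterministic statements about a convergent sequence of levels. *)
have := AD_statistic_cvg X_iid F_cdf F_cont X_sq psi_ge0 psi_int.
apply: filterS => w Sc; split.
- exact: (rate_lower psi_ge0 psi_int Z_normal Sc).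
- exact: limn_einf_sup.
- exact: (rate_upper psi_ge0 psi_int Z_normal Sc).
Qed.
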